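(* Let $0<\alpha,p,q<1$ and let $\Lambda,M\subset\mathbb{R}$ be discrete. (i) If there exists $c>0$ such that $\mathrm{D}^-_{\Phi_{1,c}}(\Lambda)$ and $\mathrm{D}^-_{G_\alpha}(M)$ are positive, then $(\Lambda,M)$ is a uniqueness pair for the Hilbert transform $\mathbf{H}$ in $\mathcal{S}(\mathbb{R})$; that is, every $f\in\mathcal{S}(\mathbb{R})$ with $f|_\Lambda=0$ and $\mathbf{H}f|_M=0$ vanishes identically. (ii) If both $\mathrm{D}^+_{G_\alpha}(\Lambda)$ and $\mathrm{D}^+_{G_\alpha}(M)$ are finite, then $(\Lambda,M)$ is a non-uniqueness pair for $\mathbf{H}$ in $\mathcal{S}_{\mathbf{H}}^{p,q}(\mathbb{R})\cap\mathscr{H}(\mathbb{R})$; that is, there is a nonzero $f\in\mathcal{S}_{\mathbf{H}}^{p,q}(\mathbb{R})\cap\mathscr{H}(\mathbb{R})$ with $f|_\Lambda=0$ and $\mathbf{H}f|_M=0$. Here $$\mathcal{S}_{\mathbf{H}}^{p,q}(\mathbb{R})=\Big\{f\in\mathcal{S}(\mathbb{R}):\exists\,c=c_f>0\text{ such that }\sup_{x\in\mathbb{R}}|f(x)|e^{c|x|^p}+\sup_{x\in\mathbb{R}}|\mathbf{H}f(x)|e^{c|x|^q}<\infty\Big\}.$$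
   Context: A set in $\mathbb{R}$ is discrete if it has no accumulation point in $\mathbb{R}$. $\mathcal{S}(\mathbb{R})$ is the Schwartz space (complex-valued functions) and $\mathscr{H}(\mathbb{R})$ is the space of (complex-valued) real-analytic functions on $\mathbb{R}$. For $f\in\mathcal{S}(\mathbb{R})$ the Hilbert transform is $\mathbf{H}f(x)=\mathrm{p.v.}\,\frac1\pi\int_{\mathbb{R}}\frac{f(x-t)}{t}\,dt$. Densities: for an injective $F:\mathbb{R}\to\mathbb{R}$ such that $F(\mathbb{R})$ contains intervals of arbitrarily large length, and $\Gamma\subset\mathbb{R}$ discrete, put for $r>0$ $$M_F(\Gamma,r)=\Big\{\tfrac{\#(F(\Gamma)\cap B)}{|B|}:B\subset F(\mathbb{R})\text{ a ball (interval)},\ |B|=r\Big\},$$ $\mathrm{D}_F^+(\Gamma)=\limsup_{r\to\infty}\sup M_F(\Gamma,r)$ and $\mathrm{D}_F^-(\Gamma)=\liminf_{r\to\infty}\inf M_F(\Gamma,r)$, both in $[0,\infty]$. Changes of variables: $G_\alpha(y)=\mathrm{sgn}(y)|y|^{1/\alpha}$ on $\mathbb{R}$, and $\Phi_{1,c}(x)=\frac{x}{|x|}e^{|x|/c}$ for $x\in\mathbb{R}\setminus\{0\}$, $\Phi_{1,c}(0)=0$. *)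

(* Defs.v *)
From mathcomp Require Import all_boot all_order all_algebra.
From mathcomp Require Import all_classical all_reals all_analysis.
From mathcomp Require Import complex.

Set Implicit Arguments.
Unset Strict Implicit.
Unset Printing Implicit Defensive.

Import Order.TTheory GRing.Theory Num.Theory.
Import numFieldNormedType.Exports.
Import ComplexField.Normc.

Local Open Scope classical_set_scope.
Local Open Scope complex_scope.
Local Open Scope ring_scope.

Definition discrete_set (R : realType) (E : set R) : Prop :=
  limit_point E = set0.

Definition Galpha (R : realType) (alpha y : R) : R :=
  Num.sg y * `|y| `^ alpha^-1.

Definition Phi1 (R : realType) (c x : R) : R :=
  if x == 0 then 0 else x / `|x| * expR (`|x| / c).

(* The set [M_F(Gamma, r)], with open balls; [counting] is [+oo] on infinite
   sets. *)
Definition density_ratios (R : realType) (F : R -> R) (Gamma : set R) (r : R)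
    : set (\bar R) :=
  [set d | exists x e : R, [/\ 0 < e,
     ball x e `<=` range F,
     (lebesgue_measure (ball x e : set R) = r%:E)%E &
     d = (counting (F @` Gamma `&` ball x e) * (r^-1)%:E)%E]].

Definition upper_density (R : realType) (F : R -> R) (Gamma : set R) : \bar R :=
  limf_esup (fun r => ereal_sup (density_ratios F Gamma r)) +oo%R.

Definition lower_density (R : realType) (F : R -> R) (Gamma : set R) : \bar R :=
  limf_einf (fun r => ereal_inf (density_ratios F Gamma r)) +oo%R.

(* Derivatives, principal values and integrals of [f : R -> R[i]] are taken on
   real and imaginary parts separately. *)
Definition Re_fun (R : realType) (f : R -> R[i]) (x : R) : R := complex.Re (f x).
Definition Im_fun (R : realType) (f : R -> R[i]) (x : R) : R := complex.Im (f x).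

Definition cderiven (R : realType) (n : nat) (f : R -> R[i]) (x : R) : R[i] :=
  derive1n n (Re_fun f) x +i* derive1n n (Im_fun f) x.

Definition smooth (R : realType) (f : R -> R[i]) : Prop :=
  forall (n : nat) (x : R),
    derivable (derive1n n (Re_fun f)) x 1 /\
    derivable (derive1n n (Im_fun f)) x 1.

Definition schwartz (R : realType) (f : R -> R[i]) : Prop :=
  smooth f /\
  forall m n : nat, exists C : R, forall x : R,
    `|x| ^+ m * normc (cderiven n f x) <= C.

(* Complex-valued functions on the line with a local power series expansion at
   every point; the cast selects on [R[i]] the topology of the complex norm. *)
Definition real_analytic (R : realType) (f : R -> R[i]) : Prop :=
  forall x0 : R, exists (a : nat -> R[i]) (rho : R), 0 < rho /\
    forall x : R, `|x - x0| < rho ->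
      (series (fun k => a k * (x - x0)%:C ^+ k) : nat -> (R[i] : numFieldType))
        @ \oo --> (f x : (R[i] : numFieldType)).

(* The truncated integrals converge absolutely when [g] is a Schwartz function,
   and their limit exists, so that [Rintegral] and [lim] carry no junk value. *)
Definition real_hilbert (R : realType) (g : R -> R) (x : R) : R :=
  lim ((pi^-1 * \int[lebesgue_measure]_(t in [set t : R | eps < `|t|])
                  (g (x - t) / t)) @[eps --> 0^'+]).

Definition hilbert (R : realType) (f : R -> R[i]) (x : R) : R[i] :=
  real_hilbert (Re_fun f) x +i* real_hilbert (Im_fun f) x.

Definition schwartz_hilbert (R : realType) (p q : R) (f : R -> R[i]) : Prop :=
  schwartz f /\
  exists c : R, 0 < c /\
    (ereal_sup (range (fun x : R =>
        (normc (f x) * expR (c * `|x| `^ p))%:E))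
     + ereal_sup (range (fun x : R =>
        (normc (hilbert f x) * expR (c * `|x| `^ q))%:E)) < +oo)%E.

Definition uniqueness_pair (R : realType) (H : (R -> R[i]) -> R -> R[i])
    (S : set (R -> R[i])) (Lambda M : set R) : Prop :=
  forall f, S f ->
    (forall x, Lambda x -> f x = 0) -> (forall x, M x -> H f x = 0) ->
    forall x, f x = 0.

Definition non_uniqueness_pair (R : realType) (H : (R -> R[i]) -> R -> R[i])
    (S : set (R -> R[i])) (Lambda M : set R) : Prop :=
  exists f, [/\ S f, exists x, f x != 0,
    forall x, Lambda x -> f x = 0 & forall x, M x -> H f x = 0].

(* Main.v *)
(* Part (i). Near [x] the zeros of [f] have gaps of order [e^(-|x|/c)], so Rolle's
   theorem applied to all derivatives gives [f = O(e^(-N|x|))] for every [N]. From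
   [H(xg)(y) = y Hg(y) - (1/pi) \int g] and [Hg(y) = O(1/|y|)], zeros of [Hf] going
   to infinity force all moments of [f] to vanish. The power series of the Fejer
   kernel [(1 - cos T(x - x0)) / (x - x0)^2] then integrates to [0] against [f] for
   every [T], and [T -> oo] gives [f(x0) = 0].

   Part (ii). If [f] decays and extends to the upper half-plane then [Hf = -i f],
   so it is enough that [f] vanishes on both sets. Finite upper density lets one
   enumerate (after adding points) the union of the two sets as a sequence [lam_k]
   with [|lam_k|^(1/alpha) = kappa k + O(1)]. The function is
   [f(y) = \prod_k (i rho_k / (y + i rho_k)) * ((y - lam_k) / (y - lam_k + 2 i w_k))]
   with [w_k = (k+1)^-4] and [rho_k = (k+1)^(1/s)], [s = max p q]: the first factors
   make it decay like [e^(-c|y|^s)], the second ones are Blaschke factors. Power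
   series majorants of the partial products on discs of polynomially small radius
   give analyticity and the bounds on all derivatives. *)

Require Import Defs.
From mathcomp Require Import all_boot all_order all_algebra.
From mathcomp Require Import all_classical all_reals all_analysis.
From mathcomp Require Import measurable_realfun.
From mathcomp Require Import complex ring lra.

Set Implicit Arguments.
Unset Strict Implicit.
Unset Printing Implicit Defensive.

Import Order.TTheory GRing.Theory Num.Theory.
Import numFieldNormedType.Exports.

Local Open Scope classical_set_scope.
Local Open Scope ring_scope.

(** * Lebesgue integrals and principal values on the line *)

(** This condition is linear, and stable under multiplication by a simple pole in the lower
    half-plane and under dominated limits, so partial fractions and the Plemelj limit replace
    contour integrals. The exponents balance competing demands. Since [s < 1], the sum of the
    [1 / rho_k] converges, while about [(|y| / 2)^s] of the [rho_k] are at most [|y| / 2], and each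
    of those contributes a factor at most [2 / 3] to the majorant. The sum of [w_k (k+1)^2]
    converges, which handles the zeros at distance at least [(k+1)^-2] from a given point; only
    boundedly many are closer, because a displacement by [(k+1)^-2] near [lam_k] changes
    [|y|^(1/alpha)] by [O(1)]. The price is a radius of analyticity that shrinks like a power of
    [|y|]: each derivative loses a polynomial factor, harmless against [e^(-c|y|^s)]. *)

Section integrals.
Context {R : realType}.
Local Notation mu := (@lebesgue_measure R).
Local Notation itg f := (mu.-integrable setT (EFin \o f)).
Implicit Types f g F : R -> R.

Lemma le_integrable_fun f g : measurable_fun setT f ->
  (forall x, `|f x| <= g x) -> itg g -> itg f.
Proof.
move=> mf fg ig; apply: le_integrable ig => //; first exact/measurable_EFinP.
move=> x _ /=; rewrite lee_fin (le_trans (fg x))//.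
by rewrite ler_norm.
Qed.

Lemma integrable_measurable f : itg f -> measurable_fun setT f.
Proof. by move=> /integrableP[/measurable_EFinP]. Qed.

Definition reflect_at (x0 : R) : measurableTypeR R -> measurableTypeR R := fun t => x0 - t.

Lemma measurable_reflect (x0 : R) : measurable_fun setT
  (reflect_at x0).
Proof. by apply: measurable_funB. Qed.

(** Lebesgue measure is determined by its values on half-open intervals. Reflection swaps the open
    and the closed end but keeps the length. *)
Lemma lebesgue_measure_reflect (x0 : R) (A : set R) : measurable A ->
  pushforward mu (reflect_at x0) A = mu A.
Proof.
pose nu : {measure set (measurableTypeR R) -> \bar R} :=
  measure_function_pushforward__canonical__measure_function_Measure mu (measurable_reflect x0).
move=> mA; apply/esym/(@lebesgue_measure_unique _ nu) => //= _ [[a b]] _ <-.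
rewrite /pushforward /=.
have -> : reflect_at x0 @^-1` [set` `]a, b]] = [set` `[x0 - b, x0 - a[].
  by apply/seteqP; split => x /=; rewrite /reflect_at !in_itv/= => /andP[h1 h2];
    apply/andP; split; lra.
rewrite !lebesgue_measure_itv/= !lte_fin.
have -> : (x0 - b < x0 - a) = (a < b) by apply/idP/idP; lra.
by case: ifP => // _; rewrite -!EFinD; congr EFin; ring.
Qed.

Lemma integrable_reflect (x0 : R) f : itg f -> itg (fun t => f (x0 - t)).
Proof.
move=> /integrableP[mf fi].
have mf' := measurable_reflect x0.
apply/integrableP; split.
  exact: (@measurableT_comp _ _ _ _ _ _ (EFin \o f) _ _ mf mf').
apply: le_lt_trans fi; rewrite le_eqVlt; apply/orP; left; apply/eqP.
transitivity (\int[pushforward mu (reflect_at x0)]_x `|(EFin \o f) x|)%E.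
  rewrite ge0_integral_pushforward ?preimage_setT//.
  exact: measurableT_comp.
by apply: eq_measure_integral => // A mA _; exact: lebesgue_measure_reflect.
Qed.

Lemma Rintegral_reflect (x0 : R) f : itg f ->
  \int[mu]_x f (x0 - x) = \int[mu]_x f x.
Proof.
move=> fi; have fi' := integrable_reflect x0 fi.
move/integrableP: (fi) => [mf _].
have mf' := measurable_reflect x0.
congr fine; transitivity (\int[pushforward mu (reflect_at x0)]_x ((EFin \o f) x))%E.
  by rewrite integral_pushforward ?preimage_setT.
by apply: eq_measure_integral => // A mA _; exact: lebesgue_measure_reflect.
Qed.

Lemma Rintegral_odd f : itg f -> (forall x, f (- x) = - f x) -> \int[mu]_x f x = 0.
Proof.
move=> fi fo; have := Rintegral_reflect 0 fi.
under eq_Rintegral do rewrite sub0r fo -mulN1r.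
rewrite RintegralZl// mulN1r; lra.
Qed.

Lemma Rdominated_convergence (f_ : nat -> R -> R) f g :
  (forall n, measurable_fun setT (f_ n)) -> measurable_fun setT f -> itg g ->
  (forall n x, `|f_ n x| <= g x) ->
  (forall x, f_ ^~ x @ \oo --> f x) ->
  itg f /\ \int[mu]_x f_ n x @[n --> \oo] --> \int[mu]_x f x.
Proof.
move=> mf_ mf ig fg ff.
have [] := @dominated_convergence _ _ _ mu setT measurableT (fun n => EFin \o f_ n)
  (EFin \o f) (EFin \o g).
- by move=> n; apply/measurable_EFinP; exact: mf_.
- by apply/measurable_EFinP; exact: mf.
- by apply: aeW => x _; apply: cvg_EFin; [exact: nearW|exact: ff].
- by [].
- by apply: aeW => x n _ /=; rewrite lee_fin.
move=> fi _ h; split => //.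
rewrite /Rintegral; apply: fine_cvg; rewrite fineK; first exact: h.
exact: integrable_fin_num.
Qed.

Lemma le_norm_Rintegral f g : measurable_fun setT f -> itg g ->
  (forall x, `|f x| <= g x) -> `|\int[mu]_x f x| <= \int[mu]_x g x.
Proof.
move=> mf ig fg; have fi := le_integrable_fun mf fg ig.
apply: (le_trans (le_normr_Rintegral _ fi)) => //.
apply: le_Rintegral => //.
by apply: (le_integrable_fun _ _ ig) => [|x]; [exact: measurableT_comp|rewrite normr_id].
Qed.

Lemma is_derive_continuous F g : (forall x : R, is_derive x (1 : R) F (g x)) -> continuous F.
Proof.
by move=> dF x; apply: differentiable_continuous; apply/derivable1_diffP; have [] := dF x.
Qed.

Lemma Rintegral_FTC F g a b : a < b -> (forall x : R, is_derive x (1 : R) F (g x)) ->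
  continuous g -> \int[mu]_(x in `[a, b]) g x = F b - F a.
Proof.
move=> ab dF cg; rewrite /Rintegral (@continuous_FTC2 _ g F)//.
- exact: continuous_subspaceT.
- have cF := is_derive_continuous dF.
  split; first by move=> x _; have [] := dF x.
    by apply: cvg_at_right_filter; exact: cF.
  by apply: cvg_at_left_filter; exact: cF.
- by move=> x _; rewrite derive1E; have [] := dF x.
Qed.

(** Integrability being assumed, a symmetric limit of [F] is enough, as for logarithms, which have
    no limits at infinity: the truncations of [g] to [[-n, n]] are dominated by [|g|]. *)
Lemma RintegralT_FTC F g l : (forall x : R, is_derive x (1 : R) F (g x)) ->
  continuous g -> itg g -> F n%:R - F (- n%:R) @[n --> \oo] --> l ->
  \int[mu]_x g x = l.
Proof.
move=> dF cg ig Fl.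
have mg := integrable_measurable ig.
have [] := @Rdominated_convergence (fun n => g \_ `[- n%:R, n%:R]) g (fun x => `|g x|).
- by move=> n; apply/(measurable_restrictT _ (measurable_itv _)); exact: measurable_funTS.
- exact: mg.
- exact: integrable_norm.
- by move=> n x /=; rewrite patchE; case: ifP => _ //; rewrite normr0.
- move=> x; apply: cvg_near_cst; exists (Num.trunc `|x|).+1 => // n /= hn.
  rewrite patchE mem_set//= in_itv/= -ler_norml.
  by rewrite (le_trans (ltW (truncnS_gt _)))// ler_nat.
move=> _ h.
apply: (cvg_unique _ h) => //.
move: Fl; apply: cvg_trans; apply: near_eq_cvg; exists 1%N => // n /= n0.
rewrite -Rintegral_mkcond (Rintegral_FTC _ dF)// gtrN//.
by rewrite ltr0n.
Qed.

End integrals.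

(** * Principal values as absolutely convergent integrals *)

Section pv.
Context {R : realType}.
Local Notation mu := (@lebesgue_measure R).
Local Notation itg f := (mu.-integrable setT (EFin \o f)).
Implicit Types f g F : R -> R.

Lemma integrable_inv1Dsqr : itg (fun x : R => (1 + x ^+ 2)^-1).
Proof.
have cf : continuous (fun x : R => (1 + x ^+ 2)^-1) by exact: continuous_oneDsqrV.
apply/integrableP; split.
  by apply/measurable_EFinP; exact: continuous_measurable_fun.
have pos (x : R) : 0 <= (1 + x ^+ 2)^-1 by rewrite invr_ge0 addr_ge0// sqr_ge0.
under eq_integral do rewrite /= ger0_norm//.
rewrite ge0_symfun_integralT//; last by move=> x /=; rewrite sqrrN.
rewrite (_ : [set x | 0 <= x] = `[0, +oo[%classic); last first.
  by apply/seteqP; split => x /=; rewrite in_itv/= andbT.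
have := @integral0y_oneDsqr R; rewrite /oneDsqr => ->.
by rewrite -EFinM ltry.
Qed.

Lemma integrable_inv_bound f K : measurable_fun setT f ->
  (forall x, `|f x| <= K / (1 + x ^+ 2)) -> itg f.
Proof.
move=> mf fK; apply: (le_integrable_fun mf fK).
by have := integrableZl measurableT K integrable_inv1Dsqr.
Qed.

(* The subtracted term is odd after division by [t], hence integrates to [0] on
   [eps < `|t|]; it makes the principal value absolutely convergent. *)
Definition pvker g (x t : R) : R := (g (x - t) - g x * (`|t| <= 1)%R%:R) / t.

Lemma measurable_funV f : measurable_fun setT f ->
  measurable_fun setT (fun x => (f x)^-1).
Proof.
move=> mf; rewrite (_ : (fun _ => _) = fun x => f x * ((f x) ^+ 2) `^ (-1)).
  apply: measurable_funM => //.
  apply: (@measurableT_comp _ _ _ _ _ _ (@powR R ^~ (-1)) _ (fun x => f x ^+ 2)).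
    exact: measurable_powR.
  exact: measurable_funX.
apply/funext => x; rewrite powR_inv1 ?sqr_ge0//.
have [->|f0] := eqVneq (f x) 0; first by rewrite invr0 mul0r.
by field.
Qed.

Lemma measurable_boolr (P : R -> bool) : measurable [set x | P x] ->
  measurable_fun setT (fun t : R => (P t)%:R : R).
Proof.
move=> mP; rewrite (_ : (fun _ => _) = \1_[set x | P x]).
  exact: measurable_indic.
by apply/funext => x; rewrite indicE; congr (nat_of_bool _)%:R; apply/idP/idP; rewrite inE.
Qed.

Lemma measurable_norm_le (c : R) : measurable [set t : R | `|t| <= c].
Proof.
rewrite (_ : [set _ | _] = `[- c, c]%classic)//.
by apply/seteqP; split => x /=; rewrite in_itv/= ler_norml.
Qed.

Lemma measurable_norm_gt (c : R) : measurable [set t : R | c < `|t|].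
Proof.
rewrite (_ : [set _ | _] = ~` [set t : R | `|t| <= c]); last first.
  by apply/seteqP; split => x /=; rewrite ltNge => /negP.
by apply: measurableC; exact: measurable_norm_le.
Qed.

Lemma measurable_pvker g x : measurable_fun setT g -> measurable_fun setT (pvker g x).
Proof.
move=> mg; apply: measurable_funM.
  apply: measurable_funB.
    exact: (measurableT_comp mg (measurable_reflect x)).
  by apply: measurable_funM => //; apply: measurable_boolr; exact: measurable_norm_le.
exact: (@measurable_funV id).
Qed.

Lemma Rintegral_cut_inv (c eps : R) : 0 < eps ->
  itg ((fun t => c * (`|t| <= 1)%R%:R / t) \_ [set t | eps < `|t|]) /\
  \int[mu]_(t in [set t | eps < `|t|]) (c * (`|t| <= 1)%R%:R / t) = 0.
Proof.
move=> e0; rewrite Rintegral_mkcond.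
set h := (X in itg X); have ih : itg h.
  apply: (@integrable_inv_bound _ (`|c| * 2 / eps)).
    apply/(measurable_restrictT _ (measurable_norm_gt _)); apply: measurable_funTS.
    apply: measurable_funM; last exact: (@measurable_funV id).
    by apply: measurable_funM => //; apply: measurable_boolr; exact: measurable_norm_le.
  move=> x; have p : 0 < 1 + x ^+ 2 by rewrite ltr_pwDl// sqr_ge0.
  rewrite /h patchE; case: ifPn => [|_]; last first.
    by rewrite normr0 divr_ge0 ?(ltW p)// divr_ge0 ?mulr_ge0// ltW.
  rewrite inE/= => ex; rewrite ler_pdivlMr// !normrM -!mulrA ler_wpM2l//.
  case: (leP `|x| 1) => x1; last by rewrite normr0 !mul0r mulr_ge0// invr_ge0 ltW.
  rewrite normr1 mul1r mulrC; apply: ler_pM; rewrite ?(ltW p)//.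
    suff : x ^+ 2 <= 1 by lra.
    by rewrite -real_normK ?num_real// expr_le1.
  by rewrite normfV lef_pV2 ?posrE ?(lt_trans e0 ex)// ltW.
split => //; apply: Rintegral_odd => // x; rewrite /h !patchE.
have -> : (- x \in [set t : R | eps < `|t|]) = (x \in [set t : R | eps < `|t|]).
  by apply/idP/idP; rewrite !inE/= normrN.
by case: ifP => _; rewrite ?oppr0// normrN invrN mulrN.
Qed.

(** Each truncated integral is unchanged by the subtraction of the odd term, so the principal value
    becomes a dominated limit of truncations of one integrable function. *)
Lemma real_hilbertE g x : measurable_fun setT g -> itg (pvker g x) ->
  real_hilbert g x = pi^-1 * \int[mu]_t pvker g x t.
Proof.
move=> mg ig; apply: cvg_lim => //.
apply: (cvgM (cvg_cst _)) => //.
apply/(cvg_at_rightP _ _ _) => u [u0 ucvg].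
have mp := measurable_pvker x mg.
have [] := @Rdominated_convergence R (fun n => (pvker g x) \_ [set t | u n < `|t|])
  (pvker g x) (fun t => `|pvker g x t|).
- move=> n; apply/(measurable_restrictT _ (measurable_norm_gt _)).
  exact: measurable_funTS.
- exact: mp.
- exact: integrable_norm.
- by move=> n t /=; rewrite patchE; case: ifP => _ //; rewrite normr0.
(* At [t = 0] the truncation never captures the point, but the kernel itself is [0] there because
   [0^-1 = 0]. *)
- move=> t; have [->|t0] := eqVneq t 0.
    rewrite (_ : (fun _ => _) = cst (pvker g x 0)); first exact: cvg_cst.
    by apply/funext => n; rewrite patchE/= /pvker invr0 !mulr0; case: ifP.
  apply: cvg_near_cst; have t0' : 0 < `|t| by rewrite normr_gt0.
  have /cvgr0Pnorm_lt/(_ _ t0') := ucvg; apply: filterS => n.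
  by rewrite (ger0_norm (ltW (u0 n))) => ut; rewrite patchE mem_set.
move=> _; apply: cvg_trans; apply: near_eq_cvg; apply: nearW => n /=.
have [i1 e1] := Rintegral_cut_inv (g x) (u0 n).
have mn := measurable_norm_gt (u n).
rewrite -Rintegral_mkcond -[LHS]addr0 -e1 -RintegralD//; last 2 first.
- exact: integrableS ig.
- have := @integrableS _ _ _ mu _ _ _ measurableT mn (@subsetT _ _) i1.
  by apply: eq_integrable => // t tn; rewrite /= patchE tn.
apply: eq_Rintegral => t _; rewrite /pvker; ring.
Qed.

(** The three summands of the constant come from three ranges of [t]: the Lipschitz bound for
    [|t| <= r], boundedness of [g] for [r < |t| <= 1], and decay of [g] for [|t| > 1]. *)
Lemma pvker_bound g x r L C : 0 < r <= 1 -> 0 <= L -> 0 <= C ->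
  (forall t, `|t| <= r -> `|g (x - t) - g x| <= L * `|t|) ->
  (forall y, `|g y| <= C / (1 + `|y|)) ->
  forall t, `|pvker g x t| <= (2 * L + 4 * C / r + C * (1 + `|x|)) / (1 + t ^+ 2).
Proof.
move=> /andP[r0 r1] L0 C0 gL gC t.
have p : 0 < 1 + t ^+ 2 by rewrite ltr_pwDl// sqr_ge0.
have a1 : 0 <= 4 * C / r by rewrite divr_ge0 ?mulr_ge0// ltW.
have a2 : 0 <= C * (1 + `|x|) by rewrite mulr_ge0// addr_ge0.
have gC' y : `|g y| <= C.
  apply: (le_trans (gC y)); rewrite ler_pdivrMr ?ltr_pwDl//.
  by rewrite mulrDr mulr1 lerDl mulr_ge0.
have [->|t0] := eqVneq t 0.
  rewrite /pvker invr0 mulr0 normr0 divr_ge0// ?(ltW p)//.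
  by rewrite !addr_ge0// mulr_ge0.
rewrite ler_pdivlMr// /pvker normrM normfV.
have nt0 : 0 < `|t| by rewrite normr_gt0.
have t2 : t ^+ 2 = `|t| ^+ 2 by rewrite real_normK ?num_real.
have [tr|tr] := leP `|t| r.
  have -> : (`|t| <= 1) by rewrite (le_trans tr).
  rewrite mulr1; have : `|g (x - t) - g x| / `|t| <= L by rewrite ler_pdivrMr ?gL.
  have : 0 <= `|g (x - t) - g x| / `|t| by rewrite divr_ge0.
  move: (_ / _) => q q0 qL.
  have : 1 + t ^+ 2 <= 2 by rewrite t2; have := @expr_le1 _ 2 `|t| isT (ltW nt0); rewrite (le_trans tr r1); lra.
  nra.
have [t1|t1] := leP `|t| 1.
  rewrite mulr1; have : `|g (x - t) - g x| / `|t| <= 2 * C / r.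
    apply: ler_pM; rewrite ?invr_ge0 ?(ltW nt0)//.
      by apply: (le_trans (ler_normB _ _)); have := gC' x; have := gC' (x - t); lra.
    by rewrite lef_pV2 ?posrE// ltW.
  have : 0 <= `|g (x - t) - g x| / `|t| by rewrite divr_ge0.
  move: (`|_| / _) => q q0 qL.
  have : 1 + t ^+ 2 <= 2 by rewrite t2; have := @expr_le1 _ 2 `|t| isT (ltW nt0); rewrite t1; lra.
  have -> : 4 * C / r = 2 * (2 * C / r) by ring.
  move: (2 * C / r) qL => w; nra.
rewrite mulr0 subr0.
(* Peetre's inequality: decay in [x - t] becomes decay in [t] at the cost of a factor [1 + |x|]. *)
have h1 : 1 + `|t| <= (1 + `|x - t|) * (1 + `|x|).
  have := ler_normB x (x - t); rewrite (_ : x - (x - t) = t); last by ring.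
  have := normr_ge0 x; have := normr_ge0 (x - t); nra.
have h2 : 0 < 1 + `|x - t| by rewrite ltr_pwDl.
apply: (@le_trans _ _ (C * (1 + `|x|))); last by rewrite lerDr addr_ge0// mulr_ge0.
rewrite mulrAC ler_pdivrMr//.
apply: (@le_trans _ _ (C / (1 + `|x - t|) * (1 + t ^+ 2))).
  by rewrite ler_wpM2r ?gC ?(ltW p).
rewrite mulrAC ler_pdivrMr// -!mulrA ler_wpM2l// t2.
have := normr_ge0 x; have := normr_ge0 (x - t); nra.
Qed.

End pv.

(** * Sums, powers and exponentials *)

Section sums.
Context {R : realType}.
Implicit Types (x y u v : R).

Lemma sum_telescope_le (e b : nat -> R) B n : (forall k, e k <= B * (b k - b k.+1)) ->
  \sum_(k < n) e k <= B * (b 0%N - b n).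
Proof.
move=> eb; elim: n => [|n IH]; first by rewrite big_ord0 subrr mulr0.
rewrite big_ord_recr/= (le_trans (lerD IH (eb n)))//.
by rewrite -mulrDr subrKA.
Qed.

Lemma sum_inv_sqr n : \sum_(k < n) ((k.+1%:R ^+ 2)^-1 : R) <= 2.
Proof.
pose b k : R := k.+1%:R^-1.
apply: (@le_trans _ _ (2 * (b 0%N - b n))).
  apply: (@sum_telescope_le (fun k => (k.+1%:R ^+ 2)^-1) b 2) => k; rewrite /b.
  have p1 : 0 < k.+1%:R :> R by rewrite ltr0n.
  have e : k.+2%:R = k.+1%:R + 1 :> R by rewrite -natr1.
  rewrite e; move: (k.+1%:R) p1 (ler1n R k.+1) => q q0 q1.
  rewrite (_ : q^-1 - (q + 1)^-1 = (q * (q + 1))^-1); last first.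
    by field; rewrite ?gt_eqF// ltr_wpDl// ltW.
  rewrite mulrC ler_pdivlMl ?mulr_gt0 ?addr_gt0// ler_pdivrMr ?exprn_gt0//.
  by move: q1; rewrite ltn0Sn => q1; nra.
rewrite /b invr1 mulrBr mulr1 gerBl.
by rewrite mulr_ge0// invr_ge0.
Qed.

Lemma one_sub_exp_le (q : R) J : 0 <= q <= 1 -> 1 - q ^+ J <= J%:R * (1 - q).
Proof.
move=> /andP[q0 q1]; elim: J => [|J IH]; first by rewrite expr0 subrr mul0r.
rewrite exprS -natr1; have : q ^+ J <= 1 by rewrite exprn_ile1.
by move: IH; move: (q ^+ J) (J%:R) => Q j; nra.
Qed.

(** Comparison with the telescoping sequence [k^-d], [d = theta - 1]. The integer [J] satisfies
    [d J >= 1], so [q^(d J) <= q] for [q] in [[0, 1]], and Bernoulli's inequality for the integer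
    exponent [J] replaces the mean value theorem for real powers. *)
Lemma sum_inv_powR (theta : R) : 1 < theta ->
  exists2 S, 0 <= S & forall n, \sum_(k < n) (k.+1%:R `^ theta)^-1 <= S.
Proof.
move=> t1; pose d := theta - 1; have d0 : 0 < d by rewrite subr_gt0.
pose J := (Num.trunc d^-1).+1.
have Jd : 1 <= d * J%:R.
  by rewrite mulrC -ler_pdivrMr// div1r ltW// truncnS_gt.
pose b k : R := (k.+1%:R `^ d)^-1.
exists (2 * J%:R) => //; move=> n.
apply: (@le_trans _ _ (2 * J%:R * (b 0%N - b n))); last first.
  rewrite ler_piMr// /b powR1 invr1 gerBl invr_ge0; exact: powR_ge0.
apply: (@sum_telescope_le (fun k => (k.+1%:R `^ theta)^-1) b) => k; rewrite /b.
have e : k.+2%:R = k.+1%:R + 1 :> R by rewrite -natr1.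
have p1 : 1 <= k.+1%:R :> R by rewrite ler1n.
rewrite e; move: (k.+1%:R : R) p1 => y y1.
have y0 : 0 < y by rewrite (lt_le_trans _ y1).
have z0 : 0 < y + 1 by rewrite addr_gt0.
pose q := y / (y + 1).
have q0 : 0 <= q by rewrite divr_ge0// ltW.
have q1 : q <= 1 by rewrite ler_pdivrMr// mul1r lerDl.
have h1 : 1 - q <= J%:R * (1 - q `^ d).
  have qd : q `^ d <= 1.
    have := ge0_ler_powR (ltW d0) _ _ q1; rewrite powR1; apply; rewrite nnegrE//.
  apply: le_trans (one_sub_exp_le J _); last by rewrite powR_ge0 qd.
  rewrite lerD2l lerN2 -powR_mulrn ?powR_ge0// -powRrM.
  have [->|qn0] := eqVneq q 0; first by rewrite powR0// gt_eqF// (lt_le_trans _ Jd).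
  rewrite -[leRHS]powRr1//; apply: ger_powR => //.
  by rewrite q1 lt_def qn0 q0.
have h2 : (y `^ theta)^-1 = (y `^ d)^-1 / y.
  rewrite -invfM -[X in _ * X]powRr1 ?(ltW y0)// -powRD; last by rewrite (gt_eqF y0) implybT.
  by rewrite /d subrK.
have h3 : (y `^ d)^-1 - ((y + 1) `^ d)^-1 = (y `^ d)^-1 * (1 - q `^ d).
  have -> : y `^ d = q `^ d * (y + 1) `^ d.
    by rewrite -powRM// ?(ltW z0)// /q divfK// gt_eqF.
  have qp : 0 < q by rewrite divr_gt0.
  by field; rewrite ?gt_eqF ?powR_gt0.
rewrite h2 h3 mulrCA ler_wpM2l ?invr_ge0 ?powR_ge0//.
rewrite -mulrA; apply: le_trans (ler_wpM2l _ h1) => //.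
rewrite /q (_ : 1 - y / (y + 1) = (y + 1)^-1); last by field; rewrite gt_eqF.
by rewrite ler_pdivlMr// mulrC ler_pdivrMr//; lra.
Qed.

(** From the least index satisfying [P] on, all others lie in a window of [D + 1] indices. *)
Lemma sum_spread (P : nat -> bool) D n : (forall k l, P k -> P l -> (k <= l + D)%N) ->
  \sum_(k < n) (P k)%:R <= D.+1%:R :> R.
Proof.
move=> PD; rewrite -natr_sum ler_nat.
have [exP|nP] := pselect (exists l, P l); last first.
  by rewrite big1// => i _; case: (boolP (P i)) => // Pi; exfalso; apply: nP; exists i.
case: (ex_minnP exP) => l Pl lmin.
apply: (@leq_trans (\sum_(0 <= k < n) (l <= k <= l + D)%N)).
  rewrite big_mkord; apply: leq_sum => i _; case: (boolP (P i)) => // Pi.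
  by rewrite lmin// PD.
rewrite -big_mkcond/= sum1_count -size_filter /index_iota subn0.
apply: (@leq_trans (size (iota l D.+1))); last by rewrite size_iota.
apply: uniq_leq_size; first by rewrite filter_uniq// iota_uniq.
by move=> i; rewrite mem_filter mem_iota => /andP[/andP[h1 h2] _]; rewrite mem_iota h1 addnS ltnS.
Qed.

Lemma powRD1_le (b y : R) : 0 <= b -> 0 <= y -> (y + 1) `^ b <= 2 `^ b * (1 + y `^ b).
Proof.
move=> b0 y0; have [y1|y1] := leP y 1.
  apply: (@le_trans _ _ (2 `^ b)).
    by apply: ge0_ler_powR; rewrite ?nnegrE//; lra.
  by rewrite ler_peMr ?powR_ge0// lerDl powR_ge0.
apply: (@le_trans _ _ ((2 * y) `^ b)).
  by apply: ge0_ler_powR; rewrite ?nnegrE//; lra.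
by rewrite powRM// ler_wpM2l ?powR_ge0// lerDr.
Qed.

(** Bernoulli's inequality for [u / v] gives the slope [J v^(b-1)]; the weaker [J (1 + v^b)] avoids
    the exponent [b - 1] and is what the enumeration of the zeros controls. *)
Lemma powR_lip (b : R) J u v : 1 <= b <= J%:R -> 0 <= u <= v ->
  v `^ b - u `^ b <= J%:R * (1 + v `^ b) * (v - u).
Proof.
move=> /andP[b1 bJ] /andP[u0 uv]; have v0 := le_trans u0 uv.
have b0 : 0 < b by rewrite (lt_le_trans _ b1).
have [v00|vn0] := eqVneq v 0.
  have u00 : u = 0 by apply/eqP; rewrite eq_le u0 andbT -v00.
  by rewrite v00 u00 !subrr mulr0.
have vp : 0 < v by rewrite lt_def vn0.
pose q := u / v.
have q0 : 0 <= q by rewrite divr_ge0.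
have q1 : q <= 1 by rewrite ler_pdivrMr// mul1r.
have ub : u `^ b = v `^ b * q `^ b.
  by rewrite /q -powRM// mulrC divfK.
have qb : 1 - q `^ b <= J%:R * (1 - q).
  apply: le_trans (one_sub_exp_le J _); last by rewrite q0 q1.
  rewrite lerD2l lerN2 -powR_mulrn//.
  have [->|qn0] := eqVneq q 0; first by rewrite !powR0// gt_eqF// (lt_le_trans b0).
  by apply: ger_powR => //; rewrite q1 lt_def qn0 q0.
rewrite ub -{1}[v `^ b]mulr1 -mulrBr.
apply: le_trans (ler_wpM2l (powR_ge0 _ _) qb) _.
rewrite mulrCA -mulrA ler_wpM2l//.
have e : v - u = v * (1 - q) by rewrite mulrBr mulr1 /q mulrC divfK.
rewrite e mulrA ler_wpM2r ?subr_ge0//.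
have [v1|v1] := leP v 1.
  apply: (@le_trans _ _ v); last by rewrite mulrDl mul1r lerDl mulr_ge0// powR_ge0.
  rewrite -[leRHS]powRr1 ?(ltW vp)//; apply: ger_powR => //.
  by rewrite vp v1.
have pv := powR_ge0 v b; nra.
Qed.

Lemma powR_le_expr (b : R) J y : 0 <= b <= J%:R -> 0 <= y -> y `^ b <= (1 + y) ^+ J.
Proof.
move=> /andP[b0 bJ] y0; rewrite -powR_mulrn ?addr_ge0//.
apply: (@le_trans _ _ ((1 + y) `^ b)).
  by apply: ge0_ler_powR; rewrite ?nnegrE//; lra.
by apply: ler_powR => //; rewrite lerDl.
Qed.

Lemma expr_le_expR (v : R) j : 0 <= v -> v ^+ j.+1 <= j.+1`!%:R * expR v.
Proof.
move=> v0; have := expR_ge1Dxn j v0.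
have p : 0 < j.+1`!%:R :> R by rewrite ltr0n fact_gt0.
by move=> h; rewrite [leRHS]mulrC -ler_pdivrMr//; lra.
Qed.

(** For [y >= 1], [j] is large enough that [y^m <= (y^s)^(j+1)], and a single term of the
    exponential series then dominates. *)
Lemma poly_expR_bounded (c s : R) m : 0 < c -> 0 < s ->
  exists2 B, 0 <= B & forall y, 0 <= y -> (1 + y) ^+ m * expR (- (c * y `^ s)) <= B.
Proof.
move=> c0 s0; pose j := (Num.trunc (m%:R / s)).
have js : m%:R <= s * j.+1%:R.
  by rewrite mulrC -ler_pdivrMr// ltW// truncnS_gt.
have j0 : 0 <= j.+1`!%:R / c ^+ j.+1 by rewrite divr_ge0 ?exprn_ge0// ltW.
exists (2 ^+ m * (1 + j.+1`!%:R / c ^+ j.+1)).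
  by rewrite mulr_ge0 ?exprn_ge0// addr_ge0.
move=> y y0; have ys := powR_ge0 y s.
have e1 : expR (- (c * y `^ s)) <= 1.
  by rewrite expR_le1 oppr_le0 mulr_ge0// ltW.
have e0 := expR_ge0 (- (c * y `^ s)).
have [y1|y1] := leP y 1.
  apply: ler_pM => //; first by rewrite exprn_ge0// addr_ge0.
    by rewrite lerXn2r ?nnegrE//; lra.
  by rewrite (le_trans e1)// lerDl.
apply: (@le_trans _ _ ((2 * y) ^+ m * expR (- (c * y `^ s)))).
  by rewrite ler_wpM2r// lerXn2r ?nnegrE//; lra.
rewrite exprMn -mulrA ler_wpM2l ?exprn_ge0//.
apply: (@le_trans _ _ (j.+1`!%:R / c ^+ j.+1)); last by rewrite lerDr.
have ym : y ^+ m <= (y `^ s) ^+ j.+1.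
  rewrite -powR_mulrn// -powR_mulrn// -powRrM; apply: ler_powR => //; exact: ltW.
apply: (le_trans (ler_wpM2r e0 ym)).
rewrite ler_pdivlMr ?exprn_gt0// mulrAC -exprMn [y `^ s * c]mulrC.
rewrite expRN ler_pdivrMr ?expR_gt0//.
by apply: expr_le_expR; rewrite mulr_ge0// ltW.
Qed.

Lemma prod1D_le_expR (t : nat -> R) n : (forall k, 0 <= t k) ->
  \prod_(k < n) (1 + t k) <= expR (\sum_(k < n) t k).
Proof.
move=> t0; elim: n => [|n IH]; first by rewrite !big_ord0 expR0.
rewrite !big_ord_recr/= expRD ler_pM ?expR_ge1Dx ?addr_ge0//.
by apply: prodr_ge0 => i _; rewrite addr_ge0.
Qed.

(* A product of factors in [0, 1] with summable defect stays away from [0]. *)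
Lemma prod_bounded_below (b : nat -> R) S : (forall k, 0 < b k <= 1) ->
  (forall n, \sum_(k < n) (1 - b k) <= S) ->
  exists2 d, 0 < d & forall n, d <= \prod_(k < n) b k.
Proof.
move=> b01 bS.
have b1 k : 0 <= 1 - b k by have /andP[_] := b01 k; lra.
have [N hN] : exists N, forall n, \sum_(k < n) (1 - b (N + k)%N) <= 2^-1.
  have cS : cvgn (fun n => \sum_(k < n) (1 - b k)).
    apply: nondecreasing_is_cvgn.
      by apply/nondecreasing_seqP => n; rewrite big_ord_recr/= lerDl.
    by exists S => _ [n _ <-]; exact: bS.
  pose L := limn (fun n => \sum_(k < n) (1 - b k)).
  have half : 0 < 2^-1 :> R by rewrite invr_gt0.
  have /cvgrPdist_le/(_ _ half)[N _ h] := cS; exists N => n.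
  have h1 := h N (leqnn _).
  have nd : nondecreasing_seq (fun n => \sum_(k < n) (1 - b k)).
    by apply/nondecreasing_seqP => m; rewrite big_ord_recr/= lerDl.
  have h2 := nondecreasing_cvgn_le nd cS (N + n)%N.
  rewrite big_split_ord/= in h2.
  have h3 := le_trans (ler_norm _) h1.
  by move: h2 h3; rewrite -/L; lra.
(* Weierstrass' product inequality: past [N] the total defect is at most [1/2], so the tail product
   is at least [1/2], and the first [N] factors contribute a fixed positive number. *)
have lb n : 1 - \sum_(k < n) (1 - b (N + k)%N) <= \prod_(k < n) b (N + k)%N.
  elim: n => [|n IH]; first by rewrite !big_ord0 subr0.
  rewrite !big_ord_recr/=; have /andP[p1 p2] := b01 (N + n)%N.
  have q1 : \prod_(k < n) b (N + k)%N <= 1.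
    elim: n {IH p1 p2} => [|n IH]; first by rewrite big_ord0.
    have /andP[/ltW p1 p2] := b01 (N + n)%N.
    rewrite big_ord_recr/= mulr_ile1//.
    by apply: prodr_ge0 => i _; have /andP[/ltW] := b01 (N + i)%N.
  have q0 : 0 <= \prod_(k < n) b (N + k)%N.
    by apply: prodr_ge0 => i _; have /andP[/ltW] := b01 (N + i)%N.
  by move: IH p1 p2 q1 q0; move: (\sum_(k < n) _) (\prod_(k < n) _) (b _) => s p q; nra.
have P0 : 0 < \prod_(k < N) b k by apply: prodr_gt0 => i _; have /andP[] := b01 i.
exists (\prod_(k < N) b k / 2); first by rewrite divr_gt0.
move=> n; apply: (@le_trans _ _ (\prod_(k < N + n) b k)).
  rewrite big_split_ord/= ler_wpM2l ?(ltW P0)//.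
  by have := lb n; have := hN n; lra.
elim: N {hN lb P0} => [|N IH]; first by rewrite add0n.
rewrite addSn big_ord_recr/=; apply: le_trans IH.
rewrite ler_piMr//; last by have /andP[] := b01 (N + n)%N.
by apply: prodr_ge0 => i _; have /andP[/ltW] := b01 i.
Qed.

End sums.

(** * Complex-valued functions on the line *)

Section complex_basics.
Local Open Scope complex_scope.
Context {R : realType}.
Local Notation C := R[i].
Local Notation Re := (@complex.Re R).
Local Notation Im := (@complex.Im R).
Local Notation normc := (@Normc.normc R).
Implicit Types z w : C.

Lemma normcE2 z : normc z = Num.sqrt (Re z ^+ 2 + Im z ^+ 2).
Proof. by case: z. Qed.

Lemma normc_ge0 z : 0 <= normc z.
Proof. by rewrite normcE2 sqrtr_ge0. Qed.

Lemma Re_le_normc z : `|Re z| <= normc z.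
Proof. by rewrite normcE2 -sqrtr_sqr ler_wsqrtr// lerDl sqr_ge0. Qed.

Lemma Im_le_normc z : `|Im z| <= normc z.
Proof. by rewrite normcE2 -sqrtr_sqr ler_wsqrtr// lerDr sqr_ge0. Qed.

Lemma normc_le_ReIm z : normc z <= `|Re z| + `|Im z|.
Proof.
rewrite normcE2 -[leRHS]ger0_norm ?addr_ge0// -sqrtr_sqr ler_wsqrtr//.
rewrite sqrrD !real_normK ?num_real// lerD2r lerDl.
by rewrite mulrn_wge0// mulr_ge0.
Qed.

Lemma normc_real (x : R) : normc x%:C = `|x|.
Proof. by rewrite normcE2/= expr0n addr0 sqrtr_sqr. Qed.

Lemma normcD z w : normc (z + w) <= normc z + normc w.
Proof. exact: (@le_normcD R z w). Qed.

Lemma normcB z w : normc (z - w) <= normc z + normc w.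
Proof. by have := normcD z (- w); rewrite (@normcN R). Qed.

Lemma normcX z n : normc (z ^+ n) = normc z ^+ n.
Proof. by elim: n => [|n IH]; rewrite ?expr0 ?Normc.normc1// !exprS Normc.normcM IH. Qed.

Lemma normc_eq0 z : (normc z == 0) = (z == 0).
Proof.
apply/eqP/eqP => [/Normc.eq0_normc//|->]; exact: Normc.normc0.
Qed.

Lemma normc_gt0 z : (0 < normc z) = (z != 0).
Proof. by rewrite lt_def normc_ge0 normc_eq0 andbT. Qed.

Lemma normrCE z : `|z| = (normc z)%:C.
Proof. by []. Qed.

Lemma cReM z w : Re (z * w) = Re z * Re w - Im z * Im w.
Proof. by case: z; case: w. Qed.
Lemma cImM z w : Im (z * w) = Re z * Im w + Im z * Re w.
Proof. by case: z; case: w. Qed.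
Lemma cReD z w : Re (z + w) = Re z + Re w.
Proof. by case: z; case: w. Qed.
Lemma cImD z w : Im (z + w) = Im z + Im w.
Proof. by case: z; case: w. Qed.
Lemma cReN z : Re (- z) = - Re z.
Proof. by case: z. Qed.
Lemma cImN z : Im (- z) = - Im z.
Proof. by case: z. Qed.
Lemma cReV z : Re z^-1 = Re z / (Re z ^+ 2 + Im z ^+ 2).
Proof. by case: z. Qed.
Lemma cImV z : Im z^-1 = - (Im z / (Re z ^+ 2 + Im z ^+ 2)).
Proof. by case: z. Qed.
Definition ReImE := (cReM, cImM, cReD, cImD, cReN, cImN, cReV, cImV).

Lemma eq_ReIm z w : Re z = Re w -> Im z = Im w -> z = w.
Proof. by case: z => a b; case: w => c d /= -> ->. Qed.

Lemma subC_neq0 (s : R) (a : C) : Im a < 0 -> s%:C - a != 0.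
Proof.
move=> a0; apply: contraTneq a0 => /(congr1 Im); rewrite !ReImE/= sub0r => /eqP.
by rewrite oppr_eq0 => /eqP ->; rewrite ltxx.
Qed.

Lemma normc_sub_ge (a : C) (s : R) : Im a < 0 ->
  1 + `|s| <= ((1 + normc a) / - Im a + 1) * normc (s%:C - a).
Proof.
move=> a0; have b0 : 0 < - Im a by rewrite oppr_gt0.
have h1 : - Im a <= normc (s%:C - a).
  by apply: le_trans (Im_le_normc _); rewrite !ReImE/= sub0r ler_norm.
have h2 : `|s| <= normc a + normc (s%:C - a).
  have := normcD a (s%:C - a); rewrite addrC subrK normc_real.
  by rewrite addrC.
have h3 : 1 + normc a <= (1 + normc a) / - Im a * normc (s%:C - a).
  by rewrite mulrAC ler_pdivlMr// ler_wpM2l// addr_ge0// normc_ge0.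
rewrite mulrDl mul1r; lra.
Qed.

End complex_basics.

(** * Integration of complex-valued functions by components *)

Section complex_integral.
Local Open Scope complex_scope.
Context {R : realType}.
Local Notation C := R[i].
Local Notation Re := (@complex.Re R).
Local Notation Im := (@complex.Im R).
Local Notation normc := (@Normc.normc R).
Local Notation mu := (@lebesgue_measure R).
Local Notation itg f := (mu.-integrable setT (EFin \o f)).
Implicit Types f g : R -> C.

Definition cmeasurable f := measurable_fun setT (Re_fun f) /\ measurable_fun setT (Im_fun f).
Definition cintegrable f := itg (Re_fun f) /\ itg (Im_fun f).
Definition cint f : C := (\int[mu]_x Re_fun f x) +i* (\int[mu]_x Im_fun f x).

Lemma cmeasurable_cst (c : C) : cmeasurable (fun=> c).
Proof. by split; apply: measurable_cst. Qed.

Lemma cmeasurable_real (h : R -> R) : measurable_fun setT h -> cmeasurable (fun x => (h x)%:C).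
Proof. by move=> mh; split => //; apply: measurable_cst. Qed.

Lemma cmeasurableD f g : cmeasurable f -> cmeasurable g -> cmeasurable (fun x => f x + g x).
Proof.
move=> [f1 f2] [g1 g2]; split; rewrite /Re_fun /Im_fun;
by under eq_fun do rewrite !ReImE; apply: measurable_funD.
Qed.

Lemma cmeasurableM f g : cmeasurable f -> cmeasurable g -> cmeasurable (fun x => f x * g x).
Proof.
move=> [f1 f2] [g1 g2]; split; rewrite /Re_fun /Im_fun; under eq_fun do rewrite !ReImE.
  by apply: measurable_funB; apply: measurable_funM.
by apply: measurable_funD; apply: measurable_funM.
Qed.

Lemma cmeasurableV f : cmeasurable f -> cmeasurable (fun x => (f x)^-1).
Proof.
move=> [f1 f2]; have m : measurable_fun setT (fun x => (Re (f x) ^+ 2 + Im (f x) ^+ 2)^-1).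
  by apply: measurable_funV; apply: measurable_funD; apply: measurable_funX.
split; rewrite /Re_fun /Im_fun; under eq_fun do rewrite !ReImE.
  exact: measurable_funM.
by apply: measurable_funN; apply: measurable_funM.
Qed.

Lemma cmeasurable_subV (a : C) : cmeasurable (fun s => (s%:C - a)^-1).
Proof.
apply: cmeasurableV; apply: cmeasurableD; first exact: cmeasurable_real.
exact: cmeasurable_cst.
Qed.

Lemma cintegrable_bound f K : cmeasurable f ->
  (forall x, normc (f x) <= K / (1 + x ^+ 2)) -> cintegrable f.
Proof.
by move=> [f1 f2] fK; split; apply: integrable_inv_bound => // x;
  apply: le_trans (fK x); rewrite ?Re_le_normc ?Im_le_normc.
Qed.

Lemma cintD f g : cintegrable f -> cintegrable g ->
  cint (fun x => f x + g x) = cint f + cint g.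
Proof.
move=> [f1 f2] [g1 g2]; apply: eq_ReIm; rewrite !ReImE /cint /= -RintegralD//;
by apply: eq_Rintegral => x _; rewrite /Re_fun /Im_fun ReImE.
Qed.

Lemma cintZ (c : C) f : cintegrable f -> cint (fun x => c * f x) = c * cint f.
Proof.
move=> [f1 f2].
have z (k : R) h : itg h -> itg (fun x => k * h x).
  by move=> ih; have := integrableZl measurableT k ih.
apply: eq_ReIm; rewrite !ReImE /cint /= -!RintegralZl// -?RintegralB -?RintegralD//; try exact: z;
by apply: eq_Rintegral => x _; rewrite /Re_fun /Im_fun ReImE.
Qed.

Lemma cintegrableZ (c : C) f : cintegrable f -> cintegrable (fun x => c * f x).
Proof.
move=> [f1 f2].
have z (k : R) h : itg h -> itg (fun x => k * h x).
  by move=> ih; have := integrableZl measurableT k ih.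
split; rewrite /Re_fun /Im_fun; under eq_fun do rewrite !ReImE.
  by have := integrableB measurableT (z (Re c) _ f1) (z (Im c) _ f2).
by have := integrableD measurableT (z (Re c) _ f2) (z (Im c) _ f1).
Qed.

Lemma normc_cvg_ReIm (u : nat -> C) l (e : nat -> R) :
  (forall n, normc (u n - l) <= e n) -> e n @[n --> \oo] --> 0 ->
  Re (u n) @[n --> \oo] --> Re l /\ Im (u n) @[n --> \oo] --> Im l.
Proof.
move=> ue e0.
have main (h : C -> R) : (forall z, `|h z| <= normc z) -> {morph h : x y / x - y} ->
    h (u n) @[n --> \oo] --> h l.
  move=> hn hB; apply/cvgrPdist_le => eps e_gt0.
  have /cvgr0Pnorm_le/(_ _ e_gt0) := e0; apply: filterS => n ne.
  rewrite distrC -hB (le_trans (hn _))// (le_trans (ue n))//.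
  by rewrite (le_trans _ ne)// ler_norm.
split; apply: main; [exact: Re_le_normc| |exact: Im_le_normc|];
by move=> x y; rewrite !ReImE.
Qed.

Lemma cint_dominated (f_ : nat -> R -> C) f (g : R -> R) :
  (forall n, cmeasurable (f_ n)) -> cmeasurable f -> itg g ->
  (forall n x, normc (f_ n x) <= g x) ->
  (forall x, Re (f_ n x) @[n --> \oo] --> Re (f x)) ->
  (forall x, Im (f_ n x) @[n --> \oo] --> Im (f x)) ->
  [/\ cintegrable f, Re (cint (f_ n)) @[n --> \oo] --> Re (cint f) &
    Im (cint (f_ n)) @[n --> \oo] --> Im (cint f)].
Proof.
move=> mf_ [mf1 mf2] ig fg fR fI.
have [i1 c1] := @Rdominated_convergence _ (fun n => Re_fun (f_ n)) _ _ (fun n => (mf_ n).1)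
  mf1 ig (fun n x => le_trans (Re_le_normc _) (fg n x)) fR.
have [i2 c2] := @Rdominated_convergence _ (fun n => Im_fun (f_ n)) _ _ (fun n => (mf_ n).2)
  mf2 ig (fun n x => le_trans (Im_le_normc _) (fg n x)) fI.
by split.
Qed.

Lemma cint_dominated0 (f_ : nat -> R -> C) f (g : R -> R) :
  (forall n, cmeasurable (f_ n)) -> cmeasurable f -> itg g ->
  (forall n x, normc (f_ n x) <= g x) ->
  (forall x, Re (f_ n x) @[n --> \oo] --> Re (f x)) ->
  (forall x, Im (f_ n x) @[n --> \oo] --> Im (f x)) ->
  (forall n, cint (f_ n) = 0) -> cint f = 0.
Proof.
move=> mf_ mf ig fg fR fI f0.
have [_ c1 c2] := cint_dominated mf_ mf ig fg fR fI.
apply: eq_ReIm.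
  by apply: (cvg_unique _ c1) => //; apply: cvg_near_cst; apply: nearW => n; rewrite f0.
by apply: (cvg_unique _ c2) => //; apply: cvg_near_cst; apply: nearW => n; rewrite f0.
Qed.

End complex_integral.

(** * Boundary values of functions on the upper half-plane *)

Section lower_orth.
Local Open Scope complex_scope.
Context {R : realType}.
Local Notation C := R[i].
Local Notation Re := (@complex.Re R).
Local Notation Im := (@complex.Im R).
Local Notation normc := (@Normc.normc R).
Local Notation mu := (@lebesgue_measure R).
Local Notation itg f := (mu.-integrable setT (EFin \o f)).
Implicit Types f g : R -> C.

(** Decay of order [1 / |s|] is that of the Cauchy kernel itself, and a product of two such
    functions is integrable even when neither factor is. *)
Definition decay1 f := cmeasurable f /\
  exists2 K, 0 <= K & forall s, normc (f s) <= K / (1 + `|s|).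

(* The Cauchy integral of [f] vanishes on the lower half-plane, i.e. [f] is the
   boundary value of a function holomorphic on the upper half-plane. *)
Definition lower_orth f := forall a, Im a < 0 ->
  cint (fun s => f s * (s%:C - a)^-1) = 0.

Lemma decay1_subV (a : C) : Im a < 0 -> decay1 (fun s => (s%:C - a)^-1).
Proof.
move=> a0; split; first exact: cmeasurable_subV.
exists ((1 + normc a) / - Im a + 1).
  by rewrite addr_ge0// divr_ge0 ?addr_ge0 ?normc_ge0// oppr_ge0 ltW.
move=> s; rewrite Normc.normcV; have := normc_sub_ge s a0.
have p : 0 < 1 + `|s| by rewrite ltr_pwDl.
have p' : 0 < normc (s%:C - a) by rewrite normc_gt0 subC_neq0.
by move=> h; rewrite ler_pdivlMr// mulrC ler_pdivrMr.
Qed.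

Lemma decay1M_bound f g : decay1 f -> decay1 g ->
  exists K, forall s, normc (f s * g s) <= K / (1 + s ^+ 2).
Proof.
move=> [_ [K K0 fK]] [_ [L L0 gL]]; exists (K * L) => s.
have p : 0 < 1 + `|s| by rewrite ltr_pwDl.
rewrite Normc.normcM; apply: (@le_trans _ _ ((K / (1 + `|s|)) * (L / (1 + `|s|)))).
  by apply: ler_pM => //; rewrite normc_ge0.
rewrite mulrACA ler_wpM2l ?mulr_ge0// -invfM lef_pV2 ?posrE ?mulr_gt0//.
  rewrite -(real_normK (num_real s)); have := normr_ge0 s; nra.
by rewrite ltr_pwDl// sqr_ge0.
Qed.

Lemma decay1M_integrable f g : decay1 f -> decay1 g -> cintegrable (fun s => f s * g s).
Proof.
move=> df dg; have [K fK] := decay1M_bound df dg; apply: cintegrable_bound fK.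
by apply: cmeasurableM; [have [] := df|have [] := dg].
Qed.

Lemma decay1Z (c : C) f : decay1 f -> decay1 (fun s => c * f s).
Proof.
move=> [mf [K K0 fK]]; split; first by apply: cmeasurableM => //; exact: cmeasurable_cst.
exists (normc c * K); first by rewrite mulr_ge0// normc_ge0.
by move=> s; rewrite Normc.normcM -mulrA ler_wpM2l ?normc_ge0.
Qed.

Lemma decay1D f g : decay1 f -> decay1 g -> decay1 (fun s => f s + g s).
Proof.
move=> [mf [K K0 fK]] [mg [L L0 gL]]; split; first exact: cmeasurableD.
exists (K + L); first exact: addr_ge0.
by move=> s; rewrite (le_trans (normcD _ _))// mulrDl lerD.
Qed.

Lemma decay1M f g : decay1 f -> decay1 g -> decay1 (fun s => f s * g s).
Proof.
move=> [mf [K K0 fK]] [mg [L L0 gL]]; split; first exact: cmeasurableM.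
exists (K * L); first exact: mulr_ge0.
move=> s; rewrite Normc.normcM mulrAC ler_pM ?normc_ge0//.
rewrite (le_trans (gL s))// ler_pdivrMr ?ltr_pwDl//.
by rewrite mulrDr mulr1 lerDl mulr_ge0.
Qed.

Lemma lower_orthZ (c : C) f : decay1 f -> lower_orth f -> lower_orth (fun s => c * f s).
Proof.
move=> df of_ a a0; under [X in cint X]eq_fun do rewrite -mulrA.
by rewrite cintZ ?of_ ?mulr0//; apply: decay1M_integrable => //; exact: decay1_subV.
Qed.

Lemma lower_orthD f g : decay1 f -> decay1 g -> lower_orth f -> lower_orth g ->
  lower_orth (fun s => f s + g s).
Proof.
move=> df dg of_ og a a0; under [X in cint X]eq_fun do rewrite mulrDl.
by rewrite cintD ?of_ ?og ?addr0//; apply: decay1M_integrable => //; exact: decay1_subV.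
Qed.

(* The removed pole is recovered by approaching [b] vertically from below. *)
Lemma lower_orth_pole f b : decay1 f -> Im b < 0 ->
  (forall a, Im a < 0 -> a != b -> cint (fun s => f s * (s%:C - a)^-1) = 0) ->
  cint (fun s => f s * (s%:C - b)^-1) = 0.
Proof.
move=> df b0 fa; have [mf _] := df.
pose a_ n := b - 'i * (n.+1%:R^-1)%:C.
have Ima n : Im (a_ n) = Im b - n.+1%:R^-1 by rewrite /a_ !ReImE/=; ring.
have Rea n : Re (a_ n) = Re b by rewrite /a_ !ReImE/=; ring.
have e0 n : 0 < n.+1%:R^-1 :> R by rewrite invr_gt0.
have a0 n : Im (a_ n) < 0 by rewrite Ima subr_lt0 (lt_trans b0).
have ab n : a_ n != b.
  by apply/eqP => /(congr1 Im); rewrite Ima; have := e0 n; move: (n.+1%:R^-1) => w; lra.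
have [K fK] := decay1M_bound df (decay1_subV b0).
have iK : itg (fun s : R => K / (1 + s ^+ 2)).
  by have := integrableZl measurableT K (@integrable_inv1Dsqr R).
(* Moving the pole further down increases its distance to every real point, so the kernels at [a_ n]
   are dominated by the kernel at [b]. *)
have le_ab n s : normc (s%:C - b) <= normc (s%:C - a_ n).
  have := Ima n; have := Rea n; move: (a_ n) => a hR hI.
  rewrite !normcE2 ler_wsqrtr// !ReImE hR hI lerD2l/= !sub0r !sqrrN.
  by have := e0 n; have := b0; move: (n.+1%:R^-1) => w; nra.
have p s : 0 < normc (s%:C - b) by rewrite normc_gt0 subC_neq0.
have p' s n : 0 < normc (s%:C - a_ n) by rewrite normc_gt0 subC_neq0.
have cv s : Re (f s * (s%:C - a_ n)^-1) @[n --> \oo] --> Re (f s * (s%:C - b)^-1) /\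
   Im (f s * (s%:C - a_ n)^-1) @[n --> \oo] --> Im (f s * (s%:C - b)^-1).
  apply: (@normc_cvg_ReIm _ _ _ (fun n => normc (f s) * (normc (s%:C - b))^-1 ^+ 2 * n.+1%:R^-1)).
    move=> n; rewrite (_ : _ - _ = f s * (s%:C - b)^-1 * (s%:C - a_ n)^-1 * (a_ n - b)); last first.
      have := subC_neq0 s b0; have := subC_neq0 s (a0 n); move: (a_ n) => a n1 n2.
      by field; rewrite n1.
    rewrite !Normc.normcM !Normc.normcV expr2 mulrA.
    rewrite (_ : normc (a_ n - b) = n.+1%:R^-1); last first.
      rewrite /a_ addrAC subrr add0r (@normcN R) Normc.normcM normc_real gtr0_norm//.
      by rewrite normcE2/= expr0n/= add0r expr1n sqrtr1 mul1r.
    apply: ler_wpM2r; first exact: ltW.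
    by apply: ler_wpM2l; rewrite ?mulr_ge0 ?invr_ge0 ?normc_ge0// lef_pV2 ?posrE.
  rewrite -[X in _ --> X](mulr0 (normc (f s) * (normc (s%:C - b))^-1 ^+ 2)).
  by apply: cvgM; [exact: cvg_cst|exact: cvg_harmonic].
apply: (@cint_dominated0 _ (fun n s => f s * (s%:C - a_ n)^-1) _ (fun s => K / (1 + s ^+ 2))).
- by move=> n; apply: cmeasurableM => //; exact: cmeasurable_subV.
- by apply: cmeasurableM => //; exact: cmeasurable_subV.
- exact: iK.
- move=> n s; apply: le_trans (fK s); rewrite !Normc.normcM !Normc.normcV.
  by apply: ler_wpM2l; rewrite ?normc_ge0// lef_pV2 ?posrE.
- by move=> s; have [] := cv s.
- by move=> s; have [] := cv s.
- by move=> n; apply: fa.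
Qed.

(** For [a != b], partial fractions turn the product of the two kernels into a combination of
    kernels to which [f] is orthogonal; the double pole [a = b] is the limit case. *)
Lemma lower_orth_div f b : decay1 f -> lower_orth f -> Im b < 0 ->
  lower_orth (fun s => f s * (s%:C - b)^-1).
Proof.
move=> df of_ b0.
have main a : Im a < 0 -> a != b ->
    cint (fun s => f s * (s%:C - b)^-1 * (s%:C - a)^-1) = 0.
  move=> a0 ab.
  rewrite (_ : (fun s => _) = (fun s => (a - b)^-1 * (f s * (s%:C - a)^-1) +
      (- (a - b)^-1) * (f s * (s%:C - b)^-1))); last first.
    apply/funext => s; have := subC_neq0 s b0; have := subC_neq0 s a0 => n1 n2.
    by field; rewrite ?n1 ?n2 ?subr_eq0 ?ab.
  have ia := decay1M_integrable df (decay1_subV a0).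
  have ib := decay1M_integrable df (decay1_subV b0).
  rewrite cintD; [|exact: cintegrableZ..].
  by rewrite !cintZ// !of_// !mulr0 addr0.
move=> a a0; have [->|ab] := eqVneq a b; last exact: main.
by apply: lower_orth_pole => //; apply: decay1M => //; exact: decay1_subV.
Qed.

Lemma lower_orth_lim (f_ : nat -> R -> C) f (K : R) : (forall n, decay1 (f_ n)) ->
  decay1 f -> (forall n s, normc (f_ n s) <= K / (1 + `|s|)) -> 0 <= K ->
  (forall s, Re (f_ n s) @[n --> \oo] --> Re (f s)) ->
  (forall s, Im (f_ n s) @[n --> \oo] --> Im (f s)) ->
  (forall n, lower_orth (f_ n)) -> lower_orth f.
Proof.
move=> df_ df fK K0 cR cI of_ a a0.
(* The common majorant is itself viewed as a function of this class, so that the bound for products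
   supplies the integrable dominating function. *)
have dg : decay1 (fun s => (K / (1 + `|s|))%:C).
  split.
    apply: cmeasurable_real; apply: measurable_funM => //.
    by apply: measurable_funV; apply: measurable_funD => //; exact: measurableT_comp.
  exists K => // s; rewrite normc_real ger0_norm//.
  by rewrite divr_ge0// addr_ge0.
have [L gL] := decay1M_bound dg (decay1_subV a0).
apply: (@cint_dominated0 _ (fun n s => f_ n s * (s%:C - a)^-1) _ (fun s => L / (1 + s ^+ 2))).
- by move=> n; apply: cmeasurableM; [have [] := df_ n|exact: cmeasurable_subV].
- by apply: cmeasurableM; [have [] := df|exact: cmeasurable_subV].
- by have := integrableZl measurableT L (@integrable_inv1Dsqr R).
- move=> n s; apply: le_trans (gL s); rewrite !Normc.normcM ler_wpM2r ?normc_ge0//.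
  by rewrite normc_real ger0_norm ?fK// divr_ge0// addr_ge0.
- move=> s; under eq_fun do rewrite cReM; rewrite cReM.
  by apply: cvgB; apply: cvgM => //; exact: cvg_cst.
- move=> s; under eq_fun do rewrite cImM; rewrite cImM.
  by apply: cvgD; apply: cvgM => //; exact: cvg_cst.
- by move=> n; apply: of_.
Qed.

End lower_orth.

(** * The Cauchy kernel with a pole in the lower half-plane *)

Section simple_pole.
Local Open Scope complex_scope.
Context {R : realType}.
Local Notation C := R[i].
Local Notation Re := (@complex.Re R).
Local Notation Im := (@complex.Im R).
Local Notation normc := (@Normc.normc R).
Local Notation mu := (@lebesgue_measure R).
Local Notation itg f := (mu.-integrable setT (EFin \o f)).
Implicit Types f g : R -> C.

Lemma cvg_invn : (n.+1%:R^-1 : R) @[n --> \oo] --> (0 : R).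
Proof. exact: cvg_harmonic. Qed.

Lemma cvg_sqr T (F : set_system T) (FF : Filter F) (f : T -> R) (l : R) :
  f x @[x --> F] --> l -> f x ^+ 2 @[x --> F] --> l ^+ 2.
Proof. by move=> h; rewrite expr2; under eq_fun do rewrite expr2; exact: cvgM. Qed.

Section antiderivative.
Local Open Scope complex_scope.
Variables (alpha beta : R) (b0 : 0 < beta).
Let D (s : R) : 0 < (s - alpha) ^+ 2 + beta ^+ 2.
Proof. by rewrite ltr_wpDl ?sqr_ge0// exprn_gt0. Qed.
(** [logF] and [atanF] are the real and, up to a constant, the imaginary part of the logarithm of
    [s - (alpha - i beta)]. *)
Let logF (s : R) : R := 2^-1 * ln ((s - alpha) ^+ 2 + beta ^+ 2).
Let atanF (s : R) : R := - atan ((s - alpha) / beta).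

Lemma is_derive_logF (s : R) : is_derive s (1 : R) logF
  ((s - alpha) / ((s - alpha) ^+ 2 + beta ^+ 2)).
Proof.
have h1 : is_derive s (1 : R) (fun s : R => (s - alpha) ^+ 2 + beta ^+ 2) (2 * (s - alpha)).
  by apply: is_derive_eq; rewrite /= /GRing.scale/=; ring.
have h2 := @is_derive1_comp _ (@ln R) (fun s : R => (s - alpha) ^+ 2 + beta ^+ 2) s _ _ (is_derive1_ln (D s)) h1.
have h3 : is_derive s (1 : R) (2^-1 \*: (@ln R \o (fun s : R => (s - alpha) ^+ 2 + beta ^+ 2)))
   (2^-1 *: (((s - alpha) ^+ 2 + beta ^+ 2)^-1 * (2 * (s - alpha)))) by exact: is_deriveZ.
apply: is_derive_eq; rewrite /GRing.scale/=; have := D s; move: (_ + _) => d d0.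
by field; rewrite gt_eqF.
Qed.

Lemma is_derive_atanF (s : R) : is_derive s (1 : R) atanF
  (- (beta / ((s - alpha) ^+ 2 + beta ^+ 2))).
Proof.
have h1 : is_derive s (1 : R) (fun s : R => (s - alpha) / beta) (beta^-1).
  by apply: is_derive_eq; rewrite /= /GRing.scale/=; ring.
have h2 := @is_derive1_comp _ (@atan R) (fun s : R => (s - alpha) / beta) s _ _ (is_derive1_atan ((s - alpha) / beta)) h1.
have h3 : is_derive s (1 : R) (- (@atan R \o (fun s : R => (s - alpha) / beta)))
   (- ((1 + ((s - alpha) / beta) ^+ 2)^-1 / beta)) by exact: is_deriveN.
apply: is_derive_eq; congr (- _); have := D s => d0.
have d1 : 1 + ((s - alpha) / beta) ^+ 2 != 0.
  by rewrite gt_eqF// ltr_pwDl// sqr_ge0.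
field; rewrite ?gt_eqF//=.
Qed.

Lemma cvg_logF : logF n%:R - logF (- n%:R) @[n --> \oo] --> (0 : R).
Proof.
rewrite -cvg_shiftS.
(* Dividing numerator and denominator by [n^2] and setting [h = 1 / n] gives a rational function
   with value [1] at [h = 0]; the index was shifted so that [n] is never [0]. *)
pose phi (h : R) := ((1 - alpha * h) ^+ 2 + (beta * h) ^+ 2) / ((1 + alpha * h) ^+ 2 + (beta * h) ^+ 2).
have ph : phi n.+1%:R^-1 @[n --> \oo] --> (1 : R).
  have h1 (c : R) : 1 + c * n.+1%:R^-1 @[n --> \oo] --> (1 : R).
    rewrite -[X in _ --> X](addr0 (1 : R)) -[X in _ --> _ + X](mulr0 c).
    by apply: cvgD; [exact: cvg_cst|apply: cvgM; [exact: cvg_cst|exact: cvg_invn]].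
  have h2 : (beta * n.+1%:R^-1) ^+ 2 @[n --> \oo] --> (0 : R).
    rewrite -[X in _ --> X](expr0n R 2) -[X in X ^+ 2](mulr0 beta).
    by apply: cvg_sqr; apply: cvgM; [exact: cvg_cst|exact: cvg_invn].
  have h3 (c : R) : (1 + c * n.+1%:R^-1) ^+ 2 + (beta * n.+1%:R^-1) ^+ 2 @[n --> \oo] --> (1 : R).
    rewrite -[X in _ --> X](addr0 (1 : R)) -[X in _ --> X + _](expr1n R 2).
    by apply: cvgD => //; apply: cvg_sqr.
  rewrite [X in _ --> X](_ : (1 : R) = 1 / 1); last by rewrite divr1.
  apply: cvgM; last by apply: cvgV => //; exact: oner_neq0.
  by have := h3 (- alpha); under eq_fun do rewrite mulNr.
have : ln (phi n.+1%:R^-1) @[n --> \oo] --> ln (1 : R).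
  by apply: continuous_cvg ph; exact: continuous_ln.
rewrite ln1 => /(cvgM (cvg_cst (2^-1 : R))); rewrite mulr0.
apply: cvg_trans; apply: near_eq_cvg; apply: nearW => n /=.
rewrite /logF -mulrBr -ln_div ?posrE//; congr (_ * ln _); rewrite /phi.
have n0 : n.+1%:R != 0 :> R by rewrite pnatr_eq0.
have dN := D (- n.+1%:R).
have d2 : (1 + alpha * n.+1%:R^-1) ^+ 2 + (beta * n.+1%:R^-1) ^+ 2 != 0.
  rewrite gt_eqF// ltr_wpDl ?sqr_ge0// exprn_gt0// mulr_gt0//.
by field; rewrite ?n0 ?gt_eqF.
Qed.

Lemma cvg_atanF : atanF n%:R - atanF (- n%:R) @[n --> \oo] --> (- pi : R).
Proof.
have h (c : R) : atan ((n%:R - c) / beta) @[n --> \oo] --> (pi / 2 : R).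
  apply: cvg_comp (@cvgy_atan R); apply/cvgryPge => A; near=> n.
  rewrite ler_pdivlMr// lerBrDr; near: n; exact: nbhs_infty_ger.
rewrite (_ : - pi = - (pi / 2) - pi / 2); last by field.
apply: cvg_trans; last exact: (cvgB (cvgN (h alpha)) (h (- alpha))).
apply: near_eq_cvg; apply: nearW => n /=.
rewrite /atanF; congr (_ + _).
rewrite !fctE opprK (_ : (- n%:R - alpha) / beta = - ((n%:R - - alpha) / beta)); last by ring.
by rewrite atanN !opprK.
Unshelve. all: by end_near. Qed.

End antiderivative.

Lemma continuous_quadV (alpha beta : R) : 0 < beta ->
  continuous (fun s : R => ((s - alpha) ^+ 2 + beta ^+ 2)^-1).
Proof.
move=> b0 s; apply: cvgV.
  by rewrite gt_eqF// ltr_wpDl ?sqr_ge0// exprn_gt0.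
apply: cvgD; last exact: cvg_cst.
by apply: cvg_sqr; apply: cvgB; [exact: cvg_id|exact: cvg_cst].
Qed.

(** Partial fractions leave a difference of two kernels, integrable although its terms are not. Over
    [[-n, n]] the logarithms contribute limits ([0] for the real part, [- pi] for the imaginary
    part) that are the same for all poles below the line, so they cancel. *)
Lemma lower_orth_subV (b : C) : Im b < 0 -> lower_orth (fun s => (s%:C - b)^-1).
Proof.
move=> b0.
suff main a : Im a < 0 -> a != b -> cint (fun s : R => (s%:C - b)^-1 * (s%:C - a)^-1) = 0.
  move=> a a0; have [->|ab] := eqVneq a b; last exact: main.
  by apply: lower_orth_pole => //; exact: decay1_subV.
move=> a0 ab.
rewrite (_ : (fun s => _) = (fun s => (a - b)^-1 * ((s%:C - a)^-1 - (s%:C - b)^-1))); last first.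
  apply/funext => s; have := subC_neq0 s b0; have := subC_neq0 s a0 => n1 n2.
  by field; rewrite ?n1 ?n2 ?subr_eq0 ?ab.
have ci : cintegrable (fun s : R => (s%:C - a)^-1 - (s%:C - b)^-1).
  rewrite (_ : (fun s => _) = (fun s => (a - b) * ((s%:C - b)^-1 * (s%:C - a)^-1))); last first.
    apply/funext => s; have := subC_neq0 s b0; have := subC_neq0 s a0 => n1 n2.
    by field; rewrite ?n1 ?n2.
  by apply: cintegrableZ; apply: decay1M_integrable; exact: decay1_subV.
rewrite cintZ//; have [i1 i2] := ci.
have -> : cint (fun s : R => (s%:C - a)^-1 - (s%:C - b)^-1) = 0; last by rewrite mulr0.
move: a b a0 b0 {ab ci} i1 i2 => [a1 a2] [b1 b2] /= a0 b0 i1 i2.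
have a0' : 0 < - a2 by rewrite oppr_gt0.
have b0' : 0 < - b2 by rewrite oppr_gt0.
rewrite /cint; apply: eq_ReIm => /=.
  have eg : Re_fun (fun s : R => (s%:C - (a1 +i* a2))^-1 - (s%:C - (b1 +i* b2))^-1) =
     (fun s => (s - a1) / ((s - a1) ^+ 2 + (- a2) ^+ 2) - (s - b1) / ((s - b1) ^+ 2 + (- b2) ^+ 2)).
    by apply/funext => s; rewrite /Re_fun !ReImE/= !sub0r.
  apply: (@RintegralT_FTC _ (fun s => 2^-1 * ln ((s - a1) ^+ 2 + (- a2) ^+ 2) - 2^-1 * ln ((s - b1) ^+ 2 + (- b2) ^+ 2))) => //.
  - by rewrite eg => x; apply: is_deriveB; exact: is_derive_logF.
  - rewrite eg => x; apply: cvgB; apply: cvgM; try (by exact: continuous_quadV);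
    by apply: cvgB; [exact: cvg_id|exact: cvg_cst].
  - rewrite -[X in _ --> X](subrr (0 : R)).
    apply: cvg_trans; last exact: (cvgB (cvg_logF a1 a0') (cvg_logF b1 b0')).
    apply: near_eq_cvg; apply: nearW => n; rewrite !fctE /=; ring.
have eg : Im_fun (fun s : R => (s%:C - (a1 +i* a2))^-1 - (s%:C - (b1 +i* b2))^-1) =
   (fun s => - (- a2 / ((s - a1) ^+ 2 + (- a2) ^+ 2)) + (- b2 / ((s - b1) ^+ 2 + (- b2) ^+ 2))).
  by apply/funext => s; rewrite /Im_fun !ReImE/= !sub0r opprK.
apply: (@RintegralT_FTC _ (fun s => - atan ((s - a1) / - a2) - - atan ((s - b1) / - b2))) => //.
- rewrite eg => x; rewrite -[X in _ + X]opprK; apply: is_deriveB; exact: is_derive_atanF.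
- rewrite eg => x; apply: cvgD; last by apply: cvgM; [exact: cvg_cst|exact: continuous_quadV].
  by apply: cvgN; apply: cvgM; [exact: cvg_cst|exact: continuous_quadV].
- rewrite -[X in _ --> X](subrr (- pi : R)).
  apply: cvg_trans; last exact: (cvgB (cvg_atanF a1 a0') (cvg_atanF b1 b0')).
  apply: near_eq_cvg; apply: nearW => n; rewrite !fctE /=; ring.
Qed.

End simple_pole.

(** * The Sokhotski-Plemelj formula on the line *)

Section plemelj.
Local Open Scope complex_scope.
Context {R : realType}.
Local Notation C := R[i].
Local Notation Re := (@complex.Re R).
Local Notation Im := (@complex.Im R).
Local Notation normc := (@Normc.normc R).
Local Notation mu := (@lebesgue_measure R).
Local Notation itg f := (mu.-integrable setT (EFin \o f)).
Implicit Types f g : R -> C.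

Lemma cint_reflect (x : R) f : cintegrable f -> cint (fun t => f (x - t)) = cint f.
Proof. by move=> [f1 f2]; rewrite /cint; congr (_ +i* _); exact: (Rintegral_reflect x). Qed.

Lemma Rintegral_unit_poisson (e : R) : 0 < e ->
  \int[mu]_t ((`|t| <= 1)%R%:R * (e / (t ^+ 2 + e ^+ 2))) = 2 * atan e^-1.
Proof.
move=> e0.
have h (t : R) : is_derive t (1 : R) (- (fun s : R => - atan ((s - 0) / e))) (- - (e / ((t - 0) ^+ 2 + e ^+ 2))).
  by apply: is_deriveN; exact: is_derive_atanF.
transitivity (\int[mu]_(t in `[- 1, 1]) (- - (e / ((t - 0) ^+ 2 + e ^+ 2)))).
  rewrite [RHS]Rintegral_mkcond; apply: eq_Rintegral => t _.
  rewrite patchE opprK subr0; case: ifPn; rewrite ?inE ?notin_setE/= in_itv/= -ler_norml.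
    by move=> ->; rewrite mul1r.
  by move=> /negP/negbTE ->; rewrite mul0r.
rewrite (@Rintegral_FTC _ (- (fun s : R => - atan ((s - 0) / e))) _ (-1) 1)//; last first.
  move=> t; apply: cvgN; apply: cvgN; apply: cvgM; first exact: cvg_cst.
  exact: continuous_quadV.
rewrite !fctE !subr0 !opprK mul1r mulN1r atanN opprK; ring.
Qed.

(** The real part is odd; the imaginary part is a truncated Poisson kernel whose mass
    [2 atan (1 / e)] tends to [pi]. This is the origin of the term [i pi f x] in the limit. *)
Lemma cint_unit_kernel (e : R) : 0 < e ->
  let k := fun t : R => (`|t| <= 1)%R%:R%:C * (t%:C - (0 +i* e))^-1 in
  cintegrable k /\ cint k = 0 +i* (2 * atan e^-1).
Proof.
move=> e0 k.
have mb : measurable_fun setT (fun t : R => (`|t| <= 1)%R%:R : R).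
  by apply: measurable_boolr; exact: measurable_norm_le.
have mk : cmeasurable k.
  by apply: cmeasurableM; [exact: cmeasurable_real|exact: cmeasurable_subV].
have ne t : t%:C - (0 +i* e) != 0.
  by apply/eqP => /(congr1 Im); rewrite !ReImE/=; lra.
have nk t : e <= normc (t%:C - (0 +i* e)).
  by apply: le_trans (Im_le_normc _); rewrite !ReImE/= sub0r normrN ler_norm.
have ik : cintegrable k.
  apply: (@cintegrable_bound _ _ (2 / e)) => // t.
  rewrite /k Normc.normcM normc_real Normc.normcV.
  have p : 0 < 1 + t ^+ 2 by rewrite ltr_pwDl// sqr_ge0.
  case: (leP `|t| 1) => t1; last first.
    by rewrite normr0 mul0r !divr_ge0// ltW.
  rewrite normr1 mul1r ler_pdivlMr// [leRHS]mulrC.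
  apply: ler_pM; rewrite ?invr_ge0 ?normc_ge0 ?(ltW p)//; last first.
    by rewrite -(real_normK (num_real t)); have := expr_le1 (n := 2) isT (normr_ge0 t); rewrite t1; lra.
  by rewrite lef_pV2 ?posrE// (lt_le_trans e0).
split => //; have [i1 i2] := ik; apply: eq_ReIm => /=.
  apply: Rintegral_odd => // t; rewrite /Re_fun /k !ReImE/= normrN.
  by rewrite !subr0 !mul0r !subr0 sqrrN mulNr mulrN.
rewrite -Rintegral_unit_poisson//; apply: eq_Rintegral => t _.
by rewrite /Im_fun /k !ReImE/= sub0r !subr0 sqrrN mul0r addr0 mulNr opprK.
Qed.

(* Sokhotski-Plemelj: the vanishing Cauchy integrals at [x - i e] tend to
   [pi (hilbert f x + i f x)] as [e] tends to [0]. *)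
Lemma lower_orth_hilbert f (x r L : R) : decay1 f -> lower_orth f ->
  0 < r <= 1 -> 0 <= L -> (forall t, `|t| <= r -> normc (f (x - t) - f x) <= L * `|t|) ->
  hilbert f x = - 'i * f x.
Proof.
move=> df of_ r01 L0 fL; have [mf [K K0 fK]] := df; have [mf1 mf2] := mf.
have l1 t : `|t| <= r -> `|Re_fun f (x - t) - Re_fun f x| <= L * `|t|.
  by move=> /fL; apply: le_trans; apply: le_trans (Re_le_normc _); rewrite !ReImE.
have l2 t : `|t| <= r -> `|Im_fun f (x - t) - Im_fun f x| <= L * `|t|.
  by move=> /fL; apply: le_trans; apply: le_trans (Im_le_normc _); rewrite !ReImE.
have b1 := pvker_bound r01 L0 K0 l1 (fun y => le_trans (Re_le_normc _) (fK y)).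
have b2 := pvker_bound r01 L0 K0 l2 (fun y => le_trans (Im_le_normc _) (fK y)).
have m1 := measurable_pvker x mf1; have m2 := measurable_pvker x mf2.
have i1 := integrable_inv_bound m1 b1; have i2 := integrable_inv_bound m2 b2.
pose h (t : R) : C := pvker (Re_fun f) x t +i* pvker (Im_fun f) x t.
have mh : cmeasurable h by split.
have hE t : h t = (f (x - t) - f x * (`|t| <= 1)%R%:R%:C) * t^-1%:C.
  apply: eq_ReIm; rewrite /h /pvker /Re_fun /Im_fun !ReImE/=;
  by rewrite !mulr0 ?subr0 ?addr0 ?add0r.
suff ch : cint h = - ('i * f x * pi%:C).
  rewrite /hilbert !real_hilbertE//.
  transitivity (pi^-1%:C * cint h).
    by apply: eq_ReIm; rewrite !ReImE/= mul0r ?subr0 ?addr0.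
  rewrite ch mulrN mulNr; congr (- _); rewrite mulrCA -[X in _ * (_ * X)]/(real_complex R pi).
  rewrite -rmorphM/= mulVf ?rmorph1 ?mulr1//.
  by rewrite gt_eqF// pi_gt0.
pose e n : R := n.+1%:R^-1; have e0 n : 0 < e n by rewrite invr_gt0.
have ne n t : t%:C - (0 +i* e n) != 0.
  by apply/eqP => /(congr1 Im); rewrite !ReImE/=; have := e0 n; lra.
(* This factor turns [1 / t] into [1 / (t - i e)]. It is bounded by [1] and tends to [1] off
   [t = 0], so [h] dominates and the integral of [h] is the limit of integrals that can be computed
   exactly. *)
pose k n t : C := t%:C * (t%:C - (0 +i* e n))^-1.
have nk n t : normc (k n t) <= 1.
  rewrite /k Normc.normcM Normc.normcV ler_pdivrMr ?normc_gt0// mul1r normc_real.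
  by apply: le_trans (Re_le_normc _); rewrite !ReImE/= subr0.
have mk n : cmeasurable (k n).
  by apply: cmeasurableM; [exact: cmeasurable_real|exact: cmeasurable_subV].
have key n : cint (fun t => h t * k n t) = - (f x * (0 +i* (2 * atan n.+1%:R))).
  have [ik ck] := cint_unit_kernel (e0 n); rewrite invrK in ck; rewrite -ck.
  rewrite -cintZ//; apply/eqP; rewrite -subr_eq0 opprK.
  (* Under [t -> x - t], the part without the subtracted term is minus the Cauchy integral of [f] at
     [x - i e], which vanishes by orthogonality. Only the integral of the subtracted term
     remains. *)
  have im : Im (x%:C - (0 +i* e n)) < 0 by rewrite !ReImE/= sub0r oppr_lt0.
  have isx := decay1M_integrable df (decay1_subV im).
  have ir := cint_reflect x isx; rewrite of_// in ir.
  have ihk : cintegrable (fun t => h t * k n t).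
    apply: (@cintegrable_bound _ _ ((2 * L + 4 * K / r + K * (1 + `|x|)) + (2 * L + 4 * K / r + K * (1 + `|x|)))).
      exact: cmeasurableM.
    move=> t; rewrite Normc.normcM mulrDl (le_trans (ler_wpM2l (normc_ge0 _) (nk n t)))// mulr1.
    by rewrite (le_trans (normc_le_ReIm _))// lerD// /h/=.
  rewrite -cintD//; last exact: cintegrableZ.
  rewrite (_ : (fun t => _) = (fun t => (-1) * (f (x - t) * ((x - t)%:C - (x%:C - (0 +i* e n)))^-1))).
    rewrite cintZ ?ir ?mulr0//.
    have [j1 j2] := isx.
    by split; [exact: (integrable_reflect x j1)|exact: (integrable_reflect x j2)].
  apply/funext => t; rewrite hE /k.
  rewrite (_ : (x - t)%:C - (x%:C - (0 +i* e n)) = - (t%:C - (0 +i* e n))); last first.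
    by rewrite rmorphB/=; ring.
  rewrite invrN; have := ne n t; move: (0 +i* e n) => w w0.
  have [->|t0] := eqVneq t 0.
    rewrite invr0 normr0 ler01 subr0.
    have z1 : (true%:R : R)%:C = 1 by [].
    rewrite z1 mulr1 subrr !mul0r add0r mul1r mulN1r mulrN opprK; reflexivity.
  have t0' : t%:C != 0 by apply/eqP => /(congr1 Re)/=/eqP; rewrite (negbTE t0).
  rewrite (_ : t^-1%:C = (t%:C)^-1); last by rewrite fmorphV.
  by field; rewrite ?w0 ?t0'.
pose g t := `|Re (h t)| + `|Im (h t)|.
have ig : itg g.
  by have := integrableD measurableT (integrable_norm i1) (integrable_norm i2).
have cvk t : Re (h t * k n t) @[n --> \oo] --> Re (h t) /\ Im (h t * k n t) @[n --> \oo] --> Im (h t).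
  have [->|t0] := eqVneq t 0.
    rewrite hE invr0 mulr0; split; apply: cvg_near_cst; apply: nearW => n;
    by rewrite mul0r.
  have t0' : t%:C != 0 by apply/eqP => /(congr1 Re)/=/eqP; rewrite (negbTE t0).
  apply: (@normc_cvg_ReIm _ _ _ (fun n => normc (h t) / `|t| * n.+1%:R^-1)).
    move=> n; rewrite (_ : _ - _ = h t * (0 +i* e n) * (t%:C - (0 +i* e n))^-1); last first.
      by rewrite /k; have := ne n t; move: (0 +i* e n) => w w0; field; rewrite ?w0.
    rewrite !Normc.normcM Normc.normcV mulrAC ler_pM ?mulr_ge0 ?invr_ge0 ?normc_ge0//.
      rewrite ler_wpM2l ?normc_ge0// lef_pV2 ?posrE ?normr_gt0 ?normc_gt0//.
      by rewrite (le_trans _ (Re_le_normc _))// !ReImE/= subr0.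
    by rewrite normcE2/= expr0n add0r sqrtr_sqr gtr0_norm.
  rewrite -[X in _ --> X](mulr0 (normc (h t) / `|t|)).
  by apply: cvgM; [exact: cvg_cst|exact: cvg_invn].
have nhk n t : normc (h t * k n t) <= g t.
  rewrite Normc.normcM (le_trans (ler_wpM2l (normc_ge0 _) (nk n t)))// mulr1.
  exact: normc_le_ReIm.
have [_ c1 c2] := cint_dominated (fun n => cmeasurableM mh (mk n)) mh ig nhk
  (fun t => (cvk t).1) (fun t => (cvk t).2).
have at2 : 2 * atan n.+1%:R @[n --> \oo] --> (pi : R).
  rewrite [X in _ --> X](_ : _ = 2 * (pi / 2)); last by field.
  apply: cvgM; first exact: cvg_cst.
  rewrite (cvg_shiftS (fun n => atan (n%:R : R))).
  apply: cvg_comp (@cvgy_atan R); exact: cvgr_idn.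
apply: eq_ReIm.
  apply: (cvg_unique _ c1) => //.
  rewrite /= [X in _ --> X](_ : _ = Im (f x) * pi); last by rewrite !ReImE/=; ring.
  apply: cvg_trans (cvgM (cvg_cst (Im (f x))) at2).
  apply: near_eq_cvg; apply: nearW => n; have /(congr1 Re) := key n; rewrite !ReImE/= => ->; ring.
apply: (cvg_unique _ c2) => //.
rewrite /= [X in _ --> X](_ : _ = - Re (f x) * pi); last by rewrite !ReImE/=; ring.
apply: cvg_trans (cvgM (cvg_cst (- Re (f x))) at2).
apply: near_eq_cvg; apply: nearW => n; have /(congr1 Im) := key n; rewrite !ReImE/= => ->; ring.
Qed.

End plemelj.

(** * Power series majorants *)

Section complex_sequences.
Local Open Scope complex_scope.
Context {R : realType}.
Local Notation C := R[i].
Local Notation Re := (@complex.Re R).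
Local Notation Im := (@complex.Im R).
Local Notation normc := (@Normc.normc R).
Implicit Types (z : nat -> C) (e : nat -> R).

(** Convergence is expressed through a real sequence, so that only the topology of [R] is
    involved. *)
Definition cto z (l : C) := normc (z n - l) @[n --> \oo] --> (0 : R).

Lemma squeeze0 (u v : nat -> R) : (forall n, 0 <= u n <= v n) ->
  v n @[n --> \oo] --> (0 : R) -> u n @[n --> \oo] --> (0 : R).
Proof.
by move=> uv v0; apply: (squeeze_cvgr _ (cvg_cst 0) v0); exact: nearW.
Qed.

Lemma normc_sum n (F : 'I_n -> C) : normc (\sum_(i < n) F i) <= \sum_(i < n) normc (F i).
Proof.
elim/big_rec2: _ => [|i y1 y2 _ h]; first by rewrite Normc.normc0.
by rewrite (le_trans (normcD _ _))// lerD2l.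
Qed.

Lemma normc_distr (a b : C) : normc (a - b) = normc (b - a).
Proof. by rewrite -(@normcN R (a - b)) opprB. Qed.

Lemma nonneg_sum_bounded_cvg e M : (forall n, 0 <= e n) ->
  (forall n, \sum_(k < n) e k <= M) ->
  exists E, [/\ \sum_(k < n) e k @[n --> \oo] --> E, E <= M &
    forall n, \sum_(k < n) e k <= E].
Proof.
move=> e0 eM; pose s n := \sum_(k < n) e k.
have nds : nondecreasing_seq s.
  by apply/nondecreasing_seqP => n; rewrite /s big_ord_recr/= lerDl.
have cs : cvgn s by apply: nondecreasing_is_cvgn => //; exists M => _ [n _ <-]; exact: eM.
exists (limn s); split => //.
- by apply: limr_le => //; apply: nearW.
- by move=> n; exact: nondecreasing_cvgn_le.
Qed.

Lemma bounded_sum_term0 e M : (forall n, 0 <= e n) ->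
  (forall n, \sum_(k < n) e k <= M) -> e n @[n --> \oo] --> (0 : R).
Proof.
move=> e0 eM; have [E [sE _ _]] := nonneg_sum_bounded_cvg e0 eM.
apply: cvg_series_cvg_0; apply/cvg_ex; exists E.
by rewrite (_ : series e = fun n => \sum_(k < n) e k)//; apply/funext => n; rewrite /series/= big_mkord.
Qed.

Lemma cto_ReIm z l : cto z l ->
  Re (z n) @[n --> \oo] --> Re l /\ Im (z n) @[n --> \oo] --> Im l.
Proof. by move=> zl; apply: (normc_cvg_ReIm _ zl). Qed.

(** Increments with summable norms have absolutely summable real and imaginary parts, so each
    component is a convergent telescoping series. *)
Lemma cto_sum_step z e M : (forall n, normc (z n.+1 - z n) <= e n) ->
  (forall n, \sum_(k < n) e k <= M) -> exists l, cto z l.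
Proof.
move=> ze eM; have e0 n : 0 <= e n by rewrite (le_trans (normc_ge0 _) (ze n)).
have main (h : C -> R) : (forall w : C, `|h w| <= normc w) -> {morph h : x y / x - y} ->
    exists l : R, h (z n) @[n --> \oo] --> l.
  move=> hn hB; have cu : cvgn (series (fun n => h (z n.+1) - h (z n))).
    apply: normed_cvg.
    apply: nondecreasing_is_cvgn.
      by apply/nondecreasing_seqP => n; rewrite /normed_series_of/series/= big_nat_recr//= lerDl.
    exists M => _ [n _ <-]; apply: le_trans (eM n); rewrite /normed_series_of/series/= big_mkord.
    by apply: ler_sum => i _; rewrite -hB (le_trans (hn _)).
  have [l hl] := (cvg_ex _).1 cu; exists (l + h (z 0%N)).
  have -> : (fun n => h (z n)) = (fun n => series (fun n => h (z n.+1) - h (z n)) n + h (z 0%N)).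
    by apply/funext => n; rewrite /series/= telescope_sumr// subrK.
  by apply: cvgD hl _; exact: cvg_cst.
have [a ha] := main Re (@Re_le_normc R) (fun x y => ltac:(by rewrite !ReImE)).
have [b hb] := main Im (@Im_le_normc R) (fun x y => ltac:(by rewrite !ReImE)).
exists (a +i* b).
apply: (@squeeze0 _ (fun n => `|Re (z n) - a| + `|Im (z n) - b|)).
  move=> n; rewrite normc_ge0/= (le_trans (normc_le_ReIm _))//.
  by rewrite !ReImE.
have nz (u : nat -> R) l : u n @[n --> \oo] --> l -> `|u n - l| @[n --> \oo] --> (0 : R).
  move=> ul; have : u n - l @[n --> \oo] --> (0 : R).
    by rewrite -(subrr l); apply: cvgB => //; exact: cvg_cst.
  by move=> /cvg_norm; rewrite normr0.
rewrite -[X in _ --> X](addr0 (0 : R)); apply: cvgD; exact: nz.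
Qed.

Lemma cto_tail z e E l : (forall n, normc (z n.+1 - z n) <= e n) ->
  (forall n, \sum_(k < n) e k <= E) -> cto z l ->
  forall n, normc (z n - l) <= E - \sum_(k < n) e k.
Proof.
move=> ze eE zl n; have e0 k : 0 <= e k by rewrite (le_trans (normc_ge0 _) (ze k)).
have st k : normc (z n - z (n + k)%N) <= \sum_(i < n + k) e i - \sum_(i < n) e i.
  elim: k => [|k IH]; first by rewrite addn0 !subrr Normc.normc0.
  rewrite addnS big_ord_recr/= addrAC.
  rewrite (_ : z n - _ = (z n - z (n + k)%N) + (z (n + k)%N - z (n + k).+1)); last by ring.
  rewrite (le_trans (normcD _ _))// lerD// normc_distr; exact: ze.
have h k : normc (z n - l) <= E - \sum_(i < n) e i + normc (z (k + n)%N - l).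
  rewrite (_ : z n - l = (z n - z (k + n)%N) + (z (k + n)%N - l)); last by ring.
  rewrite (le_trans (normcD _ _))// lerD2r addnC (le_trans (st k))// lerD2r.
  exact: eE.
have zl' : normc (z (k + n)%N - l) @[k --> \oo] --> (0 : R).
  by rewrite (cvg_shiftn n (fun k => normc (z k - l))).
have hc : E - \sum_(i < n) e i + normc (z (k + n)%N - l) @[k --> \oo] --> E - \sum_(i < n) e i.
  rewrite -[X in _ --> X]addr0; apply: cvgD => //; exact: cvg_cst.
rewrite -(cvg_lim _ hc)//; apply: limr_ge; first by apply/cvg_ex; eexists; exact: hc.
exact: nearW.
Qed.

End complex_sequences.

(** * Weighted l1 norms of Taylor coefficients *)

Section majorants.
Local Open Scope complex_scope.
Context {R : realType}.
Local Notation C := R[i].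
Local Notation Re := (@complex.Re R).
Local Notation Im := (@complex.Im R).
Local Notation normc := (@Normc.normc R).
Implicit Types (a b h : nat -> C) (f g : R -> C) (x r t M : R).

Definition cpoly a t n : C := \sum_(m < n) a m * t%:C ^+ m.

(** [M] bounds the l1 norm of the Taylor coefficients weighted by powers of [r]. This norm controls
    the supremum on the interval of radius [r] and all derivatives at [x], and behaves well under
    sums and division by a linear factor, so that no complex disc is needed. *)
Definition taylor a g x r M :=
  (forall n, \sum_(m < n) normc (a m) * r ^+ m <= M) /\
  forall t, `|t| <= r -> cto (cpoly a t) (g (x + t)).

Definition majorized g x r M := exists a, taylor a g x r M.

Lemma normc_term a t r m : `|t| <= r -> normc (a m * t%:C ^+ m) <= normc (a m) * r ^+ m.
Proof.
move=> tr; rewrite Normc.normcM normcX normc_real ler_wpM2l ?normc_ge0//.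
by rewrite lerXn2r// nnegrE// (le_trans _ tr).
Qed.

Lemma taylor_term0 a g x r M : 0 <= r -> taylor a g x r M ->
  normc (a n) * r ^+ n @[n --> \oo] --> (0 : R).
Proof.
move=> r0 [aM _]; apply: (bounded_sum_term0 _ aM) => n.
by rewrite mulr_ge0 ?normc_ge0 ?exprn_ge0.
Qed.

Lemma majorized_le g x r M M' : M <= M' -> majorized g x r M -> majorized g x r M'.
Proof.
by move=> MM [a [aM ag]]; exists a; split => // n; exact: le_trans (aM n) MM.
Qed.

Lemma majorized_cst (c : C) x r : 0 <= r -> majorized (fun=> c) x r (normc c).
Proof.
move=> r0; exists (fun m => if m is 0%N then c else 0); split.
  move=> [|n]; first by rewrite big_ord0 normc_ge0.
  rewrite big_ord_recl/= expr0 mulr1 big1 ?addr0// => i _.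
  by rewrite !expr0n/= addr0 sqrtr0 mul0r.
move=> t tr; apply: cvg_near_cst; exists 1%N => // [[|n]]//= _.
rewrite /cpoly big_ord_recl/= expr0 mulr1 big1 ?addr0 ?subrr ?Normc.normc0// => i _.
by rewrite mul0r.
Qed.

Lemma majorizedZ (c : C) g x r M : majorized g x r M -> majorized (fun y => c * g y) x r (normc c * M).
Proof.
move=> [a [aM ag]]; exists (fun m => c * a m); split.
  move=> n; under eq_bigr do rewrite Normc.normcM -mulrA.
  by rewrite -mulr_sumr ler_wpM2l ?normc_ge0.
move=> t tr; apply: (@squeeze0 _ _ (fun n => normc c * normc (cpoly a t n - g (x + t)))).
  move=> n; rewrite normc_ge0 -Normc.normcM mulrBr /cpoly mulr_sumr.
  rewrite le_eqVlt; apply/orP; left; apply/eqP; congr (normc (_ - _)).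
  by apply: eq_bigr => i _; rewrite mulrA.
by rewrite -[X in _ --> X](mulr0 (normc c)); apply: cvgM; [exact: cvg_cst|exact: ag].
Qed.

Lemma majorizedD f g x r M N : 0 <= r -> majorized f x r M -> majorized g x r N ->
  majorized (fun y => f y + g y) x r (M + N).
Proof.
move=> r0 [a [aM af]] [b [bN bg]]; exists (fun m => a m + b m); split.
  move=> n; apply: le_trans (lerD (aM n) (bN n)); rewrite -big_split/=.
  apply: ler_sum => i _; rewrite -mulrDl ler_wpM2r ?exprn_ge0//; exact: normcD.
move=> t tr; apply: (@squeeze0 _ _ (fun n => normc (cpoly a t n - f (x + t)) + normc (cpoly b t n - g (x + t)))).
  move=> n; rewrite normc_ge0/=; apply: le_trans (normcD _ _).
  rewrite /cpoly; under eq_bigr do rewrite mulrDl.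
  rewrite big_split/= le_eqVlt; apply/orP; left; apply/eqP; congr normc; ring.
by rewrite -[X in _ --> X](addr0 (0 : R)); apply: cvgD; [exact: af|exact: bg].
Qed.

Lemma majorizedMz g x r M : 0 <= r -> majorized g x r M ->
  majorized (fun y => y%:C * g y) x r ((`|x| + r) * M).
Proof.
move=> r0 [a [aM ag]].
pose b m := x%:C * a m + (if m is m'.+1 then a m' else 0).
exists b; split.
  move=> [|n]; first by rewrite big_ord0 mulr_ge0 ?addr_ge0// (le_trans _ (aM 0%N))// big_ord0.
  apply: (@le_trans _ _ (`|x| * (\sum_(m < n.+1) normc (a m) * r ^+ m) + r * \sum_(m < n) normc (a m) * r ^+ m)).
    rewrite mulr_sumr mulr_sumr [X in _ <= X + _]big_ord_recl [leLHS]big_ord_recl -addrA -big_split/=.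
    apply: lerD.
      by rewrite /b addr0 Normc.normcM normc_real -mulrA.
    apply: ler_sum => i _; rewrite /b/= /bump/= add1n exprS.
    rewrite (le_trans (ler_wpM2r _ (normcD _ _)))//; first by rewrite mulr_ge0 ?exprn_ge0.
    rewrite Normc.normcM normc_real le_eqVlt; apply/orP; left; apply/eqP; ring.
  rewrite mulrDl lerD// ler_wpM2l//; exact: aM.
move=> t tr.
(* Truncation at the same length loses the term [a_(n-1) t^n]; the last summand only serves [n = 0],
   where there is no such term. *)
apply: (@squeeze0 _ _ (fun n => `|x| * normc (cpoly a t n - g (x + t)) +
   `|t| * normc (cpoly a t n - g (x + t)) + normc (a n.-1) * r ^+ n.-1 * r + (n == 0%N)%:R * (`|t| * normc (g (x + t))))).
  move=> n; rewrite normc_ge0/=.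
  have -> : cpoly b t n - (x + t)%:C * g (x + t) = x%:C * (cpoly a t n - g (x + t)) +
    t%:C * (cpoly a t n - g (x + t)) - (if n is m.+1 then a m * t%:C ^+ m.+1 else 0).
    rewrite rmorphD/=; case: n => [|n]; first by rewrite /cpoly !big_ord0; ring.
    have : cpoly b t n.+1 = x%:C * cpoly a t n.+1 + t%:C * cpoly a t n.
      rewrite /cpoly !mulr_sumr [X in _ = X + _]big_ord_recl [LHS]big_ord_recl -addrA -big_split/=.
      congr (_ + _); first by rewrite /b addr0 mulrA.
      by apply: eq_bigr => i _; rewrite /b/= /bump/= add1n exprS; ring.
    have e : cpoly a t n.+1 = cpoly a t n + a n * t%:C ^+ n by rewrite /cpoly big_ord_recr.
    by move=> ->; rewrite e exprS; ring.
  rewrite (le_trans (normcB _ _))// -addrA lerD//.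
    by rewrite (le_trans (normcD _ _))// !Normc.normcM !normc_real.
  case: n => [|n].
    by rewrite Normc.normc0 mul1r addr_ge0// ?mulr_ge0 ?normc_ge0.
  rewrite mul0r addr0 -mulrA -exprSr Normc.normcM normcX normc_real.
  by rewrite ler_wpM2l ?normc_ge0// lerXn2r// nnegrE.
have z : forall c : R, c * normc (cpoly a t n - g (x + t)) @[n --> \oo] --> (0 : R).
  by move=> c; rewrite -[X in _ --> X](mulr0 c); apply: cvgM; [exact: cvg_cst|exact: ag].
rewrite -[X in _ --> X](addr0 (0 : R)); apply: cvgD; last first.
  by apply: cvg_near_cst; exists 1%N => // [[|n]]//= _; rewrite mul0r.
rewrite -[X in _ --> X](addr0 (0 : R)); apply: cvgD.
  by rewrite -[X in _ --> X](addr0 (0 : R)); apply: cvgD; exact: z.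
rewrite -[X in _ --> X](mul0r r); apply: cvgM; last exact: cvg_cst.
rewrite -cvg_shiftS.
by apply: (taylor_term0 r0 (conj aM ag)).
Qed.

(** Coefficients of the quotient of the series [a] by [c + t], found by comparing powers of [t] in
    [(c + t) h(t) = a(t)]. *)
Fixpoint divcoef (c : C) a (m : nat) : C :=
  if m is m'.+1 then (a m - divcoef c a m') / c else a 0%N / c.

Lemma majorized_div g x r M (p : C) : 0 <= r -> r < normc (x%:C - p) -> majorized g x r M ->
  majorized (fun y => g y * (y%:C - p)^-1) x r (M / (normc (x%:C - p) - r)).
Proof.
move=> r0 rp [a [aM ag]]; set c := x%:C - p in rp *.
have c0 : c != 0 by rewrite -normc_gt0 (le_lt_trans r0).
have nc0 : 0 < normc c by rewrite normc_gt0.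
pose h := divcoef c a.
have hS m : c * h m.+1 = a m.+1 - h m by rewrite /h/= mulrC divfK.
have h0 : c * h 0%N = a 0%N by rewrite /h/= mulrC divfK.
have hb n : \sum_(m < n) normc (h m) * r ^+ m <= M / (normc c - r).
  rewrite ler_pdivlMr ?subr_gt0//.
  pose H n := \sum_(m < n) normc (h m) * r ^+ m; rewrite -/(H n).
  have nh m : 0 <= normc (h m) * r ^+ m by rewrite mulr_ge0 ?normc_ge0 ?exprn_ge0.
  have Hn k : normc c * H k.+1 <= \sum_(m < k.+1) normc (a m) * r ^+ m + r * H k.
    rewrite /H !mulr_sumr [X in X <= _]big_ord_recl [X in _ <= X + _]big_ord_recl -addrA -big_split/=.
    apply: lerD; first by rewrite mulrA -Normc.normcM h0.
    apply: ler_sum => i _; rewrite /bump/= add1n mulrA -Normc.normcM hS.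
    rewrite (le_trans (ler_wpM2r _ (normcB _ _)))//; first by rewrite exprn_ge0.
    by rewrite mulrDl [r * (_ * _)]mulrCA -exprS.
  (* Monotonicity allows [H n.+1] in place of [H n] on the right of [Hn], and the inequality
     [|c| H <= M + r H] is then solved for [H]. *)
  have HS k : H k <= H k.+1 by rewrite /H big_ord_recr/= lerDl.
  have M0 : 0 <= M by rewrite (le_trans _ (aM 0%N))// big_ord0.
  case: n => [|n]; first by rewrite /H big_ord0 mul0r.
  have := Hn n; have := HS n; have := aM n.+1; have := r0.
  move: (H n) (H n.+1) (\sum_(m < n.+1) _) => u v w; nra.
exists h; split => // t tr.
have d0 : x%:C + t%:C - p != 0.
  apply/eqP => e; have : c = - t%:C by rewrite /c; move/eqP: e; rewrite addrAC addr_eq0 => /eqP.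
  move=> /(congr1 normc); rewrite (@normcN R) normc_real => e'.
  by move: rp; rewrite e' ltNge tr.
have nd0 : 0 < normc (x%:C + t%:C - p) by rewrite normc_gt0.
rewrite /cto -cvg_shiftS /=.
apply: (@squeeze0 _ _ (fun n => (normc (x%:C + t%:C - p))^-1 * (normc (cpoly a t n.+1 - g (x + t)) + normc (h n) * r ^+ n * r))).
  move=> n; rewrite normc_ge0/= rmorphD/=.
  (* The truncated product has a single top-degree error, which tends to [0] because the weighted
     coefficients of [h] have bounded sums. *)
  have key : (x%:C + t%:C - p) * cpoly h t n.+1 = cpoly a t n.+1 + h n * t%:C ^+ n.+1.
    have -> : x%:C + t%:C - p = c + t%:C by rewrite /c; ring.
    elim: n => [|n IH]; first by rewrite /cpoly !big_ord_recr !big_ord0/= !add0r !expr0 !mulr1 mulrDl h0 expr1 [t%:C * _]mulrC.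
    rewrite /cpoly big_ord_recr/= -/(cpoly h t n.+1) mulrDr IH.
    rewrite [in RHS]big_ord_recr/= -/(cpoly a t n.+1).
    rewrite (_ : a n.+1 = c * h n.+1 + h n); last by rewrite hS subrK.
    by rewrite [t%:C ^+ n.+2]exprS; ring.
  have -> : cpoly h t n.+1 - g (x + t) / (x%:C + t%:C - p) =
    (x%:C + t%:C - p)^-1 * (cpoly a t n.+1 - g (x + t) + h n * t%:C ^+ n.+1).
    rewrite (_ : _ + h n * _ = (x%:C + t%:C - p) * cpoly h t n.+1 - g (x + t)); last by rewrite key; ring.
    by field; rewrite ?d0.
  rewrite Normc.normcM Normc.normcV ler_wpM2l ?invr_ge0 ?normc_ge0//.
  rewrite (le_trans (normcD _ _))// lerD2l Normc.normcM normcX normc_real exprSr -!mulrA.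
  rewrite ler_wpM2l ?normc_ge0// ler_pM ?exprn_ge0// lerXn2r ?nnegrE//.
rewrite -[X in _ --> X](mulr0 (normc (x%:C + t%:C - p))^-1); apply: cvgM; first exact: cvg_cst.
rewrite -[X in _ --> X](addr0 (0 : R)); apply: cvgD.
  by rewrite (cvg_shiftS (fun n => normc (cpoly a t n - g (x + t)))); exact: ag.
rewrite -[X in _ --> X](mul0r r); apply: cvgM; last exact: cvg_cst.
apply: (@bounded_sum_term0 _ _ (M / (normc c - r)) _ hb) => n.
by rewrite mulr_ge0 ?normc_ge0 ?exprn_ge0.
Qed.

End majorants.

(** * Series of majorized functions *)

Section majorized_limit.
Local Open Scope complex_scope.
Context {R : realType}.
Local Notation C := R[i].
Local Notation Re := (@complex.Re R).
Local Notation Im := (@complex.Im R).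
Local Notation normc := (@Normc.normc R).
Implicit Types (f g : R -> C) (x r t M : R).

Lemma cto_sum (u : nat -> nat -> C) (l : nat -> C) N :
  (forall i, cto (u i) (l i)) -> cto (fun n => \sum_(i < N) u i n) (\sum_(i < N) l i).
Proof.
move=> ul; elim: N => [|N IH].
  rewrite /cto big_ord0; under eq_fun do rewrite big_ord0 subrr Normc.normc0.
  exact: cvg_cst.
apply: (@squeeze0 _ _ (fun n => normc (\sum_(i < N) u i n - \sum_(i < N) l i) + normc (u N n - l N))).
  move=> n; rewrite normc_ge0/= !big_ord_recr/=; apply: le_trans (normcD _ _).
  by rewrite le_eqVlt; apply/orP; left; apply/eqP; congr normc; ring.
by rewrite -[X in _ --> X](addr0 (0 : R)); apply: cvgD => //; exact: ul.
Qed.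

Lemma cto_mulr (u : nat -> C) l c : cto u l -> cto (fun n => u n * c) (l * c).
Proof.
move=> ul; apply: (@squeeze0 _ _ (fun n => normc (u n - l) * normc c)).
  by move=> n; rewrite normc_ge0 -Normc.normcM mulrBl/=.
by rewrite -[X in _ --> X](mul0r (normc c)); apply: cvgM => //; exact: cvg_cst.
Qed.

Lemma normc_cpoly (a : nat -> C) t r n : `|t| <= r ->
  normc (cpoly a t n) <= \sum_(m < n) normc (a m) * r ^+ m.
Proof.
move=> tr; apply: (le_trans (normc_sum _)); apply: ler_sum => i _; exact: normc_term.
Qed.

Lemma majorized_norm g x r M t : majorized g x r M -> `|t| <= r -> normc (g (x + t)) <= M.
Proof.
move=> [a [aM ag]] tr.
have h n : normc (g (x + t)) <= M + normc (cpoly a t n - g (x + t)).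
  have := normcB (cpoly a t n) (cpoly a t n - g (x + t)); rewrite subKr => h.
  by apply: (le_trans h); rewrite lerD2r (le_trans (normc_cpoly _ _ tr)).
have hc : M + normc (cpoly a t n - g (x + t)) @[n --> \oo] --> M.
  by rewrite -[X in _ --> X]addr0; apply: cvgD; [exact: cvg_cst|exact: ag].
rewrite -(cvg_lim _ hc)//; apply: limr_ge; first by apply/cvg_ex; eexists; exact: hc.
exact: nearW.
Qed.

Lemma majorized_ge0 g x r M : majorized g x r M -> 0 <= M.
Proof. by move=> [a [aM _]]; have := aM 0%N; rewrite big_ord0. Qed.

(** The coefficients of the sum are the sums of the coefficients, which converge because the [e n]
    are summable. The interchange of limits rests on the tail of the [e n], which bounds the error
    uniformly in the degree [L]. *)
Lemma majorized_series (d : nat -> R -> C) g x r (e : nat -> R) E : 0 < r ->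
  (forall n, majorized (d n) x r (e n)) -> (forall n, \sum_(k < n) e k <= E) ->
  (forall t, `|t| <= r -> cto (fun n => \sum_(k < n) d k (x + t)) (g (x + t))) ->
  majorized g x r E.
Proof.
move=> r0 de eE dg; have e0 n : 0 <= e n by exact: majorized_ge0 (de n).
have [a aT] := choice de.
have [E0 [sE0 E0E sE]] := nonneg_sum_bounded_cvg e0 eE.
pose A N m := \sum_(n < N) a n m.
have rX m : 0 < r ^+ m by rewrite exprn_gt0.
have nam n m : normc (a n m) * r ^+ m <= e n.
  have [h _] := aT n; apply: le_trans (h m.+1); rewrite big_ord_recr/= lerDr.
  by apply: sumr_ge0 => i _; rewrite mulr_ge0 ?normc_ge0 ?exprn_ge0 ?ltW.
have exl m : exists l, cto (fun N => A N m) l.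
  apply: (@cto_sum_step _ _ (fun n => e n / r ^+ m) (E / r ^+ m)).
    by move=> n; rewrite /A big_ord_recr/= addrAC subrr add0r ler_pdivlMr.
  by move=> n; rewrite -mulr_suml ler_wpM2r// invr_ge0 ltW.
have [al alT] := choice exl.
have Az t L : `|t| <= r -> forall N, normc (cpoly (A N) t L - cpoly al t L) <= E0 - \sum_(k < N) e k.
  move=> tr; apply: cto_tail => //.
    move=> n; rewrite /cpoly -sumrB (eq_bigr (fun m : 'I_L => a n m * t%:C ^+ m)).
      by rewrite (le_trans (normc_cpoly _ _ tr))//; have [h _] := aT n.
    by move=> i _; rewrite /A big_ord_recr/=; ring.
  by apply: (@cto_sum (fun m N => A N m * t%:C ^+ m) (fun m => al m * t%:C ^+ m) L) => m; exact: cto_mulr.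
exists al; split.
  move=> L.
  pose w N := \sum_(m < L) normc (A N m - al m) * r ^+ m.
  have w0 : w N @[N --> \oo] --> (0 : R).
    rewrite /w; elim: L {Az w} => [|L IH].
      by under eq_fun do rewrite big_ord0; exact: cvg_cst.
    have h2 : normc (A N L - al L) * r ^+ L @[N --> \oo] --> (0 : R).
      by rewrite -[X in _ --> X](mul0r (r ^+ L)); apply: cvgM; [exact: alT|exact: cvg_cst].
    have h3 : \sum_(m < L) normc (A N m - al m) * r ^+ m + normc (A N L - al L) * r ^+ L @[N --> \oo] --> (0 : R).
      by rewrite -[X in _ --> X](addr0 (0 : R)); apply: cvgD.
    by apply: cvg_trans h3; apply: near_eq_cvg; apply: nearW => N; rewrite big_ord_recr.
  have h N : \sum_(m < L) normc (al m) * r ^+ m <= E + w N.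
    apply: (@le_trans _ _ (\sum_(m < L) normc (A N m) * r ^+ m + w N)).
      rewrite /w -big_split/=; apply: ler_sum => i _; rewrite -mulrDl ler_wpM2r ?(ltW (rX _))//.
      by have := normcB (A N i) (A N i - al i); rewrite subKr.
    rewrite lerD2r; apply: le_trans (eE N).
    rewrite (le_trans (y := \sum_(m < L) \sum_(n < N) normc (a n m) * r ^+ m))//.
      apply: ler_sum => m _; rewrite -mulr_suml ler_wpM2r ?(ltW (rX _))//; exact: normc_sum.
    rewrite exchange_big/=; apply: ler_sum => n _; have [h _] := aT n; exact: h.
  have hc : E + w N @[N --> \oo] --> E.
    by rewrite -[X in _ --> X]addr0; apply: cvgD => //; exact: cvg_cst.
  rewrite -(cvg_lim _ hc)//; apply: limr_ge; first by apply/cvg_ex; eexists; exact: hc.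
  exact: nearW.
move=> t tr; apply/cvgr0Pnorm_le => eps eps0.
have e3 : 0 < eps / 3 by rewrite divr_gt0.
have [N hN] : exists N, E0 - \sum_(k < N) e k <= eps / 3.
  have /cvgrPdist_le/(_ _ e3)[N _ h] := sE0; exists N.
  by apply: le_trans (h N (leqnn _)); rewrite ler_norm.
have dle n : normc (\sum_(k < n.+1) d k (x + t) - \sum_(k < n) d k (x + t)) <= e n.
  by rewrite big_ord_recr/= addrAC subrr add0r; exact: majorized_norm (de n) tr.
have third := cto_tail dle sE (dg t tr) N.
have /cvgr0Pnorm_le/(_ _ e3) := @cto_sum (fun n L => cpoly (a n) t L) (fun n => d n (x + t)) N
  (fun n => (aT n).2 t tr).
apply: filterS => L hL; rewrite ger0_norm ?normc_ge0//.
rewrite ger0_norm ?normc_ge0// in hL.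
have first_ := Az t L tr N.
have eA : \sum_(n < N) cpoly (a n) t L = cpoly (A N) t L.
  rewrite /cpoly exchange_big/=; apply: eq_bigr => m _; by rewrite -mulr_suml.
rewrite eA in hL.
(* Three terms of size [eps / 3]: the first and the last by the tail beyond the fixed [N], the
   middle one by the expansions of the first [N] summands for large [L]. *)
rewrite (_ : cpoly al t L - g (x + t) = - (cpoly (A N) t L - cpoly al t L) +
  (cpoly (A N) t L - \sum_(n < N) d n (x + t)) + (\sum_(n < N) d n (x + t) - g (x + t))); last by ring.
rewrite (le_trans (normcD _ _))// (le_trans (lerD (normcD _ _) (lexx _)))//.
rewrite (@normcN R); lra.
Qed.

End majorized_limit.

(** * Termwise differentiation of power series *)

Section power_series_smooth.
Local Open Scope complex_scope.
Context {R : realType}.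
Implicit Types (c : nat -> R) (u : R -> R).

(** Radius of convergence at least [r], in a form that termwise differentiation preserves. *)
Definition coef_bounded r c := forall K, 0 < K < r -> exists B, forall m, `|c m| * K ^+ m <= B.

Lemma mulSn_expr_le (q : R) m : 0 <= q < 1 -> m.+1%:R * q ^+ m <= (1 - q)^-1.
Proof.
move=> /andP[q0 q1]; rewrite -div1r ler_pdivlMr ?subr_gt0//.
have h : m.+1%:R * q ^+ m <= \sum_(i < m.+1) q ^+ i.
  rewrite mulr_natl -[X in _ *+ X](card_ord m.+1) -sumr_const.
  by apply: ler_sum => i _; rewrite ler_wiXn2l// ?ltW// -ltnS.
apply: le_trans (ler_wpM2r _ h) _; first by rewrite subr_ge0 ltW.
have := subrX1 q m.+1; have : 0 <= q ^+ m.+1 by rewrite exprn_ge0.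
move: (\sum_(i < _) _) (q ^+ _) => S Q; lra.
Qed.

(** The factor [m + 1] is absorbed by passing from [K] to a larger radius still below [r]. *)
Lemma coef_bounded_diffs r c : coef_bounded r c -> coef_bounded r (pseries_diffs c).
Proof.
move=> bc K /andP[K0 Kr].
have [K' [KK' K'r]] : exists K', K < K' /\ K' < r by exists ((K + r) / 2); split; lra.
have K'0 : 0 < K' := lt_trans K0 KK'.
have [|B hB] := bc K'; first by rewrite K'0.
have q01 : 0 <= K / K' < 1 by rewrite divr_ge0 ?ltW//= ltr_pdivrMr ?mul1r.
exists (B / K' * (1 - K / K')^-1) => m.
have -> : `|pseries_diffs c m| * K ^+ m =
   (`|c m.+1| * K' ^+ m.+1 / K') * (m.+1%:R * (K / K') ^+ m).
  rewrite /pseries_diffs normrM normr_nat exprMn exprVn exprS.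
  by field; rewrite ?expf_neq0 ?gt_eqF.
apply: ler_pM; last exact: mulSn_expr_le.
- by rewrite !mulr_ge0 ?invr_ge0 ?exprn_ge0 ?(ltW K'0).
- by rewrite !mulr_ge0 ?exprn_ge0 ?divr_ge0 ?(ltW K'0) ?(ltW K0).
- by rewrite ler_wpM2r// invr_ge0 ltW.
Qed.

Lemma coef_bounded_cvg r c t : coef_bounded r c -> `|t| < r -> cvgn (pseries c t).
Proof.
move=> bc tr; pose K := (`|t| + r) / 2.
have tK : `|t| < K by rewrite /K; lra.
have Kr : K < r by rewrite /K; lra.
have K0 : 0 < K by rewrite (le_lt_trans _ tK).
have [|B hB] := bc K; first by rewrite K0.
have B0 : 0 <= B by apply: le_trans (hB 0%N); rewrite expr0 mulr1.
apply: normed_cvg; rewrite /normed_series_of.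
apply: (@series_le_cvg _ _ (geometric B (`|t| / K))) => [n|n|n|].
- exact: normr_ge0.
- by rewrite /= mulr_ge0// exprn_ge0// divr_ge0// ltW.
- rewrite /= normrM normrX exprMn exprVn mulrCA [leLHS]mulrC ler_wpM2l ?exprn_ge0//.
  by rewrite ler_pdivlMr ?exprn_gt0.
apply: is_cvg_geometric_series.
rewrite ger0_norm; first by rewrite ltr_pdivrMr ?mul1r.
by rewrite divr_ge0// ltW.
Qed.

Lemma is_derive_pseries r c t : coef_bounded r c -> `|t| < r ->
  is_derive t (1 : R) (fun t => limn (pseries c t)) (limn (pseries (pseries_diffs c) t)).
Proof.
move=> bc tr; pose K := (`|t| + r) / 2.
have tK : `|t| < K by rewrite /K; lra.
have Kr : K < r by rewrite /K; lra.
have K0 : 0 < K by rewrite (le_lt_trans _ tK).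
have nK : `|K| < r by rewrite gtr0_norm.
apply: (@pseries_snd_diffs R c K t); last by rewrite (gtr0_norm K0).
- exact: coef_bounded_cvg nK.
- by apply: coef_bounded_cvg nK; apply: coef_bounded_diffs.
- by apply: coef_bounded_cvg nK; do 2 apply: coef_bounded_diffs.
Qed.

Lemma is_derive_local_pseries u x r c t : coef_bounded r c ->
  (forall t, `|t| < r -> u (x + t) = limn (pseries c t)) -> `|t| < r ->
  is_derive (x + t) (1 : R) u (limn (pseries (pseries_diffs c) t)).
Proof.
move=> bc uE tr.
pose v (y : R) := limn (pseries c (y - x)).
have dv : is_derive (x + t) (1 : R) v (limn (pseries (pseries_diffs c) t)).
  have h1 : is_derive (x + t) (1 : R) (fun y : R => y - x) 1.
    by apply: is_derive_eq; rewrite /=; ring.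
  have h2 : is_derive (x + t - x) (1 : R) (fun t => limn (pseries c t)) (limn (pseries (pseries_diffs c) t)).
    by rewrite (_ : x + t - x = t); [exact: is_derive_pseries bc tr|ring].
  have := @is_derive1_comp _ (fun t => limn (pseries c t)) (fun y : R => y - x) _ _ _ h2 h1.
  by rewrite mulr1.
apply: near_eq_is_derive dv.
have : \forall y \near x + t, `|y - x| < r.
  have c1 : (y - x) @[y --> x + t] --> t.
    rewrite [X in _ --> X](_ : t = x + t - x); last by ring.
    by apply: cvgB; [exact: cvg_id|exact: cvg_cst].
  have c2 : `|y - x| @[y --> x + t] --> `|t| by exact: cvg_norm.
  exact: (cvgr_lt _ c2).
by apply: filterS => y /uE; rewrite addrC subrK => ->.
Qed.

Lemma derive1n_local_pseries u x r c n : coef_bounded r c ->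
  (forall t, `|t| < r -> u (x + t) = limn (pseries c t)) ->
  forall t, `|t| < r -> derive1n n u (x + t) = limn (pseries (iter n (@pseries_diffs R) c) t) /\
    derivable (derive1n n u) (x + t) 1.
Proof.
move=> bc uE.
have bn k : coef_bounded r (iter k (@pseries_diffs R) c).
  by elim: k => //= k; exact: coef_bounded_diffs.
suff E k t : `|t| < r -> derive1n k u (x + t) = limn (pseries (iter k (@pseries_diffs R) c) t).
  move=> t tr; split; first exact: E.
  by have [] := is_derive_local_pseries (bn n) (E n) tr.
elim: k t => [|k IH] t tr; first exact: uE.
rewrite derive1nS derive1E.
by have [_ ->] := is_derive_local_pseries (bn k) IH tr.
Qed.

Lemma iter_pseries_diffs c n m :
  m`!%:R * iter n (@pseries_diffs R) c m = (m + n)`!%:R * c (m + n)%N.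
Proof.
elim: n m => [|n IH] m; first by rewrite addn0.
by rewrite iterS /pseries_diffs mulrA -natrM mulnC -factS IH addSnnS.
Qed.

Lemma pseries0 c : limn (pseries c 0) = c 0%N.
Proof.
apply: cvg_lim => //; apply: cvg_near_cst; exists 1%N => // [[|n]]//= _.
rewrite /pseries /series/= big_mkord big_ord_recl/= expr0 mulr1 big1 ?addr0// => i _.
by rewrite expr0n/= mulr0.
Qed.

End power_series_smooth.

(** * From majorants to smoothness, derivative bounds and analyticity *)

Section majorized_smooth.
Local Open Scope complex_scope.
Context {R : realType}.
Local Notation C := R[i].
Local Notation Re := (@complex.Re R).
Local Notation Im := (@complex.Im R).
Local Notation normc := (@Normc.normc R).
Implicit Types (g : R -> C) (x r t M : R).

Lemma real_complexX (t : R) n : t%:C ^+ n = (t ^+ n)%:C.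
Proof. by rewrite rmorphXn. Qed.

Lemma Re_sum n (F : 'I_n -> C) : Re (\sum_(i < n) F i) = \sum_(i < n) Re (F i).
Proof. by elim/big_rec2: _ => // i y1 y2 _ <-; rewrite !ReImE. Qed.

Lemma Im_sum n (F : 'I_n -> C) : Im (\sum_(i < n) F i) = \sum_(i < n) Im (F i).
Proof. by elim/big_rec2: _ => // i y1 y2 _ <-; rewrite !ReImE. Qed.

Lemma taylor_Re a g x r M : 0 < r -> taylor a g x r M ->
  coef_bounded r (fun m => Re (a m)) /\
  forall t, `|t| < r -> Re_fun g (x + t) = limn (pseries (fun m => Re (a m)) t).
Proof.
move=> r0 [aM ag]; split.
  move=> K /andP[K0 Kr]; exists M => m; apply: le_trans (aM m.+1).
  rewrite big_ord_recr/= ler_wpDl ?sumr_ge0// => [i _|].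
    by rewrite mulr_ge0 ?normc_ge0 ?exprn_ge0 ?ltW.
  rewrite ler_pM ?exprn_ge0 ?(ltW K0) ?Re_le_normc// lerXn2r ?nnegrE ?ltW//.
move=> t tr; apply/esym/cvg_lim => //; have [cR _] := cto_ReIm (ag t (ltW tr)).
apply: cvg_trans cR; apply: near_eq_cvg; apply: nearW => n.
rewrite /pseries /series/= big_mkord /cpoly.
rewrite Re_sum; apply: eq_bigr => i _; rewrite !ReImE real_complexX/=; ring.
Qed.

Lemma taylor_Im a g x r M : 0 < r -> taylor a g x r M ->
  coef_bounded r (fun m => Im (a m)) /\
  forall t, `|t| < r -> Im_fun g (x + t) = limn (pseries (fun m => Im (a m)) t).
Proof.
move=> r0 [aM ag]; split.
  move=> K /andP[K0 Kr]; exists M => m; apply: le_trans (aM m.+1).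
  rewrite big_ord_recr/= ler_wpDl ?sumr_ge0// => [i _|].
    by rewrite mulr_ge0 ?normc_ge0 ?exprn_ge0 ?ltW.
  rewrite ler_pM ?exprn_ge0 ?(ltW K0) ?Im_le_normc// lerXn2r ?nnegrE ?ltW//.
move=> t tr; apply/esym/cvg_lim => //; have [_ cI] := cto_ReIm (ag t (ltW tr)).
apply: cvg_trans cI; apply: near_eq_cvg; apply: nearW => n.
rewrite /pseries /series/= big_mkord /cpoly.
rewrite Im_sum; apply: eq_bigr => i _; rewrite !ReImE real_complexX/=; ring.
Qed.

Lemma majorized_smooth g : (forall x, exists r M, 0 < r /\ majorized g x r M) -> smooth g.
Proof.
move=> gM n x; have [r [M [r0 [a ta]]]] := gM x.
have [b1 e1] := taylor_Re r0 ta; have [b2 e2] := taylor_Im r0 ta.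
have n0 : `|0 : R| < r by rewrite normr0.
have [_ d1] := derive1n_local_pseries n b1 e1 n0.
have [_ d2] := derive1n_local_pseries n b2 e2 n0.
by rewrite addr0 in d1 d2.
Qed.

(** Cauchy's estimate: the derivative is [n! a_n], and one weighted coefficient is at most the whole
    sum. *)
Lemma majorized_cderiven g x r M n : 0 < r -> majorized g x r M ->
  normc (cderiven n g x) <= n`!%:R * M / r ^+ n.
Proof.
move=> r0 [a ta].
have [b1 e1] := taylor_Re r0 ta; have [b2 e2] := taylor_Im r0 ta.
have n0 : `|0 : R| < r by rewrite normr0.
have [d1 _] := derive1n_local_pseries n b1 e1 n0.
have [d2 _] := derive1n_local_pseries n b2 e2 n0.
rewrite addr0 !pseries0 in d1 d2.
have := iter_pseries_diffs (fun m => Re (a m)) n 0; rewrite fact0 mul1r -d1 add0n => f1.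
have := iter_pseries_diffs (fun m => Im (a m)) n 0; rewrite fact0 mul1r -d2 add0n => f2.
have -> : cderiven n g x = n`!%:R%:C * a n.
  by apply: eq_ReIm; rewrite /cderiven !ReImE/= ?f1 ?f2; ring.
rewrite Normc.normcM normc_real normr_nat -mulrA ler_wpM2l//.
rewrite ler_pdivlMr ?exprn_gt0//.
have [h _] := ta; apply: le_trans (h n.+1); rewrite big_ord_recr/= lerDr.
by apply: sumr_ge0 => i _; rewrite mulr_ge0 ?normc_ge0 ?exprn_ge0 ?ltW.
Qed.

Lemma majorized_analytic g : (forall x, exists r M, 0 < r /\ majorized g x r M) -> real_analytic g.
Proof.
move=> gM x0; have [r [M [r0 [a [_ ag]]]]] := gM x0.
exists a, r; split => // x xr; have := ag (x - x0) (ltW xr).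
rewrite [x0 + _]addrC subrK => h.
apply/cvgrPdist_lt => e e0.
have eR : e = (Re e)%:C by apply: eq_ReIm => //=; move: e0; rewrite ltcE/= => /andP[/eqP ->].
have e0' : 0 < Re e by move: e0; rewrite ltcE/= => /andP[].
have /cvgr0Pnorm_lt/(_ _ e0') := h; apply: filterS => n.
rewrite ger0_norm ?normc_ge0// => hn.
rewrite normrCE eR ltcR normc_distr /series/= big_mkord.
exact: hn.
Qed.

End majorized_smooth.

(** * The Blaschke-type product *)

Section product.
Local Open Scope complex_scope.
Context {R : realType}.
Local Notation C := R[i].
Local Notation Re := (@complex.Re R).
Local Notation Im := (@complex.Im R).
Local Notation normc := (@Normc.normc R).
Variables (lam w rho : nat -> R).
Hypotheses (w0 : forall k, 0 < w k) (rho1 : forall k, 1 <= rho k).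

Definition gpole k : C := 0 +i* (- rho k).
Definition apole k : C := lam k +i* (- (2 * w k)).

(* Factor [k] is [i rho_k / (y + i rho_k)], responsible for the decay, times
   the Blaschke factor [(y - lam_k) / (y - apole k)]. *)
Fixpoint bprod (n : nat) (y : R) : C :=
  if n is k.+1 then
    let h := bprod k y * ('i * (rho k)%:C) * (y%:C - gpole k)^-1 in
    h + - ('i * (2 * w k)%:C) * (h * (y%:C - apole k)^-1)
  else 1.

Let rho0 k : 0 < rho k. Proof. by rewrite (lt_le_trans _ (rho1 k)). Qed.
Let w20 k : 0 < 2 * w k. Proof. by rewrite mulr_gt0. Qed.

Lemma Im_gpole k : Im (gpole k) < 0. Proof. by rewrite /= oppr_lt0. Qed.
Lemma Im_apole k : Im (apole k) < 0. Proof. by rewrite /= oppr_lt0. Qed.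

Definition gfac k (y : R) : C := 'i * (rho k)%:C * (y%:C - gpole k)^-1.
Definition afac k (y : R) : C := (y - lam k)%:C * (y%:C - apole k)^-1.

(** The recursion is additive because orthogonality and majorants pass through sums and pole
    factors; the factored form serves for zeros and moduli. *)
Lemma bprodS n y : bprod n.+1 y = bprod n y * (gfac n y * afac n y).
Proof.
rewrite /= /gfac /afac; have n1 := subC_neq0 y (Im_apole n).
have n2 := subC_neq0 y (Im_gpole n).
have e : (y - lam n)%:C = (y%:C - apole n) - 'i * (2 * w n)%:C.
  by apply: eq_ReIm; rewrite !ReImE/=; ring.
rewrite e; move: (apole n) (gpole n) n1 n2 => a g n1 n2.
by field; rewrite ?n1 ?n2.
Qed.

Lemma normc_i (x : R) : normc ('i * x%:C) = `|x|.
Proof. by rewrite Normc.normcM normc_real normcE2/= expr0n/= add0r expr1n sqrtr1 mul1r. Qed.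

Lemma normc_gfac k y : normc (gfac k y) = rho k / normc (y%:C - gpole k).
Proof. by rewrite /gfac Normc.normcM Normc.normcV normc_i gtr0_norm. Qed.

Lemma ge_gpole k y : rho k <= normc (y%:C - gpole k) /\ `|y| <= normc (y%:C - gpole k).
Proof.
split; [apply: le_trans (Im_le_normc _)|apply: le_trans (Re_le_normc _)]; rewrite !ReImE/=.
  by rewrite sub0r opprK ger0_norm// ltW.
by rewrite subr0.
Qed.

Lemma ge_apole k y : 2 * w k <= normc (y%:C - apole k) /\ `|y - lam k| <= normc (y%:C - apole k).
Proof.
split; [apply: le_trans (Im_le_normc _)|apply: le_trans (Re_le_normc _)]; rewrite !ReImE/=//.
by rewrite sub0r opprK ger0_norm// ltW.
Qed.

Lemma normc_gfac_le1 k y : normc (gfac k y) <= 1.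
Proof.
have [h _] := ge_gpole k y.
by rewrite normc_gfac ler_pdivrMr ?mul1r// normc_gt0 subC_neq0// Im_gpole.
Qed.

Lemma normc_afac_le1 k y : normc (afac k y) <= 1.
Proof.
have [_ h] := ge_apole k y.
rewrite Normc.normcM Normc.normcV normc_real.
by rewrite ler_pdivrMr ?mul1r// normc_gt0 subC_neq0// Im_apole.
Qed.

Lemma bprod_prod n y : normc (bprod n y) = \prod_(k < n) normc (gfac k y * afac k y).
Proof.
elim: n => [|n IH]; first by rewrite big_ord0 Normc.normc1.
by rewrite bprodS Normc.normcM IH big_ord_recr.
Qed.

(** The factor of index [0] alone gives the decay and all others have modulus at most [1], so the
    bound is uniform in [n], as the dominated limit requires. *)
Lemma bprod_le n y : rho 0%N = 1 -> normc (bprod n.+1 y) <= 2 / (1 + `|y|).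
Proof.
move=> rho01.
have gl k : normc (gfac k y * afac k y) <= 1.
  by rewrite Normc.normcM mulr_ile1 ?normc_ge0 ?normc_gfac_le1 ?normc_afac_le1.
elim: n => [|n IH]; last first.
  by rewrite bprodS Normc.normcM (le_trans _ IH)// ler_piMr ?normc_ge0.
rewrite bprodS [bprod 0 y]/= mul1r Normc.normcM.
apply: (@le_trans _ _ (normc (gfac 0 y))).
  by rewrite ler_piMr ?normc_ge0 ?normc_afac_le1.
have [h1 h2] := ge_gpole 0 y; rewrite normc_gfac rho01 in h1 *.
have p : 0 < 1 + `|y| by rewrite ltr_pwDl.
rewrite ler_pdivlMr// mulrAC mul1r ler_pdivrMr ?(lt_le_trans _ h1)//; lra.
Qed.

Lemma bprod_zero n k : (k < n)%N -> bprod n (lam k) = 0.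
Proof.
elim: n => // n IH; rewrite ltnS leq_eqVlt bprodS => /predU1P[->|/IH ->]; last by rewrite mul0r.
by rewrite /afac subrr mul0r !mulr0.
Qed.

(** The induction starts with one factor because the empty product does not decay. *)
Lemma bprod_orth n : decay1 (bprod n.+1) /\ lower_orth (bprod n.+1).
Proof.
have step (g : R -> C) k : decay1 g -> lower_orth g ->
    decay1 (fun y => g y + - ('i * (2 * w k)%:C) * (g y * (y%:C - apole k)^-1)) /\
    lower_orth (fun y => g y + - ('i * (2 * w k)%:C) * (g y * (y%:C - apole k)^-1)).
  move=> dg og; have d1 : decay1 (fun y => g y * (y%:C - apole k)^-1).
    by apply: decay1M => //; apply: decay1_subV; exact: Im_apole.
  have o1 : lower_orth (fun y => g y * (y%:C - apole k)^-1).
    by apply: lower_orth_div => //; exact: Im_apole.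
  split; first by apply: decay1D => //; exact: decay1Z.
  by apply: lower_orthD => //; [exact: decay1Z|exact: lower_orthZ].
elim: n => [|n [dn on]].
  apply: step.
    rewrite (_ : (fun y => _) = fun y => ('i * (rho 0)%:C) * (y%:C - gpole 0)^-1); last first.
      by apply/funext => y; rewrite mul1r.
    by apply: decay1Z; apply: decay1_subV; exact: Im_gpole.
  rewrite (_ : (fun y => _) = fun y => ('i * (rho 0)%:C) * (y%:C - gpole 0)^-1); last first.
    by apply/funext => y; rewrite mul1r.
  apply: lower_orthZ; first by apply: decay1_subV; exact: Im_gpole.
  by apply: lower_orth_subV; exact: Im_gpole.
have -> : bprod n.+2 = fun y => (fun y => ('i * (rho n.+1)%:C) * (bprod n.+1 y * (y%:C - gpole n.+1)^-1)) y
   + - ('i * (2 * w n.+1)%:C) * ((fun y => ('i * (rho n.+1)%:C) * (bprod n.+1 y * (y%:C - gpole n.+1)^-1)) y * (y%:C - apole n.+1)^-1).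
  by apply/funext => y; rewrite [LHS]/= -/(bprod n.+1 y); ring.
have d1 : decay1 (fun y => bprod n.+1 y * (y%:C - gpole n.+1)^-1).
  by apply: decay1M => //; apply: decay1_subV; exact: Im_gpole.
apply: step; first exact: decay1Z.
by apply: lower_orthZ => //; apply: lower_orth_div => //; exact: Im_gpole.
Qed.

Section majorant.
Local Open Scope complex_scope.
Variables (x r : R).
Hypotheses (r0 : 0 < r) (r4 : r <= 4^-1).
Hypothesis ra : forall k, r < normc (x%:C - apole k).

Definition gmaj k := rho k / (normc (x%:C - gpole k) - r).
Definition tau k := 2 * w k / (normc (x%:C - apole k) - r).
Definition pmaj n := \prod_(k < n) (gmaj k * (1 + tau k)).

Let rg k : r < normc (x%:C - gpole k).
Proof.
have [h _] := ge_gpole k x; rewrite (lt_le_trans _ h)// (lt_le_trans _ (rho1 k))//.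
by rewrite (le_lt_trans r4)// invf_lt1// ltr1n.
Qed.

Lemma gmaj_ge0 k : 0 <= gmaj k.
Proof. by rewrite divr_ge0 ?subr_ge0 ?ltW. Qed.

Lemma tau_ge0 k : 0 <= tau k.
Proof. by rewrite divr_ge0 ?subr_ge0 ?ltW. Qed.

Lemma pmaj_ge0 n : 0 <= pmaj n.
Proof. by apply: prodr_ge0 => i _; rewrite mulr_ge0 ?gmaj_ge0// addr_ge0 ?tau_ge0. Qed.

Lemma gmaj_le k : gmaj k <= 1 + (rho k)^-1.
Proof.
have [h _] := ge_gpole k x; have h1 := rho1 k; have h0 := rho0 k.
rewrite ler_pdivrMr ?subr_gt0//.
apply: (@le_trans _ _ ((1 + (rho k)^-1) * (rho k - 4^-1))); last first.
  have i0 : 0 <= (rho k)^-1 by rewrite invr_ge0 ltW.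
  by apply: ler_wpM2l; [rewrite addr_ge0|move: r4; lra].
rewrite mulrDl mul1r mulrBr mulVf ?gt_eqF//.
have : (rho k)^-1 <= 1 by rewrite invf_le1.
by move: (rho k)^-1 => v; lra.
Qed.

(** The source of the decay: the pole is at distance at least [2 rho_k], of which the radius
    [r <= 1/4] costs at most [rho_k / 2]. *)
Lemma gmaj_le23 k : 2 * rho k <= `|x| -> gmaj k <= 2 / 3.
Proof.
move=> hx; have [_ h] := ge_gpole k x; have h1 := rho1 k.
by rewrite ler_pdivrMr ?subr_gt0//; move: r4; lra.
Qed.

(** The second bound makes the increments summable: [1 - i rho / (y + i rho) = y / (y + i rho)] is
    of order [|x| / rho], and the other factor differs from [1] by at most [tau]. *)
Lemma majorized_bprodS n M : majorized (bprod n) x r M ->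
  majorized (bprod n.+1) x r (M * (gmaj n * (1 + tau n))) /\
  majorized (fun y => bprod n.+1 y - bprod n y) x r
    (M * ((`|x| + r) / (normc (x%:C - gpole n) - r) + gmaj n * tau n)).
Proof.
move=> mb; have r0' := ltW r0.
have mh : majorized (fun y => bprod n y * ('i * (rho n)%:C) * (y%:C - gpole n)^-1) x r (M * gmaj n).
  rewrite (_ : (fun y => _) = fun y => ('i * (rho n)%:C) * (bprod n y * (y%:C - gpole n)^-1)); last first.
    by apply/funext => y; ring.
  rewrite (_ : M * gmaj n = normc ('i * (rho n)%:C) * (M / (normc (x%:C - gpole n) - r))); last first.
    by rewrite normc_i gtr0_norm// /gmaj; ring.
  by apply: majorizedZ; exact: majorized_div.
have mt : majorized (fun y => - ('i * (2 * w n)%:C) * (bprod n y * ('i * (rho n)%:C) * (y%:C - gpole n)^-1 * (y%:C - apole n)^-1)) x r (M * gmaj n * tau n).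
  rewrite (_ : _ * tau n = normc (- ('i * (2 * w n)%:C)) * (M * gmaj n / (normc (x%:C - apole n) - r))); last first.
    by rewrite (@normcN R) normc_i gtr0_norm// /tau; ring.
  by apply: majorizedZ; exact: majorized_div.
split.
  rewrite (_ : M * _ = M * gmaj n + M * gmaj n * tau n); last by ring.
  exact: majorizedD.
have md : majorized (fun y => - 1 * (y%:C * bprod n y * (y%:C - gpole n)^-1)) x r
    (M * ((`|x| + r) / (normc (x%:C - gpole n) - r))).
  rewrite (_ : M * _ = normc (- 1 : C) * ((`|x| + r) * M / (normc (x%:C - gpole n) - r))); last first.
    by rewrite (@normcN R) Normc.normc1; ring.
  by apply: majorizedZ; apply: majorized_div => //; exact: majorizedMz.
rewrite mulrDr mulrA.
rewrite (_ : (fun y => _) = fun y => - 1 * (y%:C * bprod n y * (y%:C - gpole n)^-1) +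
  - ('i * (2 * w n)%:C) * (bprod n y * ('i * (rho n)%:C) * (y%:C - gpole n)^-1 * (y%:C - apole n)^-1)).
  exact: majorizedD.
apply/funext => y; rewrite [bprod n.+1 y]/=.
have n1 := subC_neq0 y (Im_apole n); have n2 := subC_neq0 y (Im_gpole n).
have e : y%:C = (y%:C - gpole n) - 'i * (rho n)%:C.
  by apply: eq_ReIm; rewrite !ReImE/=; ring.
rewrite [X in _ = - 1 * (X * _ * _) + _]e.
move: (apole n) (gpole n) n1 n2 {e} => a g n1 n2.
by field; rewrite ?n1 ?n2.
Qed.

Lemma majorized_bprod n : majorized (bprod n) x r (pmaj n).
Proof.
elim: n => [|n IH].
  by rewrite /pmaj big_ord0 -(Normc.normc1 R); exact/majorized_cst/ltW.
have [h _] := majorized_bprodS IH.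
by rewrite /pmaj big_ord_recr.
Qed.

Variables (Srho Stau : R).
Hypothesis hSrho : forall n, \sum_(k < n) (rho k)^-1 <= Srho.
Hypothesis hStau : forall n, \sum_(k < n) tau k <= Stau.

Lemma pmaj_le N n : (forall k, (k < N)%N -> 2 * rho k <= `|x|) -> (N <= n)%N ->
  pmaj n <= (2 / 3) ^+ N * expR (Srho + Stau).
Proof.
move=> hN Nn.
have irho k : 0 <= (rho k)^-1 by rewrite invr_ge0 ltW.
apply: (@le_trans _ _ ((2 / 3) ^+ N * \prod_(k < n) ((1 + (rho k)^-1) * (1 + tau k)))).
  rewrite /pmaj -(subnKC Nn) !big_split_ord/= mulrA ler_pM//.
  - by apply: prodr_ge0 => i _; rewrite mulr_ge0 ?gmaj_ge0// addr_ge0 ?tau_ge0.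
  - by apply: prodr_ge0 => i _; rewrite mulr_ge0 ?gmaj_ge0// addr_ge0 ?tau_ge0.
  - have -> : (2 / 3) ^+ N = \prod_(i < N) (2 / 3) :> R by rewrite prodr_const card_ord.
    rewrite -big_split/=.
    apply: ler_prod => i _; rewrite mulr_ge0 ?gmaj_ge0 ?addr_ge0 ?tau_ge0//= mulrA.
    rewrite ler_wpM2r ?addr_ge0 ?tau_ge0// (le_trans (gmaj_le23 (hN _ _)))//.
    by rewrite ler_peMr ?lerDl.
  - apply: ler_prod => i _; rewrite mulr_ge0 ?gmaj_ge0 ?addr_ge0 ?tau_ge0//=.
    by rewrite ler_wpM2r ?addr_ge0 ?tau_ge0// gmaj_le.
rewrite ler_wpM2l ?exprn_ge0// big_split/= expRD.
apply: ler_pM.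
- by apply: prodr_ge0 => i _; rewrite addr_ge0.
- by apply: prodr_ge0 => i _; rewrite addr_ge0 ?tau_ge0.
- by rewrite (le_trans (prod1D_le_expR _ irho))// ler_expR.
- by rewrite (le_trans (prod1D_le_expR _ tau_ge0))// ler_expR.
Qed.

Definition diff_maj N n :=
  (2 / 3) ^+ N * expR (Srho + Stau) * (2 * (`|x| + 1) * (rho (N + n))^-1 + 2 * tau (N + n)).

Lemma majorized_bprod_diff N n : (forall k, (k < N)%N -> 2 * rho k <= `|x|) ->
  majorized (fun y => bprod (N + n).+1 y - bprod (N + n) y) x r (diff_maj N n).
Proof.
move=> hN; pose E := (2 / 3) ^+ N * expR (Srho + Stau).
have [_ h] := majorized_bprodS (majorized_bprod (N + n)).
apply: majorized_le h; apply: ler_pM; rewrite ?pmaj_ge0//.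
- apply: addr_ge0; last by rewrite mulr_ge0 ?gmaj_ge0 ?tau_ge0.
by apply: divr_ge0; [rewrite addr_ge0// ltW|rewrite subr_ge0 ltW].
- by apply: pmaj_le => //; exact: leq_addr.
- have h1 := rho1 (N + n); have h0 := rho0 (N + n).
apply: lerD; last first.
  rewrite ler_wpM2r ?tau_ge0// (le_trans (gmaj_le _))//.
  have : (rho (N + n))^-1 <= 1 by rewrite invf_le1.
  by move: (rho (N + n))^-1 => v; lra.
have [hg _] := ge_gpole (N + n) x; have hr := rg (N + n).
rewrite (_ : 2 * _ / _ = (`|x| + 1) * (2 / rho (N + n))); last by ring.
apply: ler_pM; rewrite ?addr_ge0 ?invr_ge0 ?subr_ge0 ?(ltW hr) ?(ltW r0)//.
  by rewrite lerD2l; move: r4; lra.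
rewrite ler_pdivlMr// mulrC ler_pdivrMr ?subr_gt0//.
by move: r4; lra.
Qed.

Lemma sum_diff_maj N n : \sum_(k < n) diff_maj N k <=
  (2 / 3) ^+ N * expR (Srho + Stau) * (2 * (`|x| + 1) * Srho + 2 * Stau).
Proof.
have E0 : 0 <= (2 / 3) ^+ N * expR (Srho + Stau) by rewrite mulr_ge0 ?exprn_ge0 ?expR_ge0.
have irho k : 0 <= (rho k)^-1 by rewrite invr_ge0 ltW.
have shift (u : nat -> R) S : (forall k, 0 <= u k) -> (forall m, \sum_(k < m) u k <= S) ->
    \sum_(k < n) u (N + k)%N <= S.
  move=> u0 uS; apply: le_trans (uS (N + n)%N); rewrite big_split_ord/= lerDr.
  exact: sumr_ge0.
rewrite /diff_maj -mulr_sumr ler_wpM2l// big_split/= -!mulr_sumr lerD//.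
  by rewrite ler_wpM2l ?mulr_ge0 ?addr_ge0// (shift _ _ irho).
by rewrite ler_wpM2l// (shift _ _ tau_ge0).
Qed.

Lemma bprod_cvg : exists l, cto (bprod ^~ x) l.
Proof.
have hN k : (k < 0)%N -> 2 * rho k <= `|x| by [].
apply: (cto_sum_step _ (sum_diff_maj 0)) => n.
have := majorized_norm (majorized_bprod_diff n hN) (t := 0); rewrite addr0 normr0.
by apply; exact: ltW.
Qed.

(** The telescoping series starts at index [N], so that the first [N] small factors are present in
    every term and [(2/3)^N] can be taken out. *)
Lemma majorized_bprod_lim f N : (forall t, `|t| <= r -> cto (fun n => bprod n (x + t)) (f (x + t))) ->
  (forall k, (k < N)%N -> 2 * rho k <= `|x|) ->
  majorized f x r ((2 / 3) ^+ N * expR (Srho + Stau) * (1 + (2 * (`|x| + 1) * Srho + 2 * Stau))).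
Proof.
move=> fl hN; pose E := (2 / 3) ^+ N * expR (Srho + Stau).
pose d n y := bprod (N + n).+1 y - bprod (N + n) y.
have de n : majorized (d n) x r (diff_maj N n) by exact: majorized_bprod_diff.
have se n := sum_diff_maj N n.
have mN : majorized (bprod N) x r E.
  by apply: majorized_le (majorized_bprod N); exact: pmaj_le.
have msum : majorized (fun y => f y - bprod N y) x r (E * (2 * (`|x| + 1) * Srho + 2 * Stau)).
  apply: (majorized_series r0 de se) => t tr.
  have := fl t tr; rewrite /cto -(cvg_shiftn N); apply: cvg_trans.
  apply: near_eq_cvg; apply: nearW => n; congr normc.
  have -> : \sum_(k < n) d k (x + t) = bprod (N + n) (x + t) - bprod N (x + t).
    elim: n => [|n IH]; first by rewrite big_ord0 addn0 subrr.
    by rewrite big_ord_recr/= IH /d addnS addrC subrKA.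
  by rewrite addnC; ring.
rewrite mulrDr mulr1.
have := majorizedD (ltW r0) mN msum.
by rewrite (_ : (fun y => _) = f)//; apply/funext => y; rewrite addrC subrK.
Qed.

End majorant.
End product.

(** * Estimates uniform in the base point *)

Section estimates.
Local Open Scope complex_scope.
Context {R : realType}.
Local Notation C := R[i].
Local Notation Re := (@complex.Re R).
Local Notation Im := (@complex.Im R).
Local Notation normc := (@Normc.normc R).
Variables (beta kappa C0 s : R) (lam : nat -> R).
Implicit Types x y : R.
Local Notation T y := (`|y| `^ beta).
Hypotheses (beta1 : 1 <= beta) (kappa0 : 0 < kappa) (C00 : 0 <= C0).
Hypothesis star : forall k, `|T (lam k) - kappa * k%:R| <= C0.
Hypothesis s01 : 0 < s < 1.

Definition width k : R := (k.+1%:R ^+ 4)^-1.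
Definition decay_pole k : R := k.+1%:R `^ s^-1.

Let s0 : 0 < s. Proof. by case/andP: s01. Qed.
Let T0 y : 0 <= T y. Proof. exact: powR_ge0. Qed.
Let beta0 : 0 <= beta. Proof. by rewrite (le_trans _ beta1). Qed.

Lemma width_gt0 k : 0 < width k.
Proof. by rewrite invr_gt0 exprn_gt0. Qed.

Lemma decay_pole_ge1 k : 1 <= decay_pole k.
Proof.
rewrite /decay_pole -[leLHS](powRr0 (k.+1%:R)); apply: ler_powR.
  by rewrite ler1n.
by rewrite invr_ge0 ltW.
Qed.

Lemma decay_pole0 : decay_pole 0 = 1.
Proof. by rewrite /decay_pole powR1. Qed.

Lemma T_near x y : `|x - y| <= 1 -> T x <= 2 `^ beta * (1 + T y).
Proof.
move=> xy; apply: le_trans (powRD1_le beta0 (normr_ge0 y)).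
apply: ge0_ler_powR; rewrite ?nnegrE ?addr_ge0//.
have := ler_normD (x - y) y; rewrite subrK; lra.
Qed.

Definition Dconst : R := (2 `^ beta + C0) / kappa + 1.

Lemma Dconst_ge1 : 1 <= Dconst.
Proof. by rewrite lerDr; apply: divr_ge0; rewrite ?addr_ge0 ?powR_ge0 ?(ltW kappa0). Qed.

(** The asymptotics of the enumeration bound the index of a zero near [x], and hence the inverse
    depth of its pole, polynomially in [|x|]. *)
Lemma near_index_le x k : `|x - lam k| <= 1 -> k.+1%:R <= Dconst * (1 + T x).
Proof.
rewrite distrC => /T_near h; have := star k; rewrite ler_norml => /andP[h1 _].
have Tx := T0 x; rewrite -natr1 /Dconst mulrDl mul1r.
suff : k%:R <= (2 `^ beta + C0) / kappa * (1 + T x) by lra.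
rewrite mulrAC ler_pdivlMr// mulrDl.
have : C0 <= C0 * (1 + T x) by rewrite ler_peMr// lerDl.
lra.
Qed.

(* At most half the distance from [x] to every pole of the product, and
   polynomially small in [x]. *)
Definition locrad (x : R) : R := (4 * (Dconst * (1 + T x)) ^+ 4)^-1.

Let D1T x : 1 <= Dconst * (1 + T x).
Proof.
have h := Dconst_ge1; have Tx := T0 x; apply: le_trans h _.
by rewrite ler_peMr ?lerDl// (le_trans _ Dconst_ge1).
Qed.

Lemma locrad_gt0 x : 0 < locrad x.
Proof. by rewrite invr_gt0 mulr_gt0// exprn_gt0// (lt_le_trans _ (D1T x)). Qed.

Lemma locrad_le4 x : locrad x <= 4^-1.
Proof.
have p : 0 < Dconst * (1 + T x) := lt_le_trans ltr01 (D1T x).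
have p4 : 0 < 4 * (Dconst * (1 + T x)) ^+ 4 by rewrite mulr_gt0// exprn_gt0.
rewrite /locrad lef_pV2 ?posrE//.
by rewrite ler_peMr// exprn_ege1.
Qed.

Lemma locrad_near x k : `|x - lam k| <= 1 -> locrad x <= width k / 4.
Proof.
move=> /near_index_le h; rewrite /locrad /width invfM mulrC ler_wpM2r// lef_pV2 ?posrE ?exprn_gt0//.
  by rewrite lerXn2r ?nnegrE// (le_trans _ (D1T x)).
by rewrite (lt_le_trans _ (D1T x)).
Qed.

Local Notation apole := (apole lam width).

Lemma locrad_apole x k : 2 * locrad x <= normc (x%:C - apole k).
Proof.
have [h1 h2] := ge_apole lam width_gt0 k x.
have [/locrad_near h|h] := leP `|x - lam k| 1.
  by have := width_gt0 k; lra.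
by have := locrad_le4 x; lra.
Qed.

Lemma locrad_lt_apole x k : locrad x < normc (x%:C - apole k).
Proof. by have := locrad_apole x k; have := locrad_gt0 x; lra. Qed.

Definition close x k := `|x - lam k| < (k.+1%:R ^+ 2)^-1.

(** The denominator of [tau] is at least half the distance to the pole. That distance is at least
    [2 w_k], which gives [2] for a close zero, and at least [(k+1)^-2] otherwise, which turns
    [4 w_k] into [4 (k+1)^-2]. *)
Lemma tau_le x k : tau lam width x (locrad x) k <= 4 * (k.+1%:R ^+ 2)^-1 + 2 * (close x k)%:R.
Proof.
have [h1 h2] := ge_apole lam width_gt0 k x; have h3 := locrad_apole x k.
have w0 := width_gt0 k; have r0 := locrad_gt0 x.
have p : 0 < normc (x%:C - apole k) - locrad x by rewrite subr_gt0 locrad_lt_apole.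
have q1 : 1 <= k.+1%:R :> R by rewrite ler1n.
have q2 : 0 < k.+1%:R ^+ 2 :> R by rewrite exprn_gt0.
have i0 : 0 < (k.+1%:R ^+ 2)^-1 :> R by rewrite invr_gt0.
have wE : width k = (k.+1%:R ^+ 2)^-1 * (k.+1%:R ^+ 2)^-1 :> R.
  by rewrite /width -invfM -exprD.
rewrite /tau ler_pdivrMr//; case: (boolP (close x k)) => c; last first.
  rewrite mulr0 addr0.
  have {}c : (k.+1%:R ^+ 2)^-1 <= `|x - lam k| by rewrite leNgt.
  by move: (normc _) h1 h2 h3 p wE c i0 => N; move: (_^-1) (width k) => i v; nra.
rewrite mulr1.
by move: (normc _) h1 h2 h3 p wE i0 => N; move: (_^-1) (width k) => i v; nra.
Qed.

(** Near [lam k] the slope of [T] is [O(k + 1)], so over a distance [(k+1)^-2] the value of [T]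
    moves by a constant [C1]. Two close zeros then have [T]-values, and by [star] indices, at
    bounded distance. *)
Lemma close_spread : exists D, forall x k l, close x k -> close x l -> (k <= l + D)%N.
Proof.
pose J := (Num.trunc beta).+1.
have bJ : beta <= J%:R by rewrite ltW// truncnS_gt.
pose C1 := J%:R * (1 + 2 `^ beta * (1 + C0 + kappa)).
have C10 : 0 <= C1.
  by rewrite mulr_ge0// addr_ge0// mulr_ge0 ?powR_ge0// !addr_ge0// ltW.
have Tclose x k : close x k -> `|T x - T (lam k)| <= C1.
  rewrite /close; set i := (_^-1) => cx.
  have q1 : 1 <= k.+1%:R :> R by rewrite ler1n.
  have q2 : 1 <= k.+1%:R ^+ 2 :> R by rewrite exprn_ege1.
  have i1 : i <= 1 by rewrite invf_le1// (lt_le_trans _ q2).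
  have i0 : 0 < i by rewrite invr_gt0 (lt_le_trans _ q2).
  have x1 : `|x - lam k| <= 1 by rewrite (le_trans (ltW cx)).
  (* Stated for an ordered pair so that it serves whichever of [x] and [lam k] is the larger in
     absolute value. *)
  have key (u v : R) : `| `|u| - `|v| | <= i -> `|u| <= `|v| -> T v <= 2 `^ beta * (1 + T (lam k)) -> T v - T u <= C1.
    move=> huv uv Tv.
    apply: (le_trans (powR_lip (J := J) _ _)); rewrite ?beta1 ?bJ ?normr_ge0 ?uv//.
    have := star k; rewrite ler_norml => /andP[_ h2].
    have Tl : 1 + T (lam k) <= (1 + C0 + kappa) * k.+1%:R.
      rewrite -natr1 in q1 *; have := ltW kappa0; move: h2 C00 q1; move: (k%:R : R) => n; nra.
    rewrite /C1 -!mulrA ler_wpM2l//.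
    have Tv' : 1 + T v <= (1 + 2 `^ beta * (1 + C0 + kappa)) * k.+1%:R.
      have h := ler_wpM2l (powR_ge0 2 beta) Tl; rewrite mulrA in h; rewrite mulrDl mul1r; lra.
    have duv : `|v| - `|u| <= i by move: huv; rewrite ler_norml; lra.
    have ik : k.+1%:R * i <= 1.
      by rewrite /i ler_pdivrMr ?(lt_le_trans _ q2)// mul1r expr2 ler_peMr// ltW.
    have A0 : 0 <= 1 + 2 `^ beta * (1 + C0 + kappa).
      by rewrite addr_ge0// mulr_ge0 ?powR_ge0// !addr_ge0// ltW.
    have d0 : 0 <= `|v| - `|u| by rewrite subr_ge0.
    have k0 : 0 <= k.+1%:R :> R by [].
    apply: (le_trans (ler_pM _ d0 Tv' duv)); first by rewrite addr_ge0.
    by rewrite -mulrA ler_piMr.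
  have huv : `| `|x| - `|lam k| | <= i by rewrite (le_trans (ler_dist_dist _ _))// ltW.
  have [xl|xl] := leP `|x| `|lam k|.
    rewrite distrC ger0_norm; last first.
      by rewrite subr_ge0; apply: ge0_ler_powR; rewrite ?nnegrE.
    apply: key => //; apply: (@T_near (lam k)); rewrite subrr normr0//.
  rewrite ger0_norm; last first.
    by rewrite subr_ge0; apply: ge0_ler_powR; rewrite ?nnegrE// ltW.
  apply: key; rewrite ?(ltW xl)//; first by rewrite distrC.
  exact: T_near.
exists (Num.trunc ((2 * C1 + 2 * C0) / kappa)).+1 => x k l /Tclose ck /Tclose cl.
have := star k; have := star l; rewrite -(ler_nat R) natrD.
have := truncnS_gt ((2 * C1 + 2 * C0) / kappa).
set m : R := (Num.trunc _).+1%:R; rewrite ltr_pdivrMr// => hm.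
move: ck cl; rewrite !ler_norml => /andP[a1 a2] /andP[b1 b2] /andP[c1 c2] /andP[d1 d2].
suff : kappa * k%:R <= kappa * (l%:R + m) by rewrite ler_pM2l.
by rewrite mulrDr; move: hm; rewrite [m * kappa]mulrC; lra.
Qed.

Lemma sum_tau : exists2 S, 0 <= S & forall x n, \sum_(k < n) tau lam width x (locrad x) k <= S.
Proof.
have [D hD] := close_spread; exists (4 * 2 + 2 * D.+1%:R).
  by rewrite addr_ge0// mulr_ge0.
move=> x n; apply: (@le_trans _ _ (\sum_(k < n) (4 * (k.+1%:R ^+ 2)^-1 + 2 * (close x k)%:R))).
  by apply: ler_sum => i _; exact: tau_le.
rewrite big_split/= -!mulr_sumr lerD// ler_wpM2l//; first exact: sum_inv_sqr.
by apply: sum_spread => k l; exact: hD.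
Qed.

Lemma sum_decay_pole : exists2 S, 0 <= S & forall n, \sum_(k < n) (decay_pole k)^-1 <= S.
Proof. by apply: sum_inv_powR; case/andP: s01 => h1 h2; rewrite invf_gt1. Qed.

Lemma decay_pole_le x k : (k < Num.trunc ((`|x| / 2) `^ s))%N -> 2 * decay_pole k <= `|x|.
Proof.
move=> hk; have h : k.+1%:R <= (`|x| / 2) `^ s.
  by rewrite -truncn_ge_nat// powR_ge0.
have x2 : 0 <= `|x| / 2 by rewrite divr_ge0.
rewrite mulrC -ler_pdivlMr// /decay_pole.
have -> : `|x| / 2 = ((`|x| / 2) `^ s) `^ s^-1 by rewrite -powRrM divff ?powRr1// gt_eqF.
by apply: ge0_ler_powR; rewrite ?nnegrE ?powR_ge0// invr_ge0 ltW.
Qed.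

Local Notation bprod := (bprod lam width decay_pole).

Lemma bprod_limit : exists f : R -> C, exists E,
  [/\ forall x, cto (bprod ^~ x) (f x), 0 <= E &
   forall x, majorized f x (locrad x)
     ((2 / 3) ^+ (Num.trunc ((`|x| / 2) `^ s)) * (E * (1 + `|x|)))].
Proof.
have [Sr Sr0 hSr] := sum_decay_pole; have [St St0 hSt] := sum_tau.
have ex x := bprod_cvg width_gt0 decay_pole_ge1 (locrad_gt0 x) (locrad_le4 x) (locrad_lt_apole x) hSr (hSt x).
have [f hf] := choice ex.
exists f, (expR (Sr + St) * (1 + 2 * Sr + 2 * St)); split => //.
  by rewrite mulr_ge0 ?expR_ge0// !addr_ge0// mulr_ge0.
move=> x.
have := majorized_bprod_lim width_gt0 decay_pole_ge1 (locrad_gt0 x) (locrad_le4 x)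
  (locrad_lt_apole x) hSr (hSt x) (fun t _ => hf (x + t)) (@decay_pole_le x).
apply: majorized_le; rewrite -!mulrA ler_wpM2l ?exprn_ge0// ler_wpM2l ?expR_ge0//.
by have := normr_ge0 x; nra.
Qed.

End estimates.

(** * The limit function: decay, Hilbert transform and non-vanishing *)

Section decaying_function.
Local Open Scope complex_scope.
Context {R : realType}.
Local Notation C := R[i].
Local Notation Re := (@complex.Re R).
Local Notation Im := (@complex.Im R).
Local Notation normc := (@Normc.normc R).
Implicit Types x y : R.

Lemma majorized_lip (g : R -> C) x (r M t : R) : 0 < r -> majorized g x r M -> `|t| <= r ->
  normc (g (x + t) - g x) <= M / r * `|t|.
Proof.
move=> r0 [a [aM ag]] tr.
have g0 : g x = a 0%N.
  have := ag 0; rewrite normr0 addr0 => /(_ (ltW r0)) h.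
  have h2 : normc (a 0%N - g x) = 0.
    have hc : normc (cpoly a 0 n - g x) @[n --> \oo] --> normc (a 0%N - g x).
      apply: cvg_near_cst; exists 1%N => // [[|n]]//= _.
      rewrite /cpoly big_ord_recl/= expr0 mulr1 big1 ?addr0// => i _.
      by rewrite exprS mul0r mulr0.
    exact: cvg_unique hc h.
  by apply/esym/eqP; rewrite -subr_eq0 -normc_eq0 h2.
have bound n : normc (cpoly a t n.+1 - a 0%N) <= M / r * `|t|.
  rewrite /cpoly big_ord_recl/= expr0 mulr1 addrC addKr.
  apply: (le_trans (normc_sum _)).
  apply: (@le_trans _ _ (\sum_(i < n) normc (a i.+1) * r ^+ i.+1 * (`|t| / r))).
    apply: ler_sum => i _; rewrite Normc.normcM normcX normc_real -mulrA ler_wpM2l ?normc_ge0//.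
    rewrite (_ : r ^+ i.+1 * (`|t| / r) = r ^+ i * `|t|); last by rewrite exprS; field; rewrite gt_eqF.
    by rewrite /bump/= add1n exprSr ler_wpM2r// lerXn2r ?nnegrE ?(ltW r0).
  rewrite -mulr_suml mulrAC -mulrA ler_wpM2r ?divr_ge0// ?(ltW r0)//.
  apply: le_trans (aM n.+1); rewrite big_ord_recl/= lerDr.
  by rewrite mulr_ge0 ?normc_ge0 ?exprn_ge0 ?(ltW r0).
have h n : normc (g (x + t) - g x) <= M / r * `|t| + normc (cpoly a t n.+1 - g (x + t)).
  rewrite (_ : g (x + t) - g x = (cpoly a t n.+1 - a 0%N) - (cpoly a t n.+1 - g (x + t))); last by rewrite g0; ring.
  by rewrite (le_trans (normcB _ _))// lerD2r.
have hc : M / r * `|t| + normc (cpoly a t n.+1 - g (x + t)) @[n --> \oo] --> M / r * `|t|.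
  rewrite -[X in _ --> X]addr0; apply: cvgD; first exact: cvg_cst.
  by rewrite (cvg_shiftS (fun n => normc (cpoly a t n - g (x + t)))); exact: ag.
rewrite -(cvg_lim _ hc)//; apply: limr_ge; first by apply/cvg_ex; eexists; exact: hc.
exact: nearW.
Qed.

Lemma smooth_cmeasurable (f : R -> C) : smooth f -> cmeasurable f.
Proof.
move=> sf; split; apply: continuous_measurable_fun => x;
  have [d1 d2] := sf 0%N x; apply: differentiable_continuous; exact/derivable1_diffP.
Qed.

(** The factor [3 / 2] pays for rounding the exponent down. *)
Lemma expn23_le (z : R) : 0 <= z -> (2 / 3) ^+ Num.trunc z <= 3 / 2 * expR (- (ln (3 / 2) * z)).
Proof.
move=> z0; have l0 : 0 <= ln (3 / 2 : R) by rewrite ln_ge0//; lra.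
have e : (2 / 3 : R) = expR (- ln (3 / 2)).
  by rewrite expRN lnK ?posrE; [field|lra].
have h : (2 / 3) ^+ (Num.trunc z).+1 <= expR (- (ln (3 / 2) * z)).
  rewrite e -expRM_natl ler_expR mulrN lerN2 mulrC ler_wpM2r// ?ltW ?truncnS_gt//.
move: h; rewrite exprS; lra.
Qed.

Lemma not_in_sequence (l : nat -> R) : exists x, forall k, x != l k.
Proof.
have [//|h] := pselect (exists x, forall k, x != l k).
have : range l = setT.
  apply/seteqP; split => // x _; apply: contrapT => nx; apply: h; exists x => k.
  by apply/eqP => xk; apply: nx; exists k.
move=> e; have : lebesgue_measure (range l) = 0%E.
  apply: countable_lebesgue_measure0.
  exact: card_le_trans (card_image_le _ _) _.
rewrite e => h0; have : (lebesgue_measure (`[0%R, 1%R]%classic : set R) <= 0)%E.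
  by rewrite -h0; apply: le_measure; rewrite ?inE//.
by rewrite lebesgue_measure_itv/= lte_fin ltr01 oppr0 adde0 lee_fin ler10.
Qed.

Variables (beta kappa C0 s : R) (lam : nat -> R).
Local Notation T y := (`|y| `^ beta).
Hypotheses (beta1 : 1 <= beta) (kappa0 : 0 < kappa) (C00 : 0 <= C0).
Hypothesis star : forall k, `|T (lam k) - kappa * k%:R| <= C0.
Hypothesis s01 : 0 < s < 1.
Local Notation bprod := (bprod lam (@width R) (decay_pole s)).
Local Notation locrad := (locrad beta kappa C0).

Lemma locradV_le : exists K J, 0 <= K /\ forall x, (locrad x)^-1 <= K * (1 + `|x|) ^+ J.
Proof.
pose J := (Num.trunc beta).+1.
have bJ : beta <= J%:R by rewrite ltW// truncnS_gt.
have D1 := Dconst_ge1 beta kappa0 C00.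
have D0 : 0 <= Dconst beta kappa C0 by rewrite (le_trans _ D1).
exists (4 * (Dconst beta kappa C0 * 2) ^+ 4), (J * 4)%N; split.
  by rewrite mulr_ge0// exprn_ge0// mulr_ge0.
move=> x; rewrite /locrad invrK -mulrA ler_wpM2l// exprM -exprMn.
have x1 : 1 <= (1 + `|x|) ^+ J by rewrite exprn_ege1// lerDl.
have hT : T x <= (1 + `|x|) ^+ J by apply: powR_le_expr; rewrite ?bJ ?(le_trans _ beta1).
have T0 : 0 <= T x by exact: powR_ge0.
move: (Dconst _ _ _) D0 => D D0.
rewrite lerXn2r ?nnegrE ?mulr_ge0 ?addr_ge0 ?exprn_ge0//.
by rewrite -mulrA ler_wpM2l//; lra.
Qed.

(** Once [hilbert f = - i f] is known, zeros and decay pass from [f] to its transform, so one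
    exponent [s] above [p] and [q] covers both weights. *)
Lemma enum_nonuniqueness p q : 0 < p <= s -> 0 < q <= s ->
  exists f : R -> C, [/\ schwartz_hilbert p q f, real_analytic f, exists x, f x != 0,
    forall k, f (lam k) = 0 & forall k, hilbert f (lam k) = 0].
Proof.
move=> ps qs; have [s0 s1] := andP s01.
have w0 := @width_gt0 R; have rho1 := decay_pole_ge1 s01.
have [f [E [fl E0 fM]]] := bprod_limit beta1 kappa0 C00 star s01.
have rad0 := locrad_gt0 beta kappa0 C00.
have rad4 := locrad_le4 beta kappa0 C00.
have loc x : exists r M, 0 < r /\ majorized f x r M.
  by eexists; eexists; split; [exact: rad0|exact: fM].
have sm := majorized_smooth loc.
pose c0 := ln (3 / 2) * 2^-1 `^ s : R.
have c00 : 0 < c0 by rewrite mulr_gt0 ?powR_gt0// ln_gt0//; lra.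
pose M x := 3 / 2 * E * ((1 + `|x|) * expR (- (c0 * `|x| `^ s))).
have fM' x : majorized f x (locrad x) (M x).
  apply: majorized_le (fM x).
  have h := @expn23_le ((`|x| / 2) `^ s) (powR_ge0 _ _).
  have p1 : 0 <= E * (1 + `|x|) by rewrite mulr_ge0// addr_ge0.
  apply: (le_trans (ler_wpM2r p1 h)).
  rewrite powRM ?invr_ge0// mulrA.
  rewrite (_ : ln _ * _ * _ = c0 * `|x| `^ s); last by rewrite /c0; ring.
  by rewrite le_eqVlt; apply/orP; left; apply/eqP; rewrite /M; ring.
have fn x : normc (f x) <= M x.
  have := majorized_norm (fM' x) (t := 0); rewrite addr0 normr0; apply; exact: ltW.
have polyM m : exists2 B, 0 <= B & forall x, (1 + `|x|) ^+ m * M x <= B.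
  have [B B0 hB] := poly_expR_bounded m.+1 c00 s0.
  exists (3 / 2 * E * B); first by rewrite !mulr_ge0.
  move=> x; rewrite /M mulrCA ler_wpM2l ?mulr_ge0// mulrA -exprSr; exact: hB.
have d1 : decay1 f.
  split; first exact: smooth_cmeasurable.
  have [B B0 hB] := polyM 1%N; exists B => // x.
  by rewrite ler_pdivlMr ?ltr_pwDl// mulrC (le_trans _ (hB x))// expr1 ler_wpM2l// addr_ge0.
have bo n := @bprod_orth R lam _ _ w0 rho1 n.
have of_ : lower_orth f.
  apply: (@lower_orth_lim _ (fun n => bprod n.+1) f 2 (fun n => (bo n).1) d1) => //.
  - by move=> n x; apply: bprod_le => //; exact: decay_pole0.
  - by move=> x; have [h _] := cto_ReIm (fl x); rewrite (cvg_shiftS (fun n => Re (bprod n x))).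
  - by move=> x; have [_ h] := cto_ReIm (fl x); rewrite (cvg_shiftS (fun n => Im (bprod n x))).
  - by move=> n; exact: (bo n).2.
have hf x : hilbert f x = - 'i * f x.
  apply: (@lower_orth_hilbert _ f x (locrad x) (M x / locrad x)) => //.
  - by rewrite rad0 (le_trans (rad4 x))// invf_le1// ler1n.
  - by rewrite divr_ge0 ?(majorized_ge0 (fM' x))// ltW.
  - move=> t tr; have := majorized_lip (rad0 x) (fM' x) (t := - t).
    by rewrite normrN; apply.
have fz k : f (lam k) = 0.
  have : cto (bprod ^~ (lam k)) 0.
    apply: cvg_near_cst; exists k.+1 => // n /= kn.
    by rewrite bprod_zero// subrr Normc.normc0.
  move=> /cto_ReIm[r0 i0]; have [r1 i1] := cto_ReIm (fl (lam k)).
  by apply: eq_ReIm; [exact: (cvg_unique _ r1 r0)|exact: (cvg_unique _ i1 i0)].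
exists f; split => //.
- split; first split=> //.
    (* Cauchy's estimate costs [n] powers of the inverse radius, a polynomial of degree [J n], which
       the decay of [M x] absorbs. *)
    move=> m n; have [K [J [K0 hK]]] := locradV_le.
    have [B B0 hB] := polyM (m + J * n)%N.
    exists (n`!%:R * K ^+ n * B) => x.
    have x0 : 0 <= 1 + `|x| by rewrite addr_ge0.
    have M0 := majorized_ge0 (fM' x).
    have h := majorized_cderiven n (rad0 x) (fM' x).
    apply: (@le_trans _ _ ((1 + `|x|) ^+ m * (n`!%:R * M x * (K * (1 + `|x|) ^+ J) ^+ n))).
      apply: ler_pM; rewrite ?exprn_ge0 ?normc_ge0//.
        by rewrite lerXn2r ?nnegrE// lerDr.
      have v0 : 0 <= (locrad x)^-1 by rewrite invr_ge0 ltW.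
      have K1 : 0 <= K * (1 + `|x|) ^+ J by rewrite mulr_ge0 ?exprn_ge0.
      apply: (le_trans h); rewrite -exprVn ler_wpM2l ?mulr_ge0//.
      by apply: lerXn2r; rewrite ?nnegrE.
    rewrite exprMn -exprM.
    apply: (@le_trans _ _ (n`!%:R * K ^+ n * ((1 + `|x|) ^+ (m + J * n) * M x))).
      rewrite exprD le_eqVlt; apply/orP; left; apply/eqP.
      by move: (M x) (_ ^+ m) (_ ^+ (J * n)) (K ^+ n) (_%:R) => a1 a2 a3 a4 a5; ring.
    by rewrite ler_wpM2l ?hB// mulr_ge0 ?exprn_ge0.
  (* Half of the exponential rate is given up to absorb the factor [1 + |x|] in [M x]. *)
  pose c := c0 / 2; have c1 : 0 < c by rewrite divr_gt0.
  exists c; split => //.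
  have [B B0 hB] := poly_expR_bounded 1 c1 s0.
  have bound p' x : 0 < p' <= s -> normc (f x) * expR (c * `|x| `^ p') <= 3 / 2 * E * expR c * B.
    move=> /andP[p0 p's].
    have xp : `|x| `^ p' <= 1 + `|x| `^ s.
      have [x1|x1] := leP `|x| 1.
        apply: (@le_trans _ _ 1); last by rewrite lerDl powR_ge0.
        by have := ge0_ler_powR (ltW p0) _ _ x1; rewrite powR1; apply; rewrite nnegrE.
      by apply: (@le_trans _ _ (`|x| `^ s)); [apply: ler_powR => //; exact: ltW|rewrite lerDr].
    have e1 : expR (c * `|x| `^ p') <= expR c * expR (c * `|x| `^ s).
      by rewrite -expRD ler_expR -[X in X + _]mulr1 -mulrDr ler_wpM2l// ltW.
    apply: (@le_trans _ _ (M x * (expR c * expR (c * `|x| `^ s)))).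
      by apply: ler_pM; rewrite ?normc_ge0 ?expR_ge0.
    rewrite (_ : M x * _ = 3 / 2 * E * expR c * ((1 + `|x|) ^+ 1 * expR (- (c * `|x| `^ s)))).
      by rewrite ler_wpM2l ?hB// !mulr_ge0 ?expR_ge0.
    rewrite /M expr1 (_ : - (c * _) = - (c0 * `|x| `^ s) + c * `|x| `^ s).
      by rewrite expRD; ring.
    by rewrite /c; field.
  apply: (@le_lt_trans _ _ ((3 / 2 * E * expR c * B)%:E + (3 / 2 * E * expR c * B)%:E)%E); last first.
    by rewrite -EFinD ltry.
  apply: leeD; apply: ge_ereal_sup => _ [x _ <-]; rewrite lee_fin; first exact: bound.
  rewrite hf Normc.normcM (_ : normc (- 'i) = 1) ?mul1r; first exact: bound.
  by rewrite normcE2/= oppr0 expr0n/= add0r sqrrN expr1n sqrtr1.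
- exact: majorized_analytic.
(* At a point off the sequence no factor vanishes, and the defects [1 - b k] are dominated by
   [|x| / rho_k + tau_k], whose sum is finite; the moduli of the partial products therefore stay
   away from [0]. *)
- have [x hx] := not_in_sequence lam; exists x.
  pose b k := normc (gfac (decay_pole s) k x * afac lam (@width R) k x).
  have b01 k : 0 < b k <= 1.
    rewrite /b; apply/andP; split; last first.
      by rewrite Normc.normcM mulr_ile1 ?normc_ge0 ?normc_gfac_le1 ?normc_afac_le1.
    rewrite normc_gt0 mulf_neq0//.
      have dp : 0 < decay_pole s k := lt_le_trans ltr01 (rho1 k).
      rewrite -normc_gt0 normc_gfac// divr_gt0//.
      by rewrite normc_gt0 subC_neq0// Im_gpole.
    rewrite -normc_gt0 Normc.normcM Normc.normcV normc_real mulr_gt0//.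
      by rewrite normr_gt0 subr_eq0.
    by rewrite invr_gt0 normc_gt0 subC_neq0// Im_apole.
  have [Sr Sr0 hSr] := sum_decay_pole s01.
  have [St St0 hSt] := sum_tau beta1 kappa0 C00 star.
  have defect k : 1 - b k <= `|x| * (decay_pole s k)^-1 + tau lam (@width R) x (locrad x) k.
    set g := gfac (decay_pole s) k x; set a := afac lam (@width R) k x.
    have n1 := subC_neq0 x (Im_apole lam w0 k); have n2 := subC_neq0 x (Im_gpole rho1 k).
    have h1 : 1 - b k <= normc (1 - g * a).
      have := normcD (g * a) (1 - g * a); rewrite addrC subrK Normc.normc1 -/(b k); lra.
    apply: (le_trans h1).
    rewrite (_ : 1 - g * a = (1 - g) + g * (1 - a)); last by ring.
    rewrite (le_trans (normcD _ _))//; apply: lerD.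
      have -> : 1 - g = x%:C * (x%:C - gpole (decay_pole s) k)^-1.
        have e : x%:C = (x%:C - gpole (decay_pole s) k) - 'i * (decay_pole s k)%:C.
          by apply: eq_ReIm; rewrite !ReImE/=; ring.
        rewrite /g /gfac [X in _ = X * _]e mulrBl mulfV//; ring.
      rewrite Normc.normcM Normc.normcV normc_real ler_wpM2l// lef_pV2 ?posrE ?normc_gt0//.
        by have [] := ge_gpole rho1 k x.
      by rewrite (lt_le_trans ltr01).
    have -> : 1 - a = 'i * (2 * @width R k)%:C * (x%:C - apole lam (@width R) k)^-1.
      have e : (x - lam k)%:C = (x%:C - apole lam (@width R) k) - 'i * (2 * @width R k)%:C.
        by apply: eq_ReIm; rewrite !ReImE/=; ring.
      rewrite /a /afac e mulrBl mulfV//; ring.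
    rewrite Normc.normcM (le_trans (ler_piMl _ _))// ?normc_ge0 ?normc_gfac_le1//.
    rewrite Normc.normcM Normc.normcV normc_i gtr0_norm ?mulr_gt0//.
    have rp := locrad_lt_apole beta1 kappa0 C00 star x k.
    rewrite /tau ler_wpM2l ?mulr_ge0 ?(ltW (w0 _))// lef_pV2 ?posrE ?subr_gt0 ?normc_gt0//.
    by rewrite gerBl ltW.
  have sdef n : \sum_(k < n) (1 - b k) <= `|x| * Sr + St.
    apply: (@le_trans _ _ (\sum_(k < n) (`|x| * (decay_pole s k)^-1 + tau lam (@width R) x (locrad x) k))).
      by apply: ler_sum => i _; exact: defect.
    rewrite big_split/= -mulr_sumr; apply: lerD; last exact: hSt.
    by apply: ler_wpM2l; [exact: normr_ge0|exact: hSr].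
  have [d d0 hd] := prod_bounded_below b01 sdef.
  apply/eqP => fx0; have := fl x; rewrite /cto fx0.
  move=> /cvgr0Pnorm_lt/(_ _ d0)[N _ /(_ N (leqnn _))].
  rewrite subr0 (ger0_norm (normc_ge0 _)) (bprod_prod lam w0 rho1) => h.
  by have := le_lt_trans (hd N) h; rewrite ltxx.
- by move=> k; rewrite hf fz mulr0.
Qed.

End decaying_function.

(** * Densities and enumerations *)

Section densities.
Context {R : realType}.
Implicit Types (F : R -> R) (Gam : set R).

Lemma upper_density_count F Gam : (upper_density F Gam < +oo)%E -> range F = setT ->
  exists r1 S : R, forall r, 0 < r -> r1 < r -> forall x,
    (counting (F @` Gam `&` ball x (r / 2)) <= (S * r)%:E)%E.
Proof.
move=> /ereal_inf_lt[_ [V [M [_ MV]] <-] Vy] FT.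
(* The supremum is an extended real that could be [-oo]; any real number is then a bound. *)
have [S hS] : exists S : R, (ereal_sup [set ereal_sup (density_ratios F Gam x) | x in V] <= S%:E)%E.
  move: Vy; case: (ereal_sup _) => [S _|//|_]; first by exists S.
  by exists 0; rewrite leNye.
exists M, S => r r0 Mr x.
have : (counting (F @` Gam `&` ball x (r / 2)) * (r^-1)%:E <= S%:E)%E.
  apply: le_trans hS; apply: (@le_trans _ _ (ereal_sup (density_ratios F Gam r))).
    apply: ereal_sup_ubound; exists x, (r / 2); split => //.
    - by rewrite divr_gt0.
    - by rewrite FT.
    - by rewrite lebesgue_measure_ball ?divr_ge0 ?ltW//; congr EFin; rewrite -mulr_natr; field.
  by apply: ereal_sup_ubound; exists r => //; exact: MV.
by rewrite EFinM lee_pdivrMr.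
Qed.

Lemma lower_density_hits F Gam : (0%:E < lower_density F Gam)%E ->
  exists r1 : R, forall r, 0 < r -> r1 < r -> forall x,
    ball x (r / 2) `<=` range F -> exists2 l, Gam l & ball x (r / 2) (F l).
Proof.
rewrite /lower_density /limf_einf lteNr oppe0 => /ereal_inf_lt[_ [V [M [_ MV]] <-] V0].
exists M => r r0 Mr x xF; apply: contrapT => no.
have e : F @` Gam `&` ball x (r / 2) = set0.
  apply/seteqP; split => // y [[l Gl <-] h]; apply: no; by exists l.
have : (ereal_inf (density_ratios F Gam r) <= 0)%E.
  apply: ereal_inf_lbound; exists x, (r / 2); split => //.
  - by rewrite divr_gt0.
  - by rewrite lebesgue_measure_ball ?divr_ge0 ?ltW//; congr EFin; rewrite -mulr_natr; field.
  - by rewrite e measure0 mul0e.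
rewrite leNgt => /negP; apply.
rewrite -oppe_lt0; apply: le_lt_trans V0; apply: ereal_sup_ubound.
by exists r => //; exact: MV.
Qed.

Lemma counting_seq (A : set R) (K : R) : (counting A <= K%:E)%E ->
  exists s : seq R, (size s)%:R <= K /\ forall x, A x -> x \in s.
Proof.
rewrite /counting; case: ifP => [/asboolP fA|_]; last by rewrite leye_eq.
rewrite lee_fin => h; exists (finmap.enum_fset (fset_set A)); split => // x Ax.
exact: (etrans (in_fset_set fA x) (mem_set Ax)).
Qed.

(** * Point sets in the coordinate [|x|^(1/alpha)] *)

Section power_coordinates.
Variable alpha : R.
Hypothesis alpha01 : 0 < alpha < 1.
Let a0 : 0 < alpha. Proof. by case/andP: alpha01. Qed.
Let b0 : 0 < alpha^-1. Proof. by rewrite invr_gt0. Qed.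

Lemma norm_Galpha y : `|Galpha alpha y| = `|y| `^ alpha^-1.
Proof.
rewrite /Galpha normrM (ger0_norm (powR_ge0 _ _)).
have [->|y0] := eqVneq y 0; first by rewrite normr0 powR0 ?mulr0// gt_eqF.
by rewrite normr_sg y0 mul1r.
Qed.

Lemma sg_Galpha y : Num.sg (Galpha alpha y) = Num.sg y.
Proof.
rewrite /Galpha sgrM sgr_id.
have [->|y0] := eqVneq y 0; first by rewrite sgr0 mul0r.
by rewrite (gtr0_sg (powR_gt0 _ _)) ?mulr1// normr_gt0.
Qed.

Definition Ginv (y : R) : R := Num.sg y * `|y| `^ alpha.

Lemma GalphaK : cancel (Galpha alpha) Ginv.
Proof.
move=> y; rewrite /Ginv sg_Galpha norm_Galpha -powRrM mulVf ?gt_eqF// powRr1//.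
by rewrite -numEsg.
Qed.

Lemma GinvK : cancel Ginv (Galpha alpha).
Proof.
move=> y; have [->|y0] := eqVneq y 0.
  by rewrite /Ginv sgr0 mul0r /Galpha sgr0 mul0r.
have p : 0 < `|y| `^ alpha by rewrite powR_gt0// normr_gt0.
rewrite /Galpha /Ginv sgrM sgr_id (gtr0_sg p) mulr1 normrM normr_sg y0 mul1r (gtr0_norm p).
by rewrite -powRrM mulfV ?gt_eqF// powRr1// -numEsg.
Qed.

Lemma range_Galpha : range (Galpha alpha) = setT.
Proof. by apply/seteqP; split => // y _; exists (Ginv y) => //; exact: GinvK. Qed.

(** Finite density in a form suited to enumeration: points of both signs share a layer, because the
    enumeration only has to control [|lam_k|]. *)
Definition layered (Gam : set R) (r : R) (K : nat) := forall n : nat, exists s : seq R,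
  (size s <= K)%N /\ forall x, Gam x -> n%:R * r <= `|x| `^ alpha^-1 <= n.+1%:R * r -> x \in s.

Lemma upper_density_layered Gam : (upper_density (Galpha alpha) Gam < +oo)%E ->
  exists r1, forall r, 0 < r -> r1 < r -> exists K, layered Gam r K.
Proof.
move=> /upper_density_count/(_ range_Galpha)[r1 [S hS]].
exists r1 => r r0 r1r; have r20 : 0 < r * 2 by rewrite mulr_gt0.
have r12 : r1 < r * 2 by rewrite (lt_trans r1r)//; lra.
exists ((Num.trunc (S * (r * 2))) + (Num.trunc (S * (r * 2))))%N => n.
(* Layer [n] is covered by two open balls of radius [r] about [(n + 1/2) r] and its opposite; the
   radius exceeds [r / 2] so that the closed ends of the layer are included. *)
have [s1 [sz1 hs1]] := counting_seq (hS _ r20 r12 ((n%:R + 2^-1) * r)).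
have [s2 [sz2 hs2]] := counting_seq (hS _ r20 r12 (- ((n%:R + 2^-1) * r))).
have szt (s : seq R) : (size s)%:R <= S * (r * 2) -> (size s <= Num.trunc (S * (r * 2)))%N.
  by move=> h; rewrite truncn_ge_nat// (le_trans _ h).
exists (map Ginv (s1 ++ s2)); split.
  by rewrite size_map size_cat leq_add ?szt.
move=> x Gx; rewrite -norm_Galpha => /andP[h1 h2]; rewrite -[x]GalphaK.
have e : r * 2 / 2 = r by field.
apply: map_f; rewrite mem_cat; rewrite e in hs1 hs2.
have en : n.+1%:R = n%:R + 1 :> R by rewrite -natr1.
rewrite en in h2; move: (n%:R : R) h1 h2 hs1 hs2 {en sz1 sz2} => m h1 h2 hs1 hs2.
have [g0|g0] := leP 0 (Galpha alpha x).
  rewrite hs1//; split; first by exists x.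
  by rewrite (ger0_norm g0) in h1 h2; rewrite /ball/= distrC lter_norml; apply/andP; split; nra.
rewrite hs2 ?orbT//; split; first by exists x.
by rewrite (ltr0_norm g0) in h1 h2; rewrite /ball/= distrC lter_norml; apply/andP; split; nra.
Qed.

Lemma layeredU Gam1 Gam2 r K1 K2 : layered Gam1 r K1 -> layered Gam2 r K2 ->
  layered (Gam1 `|` Gam2) r (K1 + K2).
Proof.
move=> h1 h2 n; have [s1 [z1 m1]] := h1 n; have [s2 [z2 m2]] := h2 n.
exists (s1 ++ s2); split; first by rewrite size_cat leq_add.
by move=> x [] Gx hx; rewrite mem_cat ?(m1 _ Gx hx)// (m2 _ Gx hx) orbT.
Qed.

(* Layer [n] occupies the indices [n * K .. n * K + K - 1], padded with the
   point [Ginv (n * r)] of that layer. *)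
Lemma layered_enum Gam r K : 0 < r -> layered Gam r K ->
  exists kappa (lam : nat -> R), [/\ 0 < kappa, Gam `<=` range lam &
    forall k, `| `|lam k| `^ alpha^-1 - kappa * k%:R | <= r].
Proof.
move=> r0 lay; have [s hs] := choice lay.
pose inl n (x : R) := n%:R * r <= `|x| `^ alpha^-1 <= n.+1%:R * r.
pose L n := [seq x <- s n | inl n x].
have nr n : 0 <= n%:R * r by rewrite mulr_ge0// ltW.
(* Blocks have length [K.+1] rather than [K], so that they are nonempty even for [K = 0]. *)
pose lam k := nth (Ginv ((k %/ K.+1)%:R * r)) (L (k %/ K.+1)%N) (k %% K.+1).
have kap : 0 < r / K.+1%:R by rewrite divr_gt0.
exists (r / K.+1%:R), lam; split => //.
  move=> x Gx; pose n := Num.trunc (`|x| `^ alpha^-1 / r).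
  have inx : inl n x.
    apply/andP; split; last by rewrite -ler_pdivrMr// ltW// truncnS_gt.
    by rewrite -ler_pdivlMr// truncn_le// divr_ge0 ?powR_ge0// ltW.
  have [sz /(_ x Gx inx) xs] := hs n.
  have xL : x \in L n by rewrite mem_filter inx.
  have iL : (index x (L n) < K.+1)%N.
    rewrite ltnS (leq_trans _ sz)// ltnW// (leq_trans (_ : _ < size (L n))%N) ?index_mem//.
    by rewrite size_filter count_size.
  exists (n * K.+1 + index x (L n))%N => //.
  by rewrite /lam divnMDl// divn_small// addn0 modnMDl modn_small// nth_index.
move=> k; have inlk : inl (k %/ K.+1)%N (lam k).
  rewrite /lam; set n := (k %/ K.+1)%N.
  have [h|h] := ltnP (k %% K.+1) (size (L n)).
    by have := mem_nth (Ginv (n%:R * r)) h; rewrite mem_filter => /andP[].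
  rewrite nth_default// /inl -norm_Galpha GinvK ger0_norm// lexx/=.
  by rewrite ler_wpM2r ?ler_nat// ltW.
move: inlk => /andP[h1 h2].
have ek : k%:R = (k %/ K.+1)%:R * K.+1%:R + (k %% K.+1)%:R :> R by rewrite -natrM -natrD -divn_eq.
(* With [n] the block of [k], both [|lam k|^(1/alpha)] and [kappa k] lie between [n r] and
   [(n + 1) r], hence differ by at most [r]. *)
have -> : r / K.+1%:R * k%:R = (k %/ K.+1)%:R * r + r * ((k %% K.+1)%:R / K.+1%:R).
  by rewrite ek; field.
have m0 : 0 <= (k %% K.+1)%:R / K.+1%:R :> R by rewrite divr_ge0.
have m1 : (k %% K.+1)%:R / K.+1%:R <= 1 :> R.
  by rewrite ler_pdivrMr// mul1r ler_nat ltnW// ltn_mod.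
rewrite -natr1 in h2.
have := mulr_ge0 (ltW r0) m0; have := ler_wpM2l (ltW r0) m1; rewrite mulr1.
rewrite mulrDl mul1r in h2; rewrite ler_norml.
by move: (r * (_ / _)) => v v1 v0; apply/andP; split; lra.
Qed.

End power_coordinates.
End densities.

Lemma finite_density_non_uniqueness (R : realType) (alpha p q : R)
    (halpha : 0 < alpha < 1) (hp : 0 < p < 1) (hq : 0 < q < 1) (Lambda M : set R) :
  (upper_density (Galpha alpha) Lambda < +oo)%E ->
  (upper_density (Galpha alpha) M < +oo)%E ->
  non_uniqueness_pair (@hilbert R)
    ([set f | schwartz_hilbert p q f] `&` [set f | real_analytic f]) Lambda M.
Proof.
move=> /(upper_density_layered halpha)[r1 h1] /(upper_density_layered halpha)[r2 h2].
have [a0 a1] := andP halpha; have [p0 p1] := andP hp; have [q0 q1] := andP hq.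
pose r := Num.max 0 (Num.max r1 r2) + 1.
have r0 : 0 < r by rewrite ltr_wpDl// le_max lexx.
have rr1 : r1 < r by rewrite ltr_pwDr// !le_max lexx orbT.
have rr2 : r2 < r by rewrite ltr_pwDr// !le_max lexx !orbT.
have [K1 l1] := h1 r r0 rr1; have [K2 l2] := h2 r r0 rr2.
have [kappa [lam [kap0 sub star]]] := layered_enum halpha r0 (layeredU l1 l2).
have b1 : 1 <= alpha^-1 by rewrite invf_ge1// ltW.
have s01 : 0 < Num.max p q < 1 by rewrite lt_max p0 gt_max p1 q1.
have [||f [f1 f2 f3 f4 f5]] := enum_nonuniqueness b1 kap0 (ltW r0) star s01 (p := p) (q := q).
- by rewrite p0 le_max lexx.
- by rewrite q0 le_max lexx orbT.
exists f; split => //.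
- by move=> x Lx; have [k _ <-] := sub x (or_introl Lx).
- by move=> x Mx; have [k _ <-] := sub x (or_intror Mx).
Qed.

(** * Decay from dense zeros *)

Section superexponential_decay.
Context {R : realType}.
Implicit Types (v : nat -> R -> R) (h : R -> R).

Lemma is_derive_continuous_within v : (forall n x, is_derive x (1 : R) (v n) (v n.+1 x)) ->
  forall n a b, {within `[a, b], continuous (v n)}.
Proof.
move=> dv n a b; apply: continuous_subspaceT => x.
by apply: differentiable_continuous; apply/derivable1_diffP; have [] := dv n x.
Qed.

(* By Rolle, zeros of [v 0] that are [h x]-dense near [x] give zeros of [v k]
   that are [2 ^ k * h x]-dense; each of them gains a factor [h x] by the mean
   value theorem. *)
Lemma zeros_decay v h X : (forall n x, is_derive x (1 : R) (v n) (v n.+1 x)) ->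
  (forall n, exists B, forall x, `|v n x| <= B) ->
  (forall x, 0 <= h x) -> (forall x y, x <= y -> h y <= h x) ->
  (forall x, X <= x -> exists z, x < z < x + h x /\ v 0%N z = 0) ->
  forall n, exists2 C, 0 <= C & forall x, X <= x -> `|v 0%N x| <= C * h x ^+ n.
Proof.
move=> dv bv h0 hdec zv.
have cv := is_derive_continuous_within dv.
have Z k : forall x, X <= x -> exists z, x < z < x + 2 ^+ k * h x /\ v k z = 0.
  elim: k => [|k IH] x Xx.
    by have [z hz] := zv x Xx; exists z; rewrite expr0 mul1r.
  have c0 : 0 <= 2 ^+ k * h x by rewrite mulr_ge0 ?exprn_ge0.
  have [z1 [/andP[a1 b1] v1]] := IH x Xx.
  have xx' : x <= x + 2 ^+ k * h x by rewrite lerDl.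
  have [z2 [/andP[a2 b2] v2]] := IH (x + 2 ^+ k * h x) (le_trans Xx xx').
  have z12 : z1 < z2 by rewrite (lt_trans b1).
  have [|c + dc] := Rolle z12 _ (cv k z1 z2) (etrans v1 (esym v2)).
    by move=> y _; have [] := dv k y.
  rewrite in_itv/= => /andP[c1 c2]; exists c; split.
    rewrite (lt_trans a1 c1)/= (lt_trans c2)// (lt_le_trans b2)//.
    rewrite exprS -mulrA mulr_natl mulr2n addrA lerD2l ler_wpM2l ?exprn_ge0//.
    exact: hdec.
  by have [_ <-] := dv k c; have [_ ->] := dc.
(* The induction on [n] needs all [k] at once: the bound of order [n + 1] for [v k] comes from the
   one of order [n] for its derivative [v k.+1]. *)
suff S n k : exists2 C, 0 <= C & forall x, X <= x -> `|v k x| <= C * h x ^+ n.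
  by move=> n; exact: S.
elim: n k => [|n IH] k.
  have [B hB] := bv k; exists B; first by rewrite (le_trans _ (hB 0)).
  by move=> x _; rewrite expr0 mulr1.
have [C C0 hC] := IH k.+1; exists (C * 2 ^+ k); first by rewrite mulr_ge0 ?exprn_ge0.
move=> x Xx; have [z [/andP[xz zx] vz]] := Z k x Xx.
have [c] := MVT xz (fun y _ => dv k y) (cv k x z).
rewrite in_itv/= => /andP[xc cz] e.
have -> : `|v k x| = `|v k.+1 c| * (z - x).
  by rewrite -normrN -[- v k x]add0r -vz e normrM (gtr0_norm (_ : 0 < z - x)) ?subr_gt0.
have cz0 : 0 <= z - x by rewrite subr_ge0 ltW.
have -> : C * 2 ^+ k * h x ^+ n.+1 = (C * h x ^+ n) * (2 ^+ k * h x) by rewrite exprSr; ring.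
apply: ler_pM => //; last by rewrite lerBlDl ltW.
apply: le_trans (hC c (le_trans Xx (ltW xc))) _; apply: ler_wpM2l => //.
by rewrite lerXn2r ?nnegrE//; apply: hdec; exact: ltW.
Qed.

(** A window of fixed length [r] just above [e^(x/c)] contains an image point. Pulled back by [c ln]
    it has length [c ln (1 + r e^(-x/c))], at most [c r e^(-x/c)]. The sign [s] treats both
    half-lines at once. *)
Lemma Phi1_hits (c : R) (Lam : set R) : 0 < c ->
  (0%:E < lower_density (Phi1 c) Lam)%E ->
  exists2 K, 0 <= K & forall (s x : R), `|s| = 1 -> 0 <= x ->
    exists2 l, Lam l & x < s * l < x + K * expR (- (x / c)).
Proof.
move=> c0 /lower_density_hits[r1 hr1]; set r := `|r1| + 1.
have r0 : 0 < r by rewrite ltr_wpDl.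
have /hr1 {}hr1 : r1 < r by rewrite (le_lt_trans (ler_norm _))// ltrDl.
exists (c * r); first by rewrite mulr_ge0// ltW.
move=> s x s1 x0.
have ss : s * s = 1 by rewrite -expr2 -real_normK ?num_real// s1 expr1n.
have e1 : 1 <= expR (x / c) by rewrite -expR0 ler_expR divr_ge0// ltW.
have B y : ball (s * (expR (x / c) + r / 2)) (r / 2) y ->
    expR (x / c) < s * y < expR (x / c) + r.
  rewrite /ball/= => h.
  have : `|expR (x / c) + r / 2 - s * y| < r / 2.
    have -> : expR (x / c) + r / 2 - s * y = s * (s * (expR (x / c) + r / 2) - y).
      by rewrite mulrBr mulrA ss mul1r.
    by rewrite normrM s1 mul1r.
  by rewrite ltr_norml => /andP[h1 h2]; apply/andP; split; lra.
have [|l Ll] := hr1 r0 (s * (expR (x / c) + r / 2)).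
  (* The range of [Phi1 c] omits the points with [0 < |y| <= 1]; the window avoids them because it
     starts above [e^(x/c) >= 1]. *)
  move=> y /B /andP[h1 h2]; have sy1 : 1 < s * y by exact: le_lt_trans h1.
  have ln0 : 0 < ln (s * y) by rewrite ln_gt0.
  exists (s * (c * ln (s * y))) => //; rewrite /Phi1.
  have cl : 0 < c * ln (s * y) by rewrite mulr_gt0.
  have n0 : `|s * (c * ln (s * y))| = c * ln (s * y) by rewrite normrM s1 mul1r gtr0_norm.
  rewrite -normr_eq0 n0 gt_eqF// mulfK ?gt_eqF// mulrAC divff ?gt_eqF// mul1r lnK; last first.
    by rewrite posrE (lt_trans _ sy1).
  by rewrite mulrA ss mul1r.
move=> /B; rewrite /Phi1; have [_|l0] := eqVneq l 0.
  by rewrite mulr0 => /andP[h1 _]; have := lt_trans h1 (lt_le_trans _ e1); rewrite ltxx; lra.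
rewrite mulrA => /andP[h1 h2].
have nl : 0 < `|l| by rewrite normr_gt0.
have sl : s * (l / `|l|) = 1.
  have : `|s * (l / `|l|)| = 1 by rewrite !normrM normfV normr_id s1 mul1r divff// gt_eqF.
  have : 0 < s * (l / `|l|).
    by rewrite -(pmulr_lgt0 _ (expR_gt0 (`|l| / c))) (lt_trans _ h1)// expR_gt0.
  by move=> p0; rewrite gtr0_norm.
have sl' : s * l = `|l| by rewrite -[RHS]mul1r -sl -!mulrA mulVf ?mulr1// gt_eqF.
rewrite sl mul1r in h1 h2.
exists l => //; rewrite sl'; apply/andP; split.
  by move: h1; rewrite ltr_expR ltr_pM2r// invr_gt0.
suff : (`|l| - x) / c < r * expR (- (x / c)).
  by rewrite ltr_pdivrMr// ltrBlDl => h; rewrite (_ : c * r * _ = r * expR (- (x / c)) * c)//; ring.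
rewrite -ltr_expR mulrBl expRD.
apply: lt_le_trans (expR_ge1Dx _).
have -> : 1 + r * expR (- (x / c)) = (expR (x / c) + r) * expR (- (x / c)).
  by rewrite [RHS]mulrDl; congr (_ + _); rewrite expRN mulfV// gt_eqF// expR_gt0.
by rewrite ltr_pM2r// expR_gt0.
Qed.

Lemma is_derive_derive1n (u : R -> R) : (forall n x, derivable (derive1n n u) x 1) ->
  forall n x, is_derive x (1 : R) (derive1n n u) (derive1n n.+1 u x).
Proof. by move=> du n x; apply: DeriveDef => //; rewrite derive1nS derive1E. Qed.

Lemma superexponential_decay (c : R) (Lam : set R) (u : R -> R) : 0 < c ->
  (0%:E < lower_density (Phi1 c) Lam)%E ->
  (forall n x, derivable (derive1n n u) x 1) ->
  (forall n, exists B, forall x, `|derive1n n u x| <= B) ->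
  (forall x, Lam x -> u x = 0) ->
  forall N, exists2 C, 0 <= C & forall x, `|u x| <= C * expR (- (N * `|x|)).
Proof.
move=> c0 /(Phi1_hits c0)[K K0 hK] du bu ul N.
have half s : `|s| = 1 -> exists2 C, 0 <= C & forall x, 0 <= x -> `|u (s * x)| <= C * expR (- (N * x)).
  move=> s1; pose v n (x : R) := s ^+ n * derive1n n u (s * x).
  (* The order is taken so that [n / c >= |N|], which makes the [n]-th power of the gap [K e^(-x/c)]
     at most a constant times [e^(-N x)]. *)
  pose n := (Num.truncn (`|N| * c)).+1.
  have [||||x x0|C C0 hC] := @zeros_decay v (fun x => K * expR (- (x / c))) 0 _ _ _ _ _ n.
  - move=> m x; have d := is_derive_derive1n du m (s * x).
    have d1 : is_derive x (1 : R) (fun x => s * x) s.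
      by apply: is_derive_eq; rewrite /GRing.scale/= !(mulr0, mulr1, addr0).
    have d2 := @is_derive1_comp _ (derive1n m u) (fun x => s * x) x _ _ d d1.
    have d3 := @is_deriveZ _ _ _ _ (s ^+ m) _ _ _ d2.
    by apply: is_derive_eq d3 _; rewrite /v exprSr /GRing.scale/= mulrA mulrAC.
  - move=> m; have [B hB] := bu m; exists B => x.
    by rewrite normrM normrX s1 expr1n mul1r.
  - by move=> x; rewrite mulr_ge0// expR_ge0.
  - by move=> x y xy; rewrite ler_wpM2l// ler_expR lerN2 ler_pM2r// invr_gt0.
  - have [l Ll hl] := hK s x s1 x0; exists (s * l); split => //.
    have ss : s * s = 1 by rewrite -expr2 -real_normK ?num_real// s1 expr1n.
    by rewrite /v expr0 mul1r mulrA ss mul1r; exact: ul.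
  exists (C * K ^+ n); first by rewrite mulr_ge0// exprn_ge0.
  move=> x x0; have := hC x x0; rewrite /v expr0 mul1r => /le_trans; apply.
  rewrite exprMn mulrA ler_wpM2l//; first by rewrite mulr_ge0// exprn_ge0.
  rewrite -expRM_natl ler_expR mulrN lerN2 mulrCA [N * x]mulrC ler_wpM2l//.
  rewrite ler_pdivlMr//; apply: (le_trans (y := `|N| * c)).
    by rewrite ler_wpM2r ?ler_norm// ltW.
  by apply/ltW; rewrite truncnS_gt.
have [C1 C10 h1] := half 1 (normr1 _); have [C2 C20 h2] := half (- 1) (normrN1 _).
exists (C1 + C2) => [|x]; first exact: addr_ge0.
rewrite mulrDl; have [x0|/ltW x0] := leP 0 x.
  have := h1 x x0; rewrite mul1r => h.
  by rewrite (ger0_norm x0) ler_wpDr// mulr_ge0// expR_ge0.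
have := h2 (- x); rewrite mulrNN mul1r oppr_ge0 => /(_ x0) h.
by rewrite (ler0_norm x0) ler_wpDl// mulr_ge0// expR_ge0.
Qed.

Lemma Galpha_hits_unbounded (alpha : R) (M : set R) : 0 < alpha < 1 ->
  (0%:E < lower_density (Galpha alpha) M)%E ->
  forall A, exists2 y, M y & A <= `|y|.
Proof.
move=> ha /lower_density_hits[r1 hr1] A; set r := `|r1| + 1.
have r0 : 0 < r by rewrite ltr_wpDl.
have /(hr1 _ r0) {}hr1 : r1 < r by rewrite (le_lt_trans (ler_norm _))// ltrDl.
have [|y My] := hr1 (`|A| `^ alpha^-1 + r / 2).
  by rewrite range_Galpha.
rewrite /ball/= ltr_norml => /andP[_ h]; exists y => //.
have ai : 0 < alpha^-1 by rewrite invr_gt0; case/andP: ha.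
have h' : `|A| `^ alpha^-1 < `|y| `^ alpha^-1.
  by rewrite -(norm_Galpha ha); apply: lt_le_trans (ler_norm _); lra.
apply: le_trans (ler_norm A) _; rewrite leNgt; apply/negP => hy.
have := ge0_ler_powR (ltW ai) _ _ (ltW hy); rewrite !nnegrE !normr_ge0 => /(_ isT isT).
by rewrite leNgt h'.
Qed.

End superexponential_decay.

(** * Zeros of the Hilbert transform and moments *)

Section vanishing_moments.
Context {R : realType}.
Local Notation mu := (@lebesgue_measure R).
Local Notation itg f := (mu.-integrable setT (EFin \o f)).
Implicit Types f g : R -> R.

Lemma le_increment g g' (a b L : R) : (forall x, is_derive x (1 : R) g (g' x)) ->
  (forall x, `|x - a| <= `|b - a| -> `|g' x| <= L) -> `|g b - g a| <= L * `|b - a|.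
Proof.
move=> dg gL.
have cg x y : {within `[x, y], continuous g}.
  by apply: continuous_subspaceT; exact: is_derive_continuous dg.
have [ab|ba|->] := ltgtP a b.
- have [c] := MVT ab (fun x _ => dg x) (cg a b).
  rewrite in_itv/= => /andP[ac cb] ->; rewrite normrM ler_wpM2r// gL//.
  by rewrite !gtr0_norm ?subr_gt0// lerD2r ltW.
- have [c] := MVT ba (fun x _ => dg x) (cg b a).
  rewrite in_itv/= => /andP[bc ca] e; rewrite distrC e normrM distrC ler_wpM2r// gL//.
  by rewrite !ltr0_norm ?subr_lt0// lerN2 lerD2r ltW.
- by rewrite !subrr normr0 mulr0.
Qed.

Lemma eq_Rintegral_off0 f g : measurable_fun setT f -> measurable_fun setT g ->
  (forall t, t != 0 -> f t = g t) -> \int[mu]_t f t = \int[mu]_t g t.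
Proof.
move=> mf mg fg; congr fine; apply: ae_eq_integral => //.
- exact/measurable_EFinP.
- exact/measurable_EFinP.
exists [set 0]; split; first exact: measurable_set1.
  exact: lebesgue_measure_set1.
move=> t /= nt; apply: contrapT => /eqP t0; apply: nt => _.
by rewrite fg.
Qed.

(** For [|t| <= 1] the mean value theorem uses [g' = O(1 / |y|)] near [y]; for [|t| > 1] the
    inequality [|y| <= (1 + |y - t|) |t|] trades decay of [g] at [y - t] for [1 / |y|]. The bracket
    has an integral independent of [y]. *)
Lemma pvker_far g g' C y t : (forall x, is_derive x (1 : R) g (g' x)) ->
  (forall x, `|g x| * (1 + `|x|) ^+ 3 <= C) -> (forall x, `|g' x| * (1 + `|x|) <= C) ->
  y != 0 ->
  `|pvker g y t| <= 2 * C / `|y| * ((1 + t ^+ 2)^-1 + (1 + (y - t) ^+ 2)^-1).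
Proof.
move=> dg gC g'C y0; have ny : 0 < `|y| by rewrite normr_gt0.
have C0 : 0 <= C by apply: le_trans (gC 0); rewrite mulr_ge0// exprn_ge0// addr_ge0.
have pos (x : R) : 0 < 1 + x ^+ 2 by rewrite ltr_pwDl// sqr_ge0.
have K0 : 0 <= C / `|y| by rewrite divr_ge0.
rewrite /pvker; have [t1|t1] := leP `|t| 1.
  rewrite mulr1 normrM normfV.
  have : `|g (y - t) - g y| <= C / `|y| * `|t|.
    have -> : `|t| = `|(y - t) - y| by rewrite addrAC subrr add0r normrN.
    apply: (le_increment dg) => x; rewrite [y - t - y]addrAC subrr add0r normrN => h.
    have : `|g' x| * `|y| <= C.
      apply: le_trans (g'C x); rewrite ler_wpM2l//.
      by rewrite -(subrK x y) (le_trans (ler_normD _ _))// lerD2r distrC (le_trans h).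
    by rewrite ler_pdivlMr.
  move=> h; apply: (le_trans (y := C / `|y|)).
    have [->|tn] := eqVneq t 0; first by rewrite normr0 invr0 mulr0.
    by rewrite ler_pdivrMr// normr_gt0.
  have h2 : 1 <= 2 * (1 + t ^+ 2)^-1.
    rewrite ler_pdivlMr// mul1r -real_normK ?num_real//.
    have : `|t| ^+ 2 <= 1 by rewrite expr_le1.
    lra.
  have : 0 <= (1 + (y - t) ^+ 2)^-1 by rewrite invr_ge0 ltW.
  rewrite -[2 * C / _]mulrA; move: h2 K0.
  by move: (C / _) ((1 + t ^+ 2)^-1) ((1 + (y - t) ^+ 2)^-1) => a b c; nra.
rewrite mulr0 subr0 normrM normfV.
set w := y - t; have gw := gC w.
have t0 : 0 < `|t| by rewrite (lt_trans _ t1).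
have yw : `|y| <= (1 + `|w|) * `|t|.
  rewrite -(subrK t y) -/w (le_trans (ler_normD _ _))//.
  by have := normr_ge0 w; move: `|w| `|t| t1 => a b; nra.
have w2 : 1 + w ^+ 2 <= (1 + `|w|) ^+ 2.
  rewrite -[w ^+ 2]real_normK ?num_real// sqrrD expr1n mul1r.
  by have := normr_ge0 w; lra.
rewrite ler_pdivrMr//.
have h : `|g w| * (`|y| * (1 + w ^+ 2)) <= C * `|t|.
  apply: le_trans (ler_wpM2r (ltW t0) gw); rewrite -mulrA ler_wpM2l//.
  rewrite exprS mulrAC; apply: ler_pM => //; exact: (ltW (pos w)).
have {}h : `|g w| <= C * `|t| / (`|y| * (1 + w ^+ 2)) by rewrite ler_pdivlMr// mulr_gt0.
apply: (le_trans h).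
have -> : C * `|t| / (`|y| * (1 + w ^+ 2)) = C / `|y| * (1 + w ^+ 2)^-1 * `|t|.
  by field; rewrite !gt_eqF.
rewrite ler_wpM2r ?(ltW t0)//.
have : 0 <= (1 + t ^+ 2)^-1 by rewrite invr_ge0 ltW.
have : 0 <= (1 + w ^+ 2)^-1 by rewrite invr_ge0 ltW.
rewrite -[2 * C / _]mulrA; move: K0.
by move: (C / _) ((1 + t ^+ 2)^-1) ((1 + w ^+ 2)^-1) => a b c; nra.
Qed.

(** One derivative is enough for the principal value, and the class is closed under multiplication
    by [x], as the induction on moments requires. *)
Definition rapid_C1 g := exists g', (forall x, is_derive x (1 : R) g (g' x)) /\
  forall n, exists C, forall x, `|g x| * (1 + `|x|) ^+ n <= C /\ `|g' x| * (1 + `|x|) ^+ n <= C.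

Lemma rapid_C1_measurable g : rapid_C1 g -> measurable_fun setT g.
Proof.
by move=> [g' [dg _]]; apply: continuous_measurable_fun; exact: is_derive_continuous dg.
Qed.

Lemma rapid_C1_integrable g : rapid_C1 g -> itg g.
Proof.
move=> rg; have mg := rapid_C1_measurable rg; have [g' [_ /(_ 2)[C hC]]] := rg.
apply: (@integrable_inv_bound _ _ C mg) => x; have [h _] := hC x.
have p : 0 < 1 + x ^+ 2 by rewrite ltr_pwDl// sqr_ge0.
rewrite ler_pdivlMr//; apply: le_trans h; rewrite ler_wpM2l//.
rewrite -[x ^+ 2]real_normK ?num_real// sqrrD expr1n mul1r.
by have := normr_ge0 x; lra.
Qed.

Lemma rapid_C1_mulx g : rapid_C1 g -> rapid_C1 (fun x => x * g x).
Proof.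
move=> [g' [dg hg]]; exists (fun x => g x + x * g' x); split=> [x|n].
  have := dg x => dgx; have h := @is_deriveM _ _ id g x 1 _ _ (is_derive_id _ _) dgx.
  by apply: is_derive_eq h _; rewrite /GRing.scale/= mulr1 addrC.
have [C hC] := hg n.+1; exists (C + C) => x; have [h1 h2] := hC x.
have n0 : 0 <= (1 + `|x|) ^+ n by rewrite exprn_ge0// addr_ge0.
have x0 := normr_ge0 x.
have a1 : `|x| * `|g x| * (1 + `|x|) ^+ n <= C.
  apply: le_trans h1; rewrite exprS mulrCA mulrA ler_wpM2r//.
  by rewrite ler_wpM2r// lerDr.
have a2 : `|x| * `|g' x| * (1 + `|x|) ^+ n <= C.
  apply: le_trans h2; rewrite exprS mulrCA mulrA ler_wpM2r//.
  by rewrite ler_wpM2r// lerDr.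
have a3 : `|g x| * (1 + `|x|) ^+ n <= C.
  apply: le_trans h1; rewrite exprS ler_wpM2l// ler_peMl// lerDl//.
have C0 : 0 <= C by apply: le_trans a1; rewrite !mulr_ge0.
split; first by rewrite normrM (le_trans a1)// lerDl.
apply: (le_trans (ler_wpM2r n0 (ler_normD _ _))); rewrite mulrDl normrM.
exact: lerD.
Qed.

Lemma integrable_pvker_far g : rapid_C1 g -> exists K, forall y, y != 0 ->
  itg (pvker g y) /\ `|\int[mu]_t pvker g y t| <= K / `|y|.
Proof.
move=> rg; have mg := rapid_C1_measurable rg; have [g' [dg hg]] := rg.
have [C1 hC1] := hg 3; have [C2 hC2] := hg 1.
pose C := Num.max C1 C2.
have i1 := @integrable_inv1Dsqr R.
pose I := \int[mu]_t (1 + t ^+ 2)^-1.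
exists (2 * C * (I + I)) => y y0.
have bd := @pvker_far g g' C y ^~ dg.
have {}bd t : `|pvker g y t| <= 2 * C / `|y| * ((1 + t ^+ 2)^-1 + (1 + (y - t) ^+ 2)^-1).
  apply: bd => // x.
    by have [h _] := hC1 x; rewrite le_max h.
  by have [_ h] := hC2 x; rewrite expr1 in h; rewrite le_max h orbT.
have i2 := integrable_reflect y i1.
have i3 : itg (fun t => (1 + t ^+ 2)^-1 + (1 + (y - t) ^+ 2)^-1) 
    by have := integrableD measurableT i1 i2.
have i4 : itg (fun t => 2 * C / `|y| * ((1 + t ^+ 2)^-1 + (1 + (y - t) ^+ 2)^-1)).
  by have := integrableZl measurableT (2 * C / `|y|) i3.
have mp := measurable_pvker y mg.
split; first exact: (le_integrable_fun mp bd i4).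
have := le_norm_Rintegral mp i4 bd.
rewrite RintegralZl// RintegralD// (Rintegral_reflect y i1) -/I.
by rewrite mulrAC.
Qed.

(** Pointwise, [(y - t) g(y - t) / t = y g(y - t) / t - g(y - t)], and the subtracted odd terms on
    the two sides agree. *)
Lemma Rintegral_pvker_mulx g y : rapid_C1 g -> y != 0 ->
  \int[mu]_t pvker (fun x => x * g x) y t = y * \int[mu]_t pvker g y t - \int[mu]_x g x.
Proof.
move=> rg y0; have mg := rapid_C1_measurable rg.
have ig := rapid_C1_integrable rg.
have [K /(_ y y0)[ip _]] := integrable_pvker_far rg.
have ir := integrable_reflect y ig.
have iy : itg (fun t => y * pvker g y t) by have := integrableZl measurableT y ip.
rewrite -(Rintegral_reflect y ig) -RintegralZl// -RintegralB//.
(* At [t = 0] both kernels take the junk value [0] and the identity fails. *)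
apply: eq_Rintegral_off0.
- apply: measurable_pvker; apply: measurable_funM => //.
- apply: measurable_funB; exact: integrable_measurable.
- move=> t t0; rewrite /pvker.
  by field.
Qed.

(* [H(xg)(y) = y Hg(y) - (1/pi) \int g] and [Hg(y) = O(1/|y|)]: letting [y] tend
   to infinity along zeros of [Hg] kills the moments one after the other. *)
Lemma hilbert_zeros_moments g (M : set R) : rapid_C1 g ->
  (forall A, exists2 y, M y & A <= `|y|) ->
  (forall y, M y -> real_hilbert g y = 0) ->
  forall k, \int[mu]_x (x ^+ k * g x) = 0.
Proof.
move=> rg unb Mg.
have {Mg} : forall y, M y -> y != 0 -> \int[mu]_t pvker g y t = 0.
  move=> y My y0; have [K /(_ y y0)[ip _]] := integrable_pvker_far rg.
  have := Mg y My; rewrite real_hilbertE//; last exact: rapid_C1_measurable.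
  by move=> /eqP; rewrite mulf_eq0 invr_eq0 gt_eqF ?pi_gt0//= => /eqP.
have base f : rapid_C1 f -> (forall y, M y -> y != 0 -> \int[mu]_t pvker f y t = 0) ->
    \int[mu]_x f x = 0.
  move=> rf Mf.
  have rf' := rapid_C1_mulx rf; have [K hK] := integrable_pvker_far rf'.
  (* At a zero [y] of the transform of [f], the kernel integral for [x f] is minus the integral of
     [f], while it is also [O(1 / |y|)]; arbitrarily large [|y|] leave only the value [0]. *)
  have KB A : 0 < A -> `|\int[mu]_x f x| * A <= K.
    move=> A0; have [y My Ay] := unb A; have y0 : 0 < `|y| by exact: lt_le_trans Ay.
    have y0' : y != 0 by rewrite -normr_gt0.
    have [_] := hK y y0'; rewrite Rintegral_pvker_mulx// Mf// mulr0 sub0r normrN.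
    by rewrite ler_pdivlMr//; apply: le_trans; rewrite ler_wpM2l.
  apply/eqP; rewrite -normr_le0 leNgt; apply/negP; move: `|_| KB => i KB i0.
  have := KB ((`|K| + 1) / i); rewrite divr_gt0 ?ltr_wpDl// => /(_ isT).
  by rewrite mulrC divfK ?gt_eqF// => h; have := ler_norm K; lra.
(* The vanishing on [M] passes from [g] to [x g] precisely because the integral of [g] is already
   known to be [0]. *)
move=> Mg k; elim: k g rg Mg => [|k IH] g rg Mg.
  by under eq_Rintegral do rewrite expr0 mul1r; exact: base.
rewrite -[RHS](IH _ (rapid_C1_mulx rg)).
  by apply: eq_Rintegral => x _; rewrite exprSr mulrA.
by move=> y My y0; rewrite Rintegral_pvker_mulx// Mg// mulr0 base// subr0.
Qed.

End vanishing_moments.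

(** * Functions with vanishing moments *)

Section moment_uniqueness.
Context {R : realType}.
Local Notation mu := (@lebesgue_measure R).
Local Notation itg f := (mu.-integrable setT (EFin \o f)).
Implicit Types (f u w : R -> R) (T s x : R).

Lemma integrable_expR_bound f (C : R) : measurable_fun setT f ->
  (forall x, `|f x| <= C * expR (- `|x|)) -> itg f.
Proof.
move=> mf fC; apply: (@integrable_inv_bound _ _ (2 * C) mf) => x.
have C0 : 0 <= C.
  by have := fC 0; rewrite normr0 oppr0 expR0 mulr1; apply: le_trans.
apply: (le_trans (fC x)); have p : 0 < 1 + x ^+ 2 by rewrite ltr_pwDl// sqr_ge0.
rewrite ler_pdivlMr// [2 * C]mulrC -mulrA ler_wpM2l// mulrC expRN ler_pdivrMr ?expR_gt0//.
have := expR_ge1Dxn 1 (normr_ge0 x); rewrite real_normK ?num_real// -[2`!]/2%N.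
have := sqr_ge0 x; lra.
Qed.

(** Terms of the power series of [(1 - cos (T s)) / s^2] in [s]. *)
Definition fejer_coeff T s (k : nat) : R :=
  (-1) ^+ k * T ^+ k.*2.+2 * s ^+ k.*2 / k.*2.+2`!%:R.

Lemma sum_fejer_coeff T s N :
  s ^+ 2 * \sum_(k < N) fejer_coeff T s k = 1 - series (cos_coeff' (T * s)) N.+1.
Proof.
rewrite /series/= big_mkord big_ord_recl /cos_coeff' expr0 expr0z mul1r fact0 divr1.
rewrite opprD addrA subrr add0r mulr_sumr -sumrN; apply: eq_bigr => k _.
rewrite /fejer_coeff lift0 doubleS -exprnP !exprMn !exprS.
by field.
Qed.

Lemma sum_even_expR_le (z : R) N : 0 <= z ->
  \sum_(k < N) z ^+ k.*2 / k.*2`!%:R <= expR z.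
Proof.
move=> z0; apply: (le_trans (y := series (exp_coeff z) N.*2)).
  elim: N => [|N IH]; first by rewrite big_ord0 /series/= big_nil.
  rewrite big_ord_recr doubleS /series/= !big_nat_recr//= -addrA lerD//.
  by rewrite lerDl /exp_coeff divr_ge0// exprn_ge0.
apply: nondecreasing_cvgn_le; last exact: is_cvg_series_exp_coeff.
by apply/nondecreasing_seqP => n; rewrite /series/= big_nat_recr//= lerDl divr_ge0// exprn_ge0.
Qed.

(** The bound is uniform in [N] but grows like [e^(|T| |s|)]; this is why [u] must decay faster than
    every exponential for termwise integration. *)
Lemma sum_fejer_coeff_bound T s N :
  `|\sum_(k < N) fejer_coeff T s k| <= T ^+ 2 * expR (`|T| * `|s|).
Proof.
apply: le_trans (ler_norm_sum _ _ _) _.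
have z0 : 0 <= `|T| * `|s| by rewrite mulr_ge0.
apply: le_trans (ler_wpM2l (sqr_ge0 T) (sum_even_expR_le N z0)).
rewrite mulr_sumr; apply: ler_sum => k _.
rewrite /fejer_coeff 3!normrM normfV 3!normrX normrN1 expr1n mul1r normr_nat.
rewrite mulrA exprMn mulrA -[T ^+ 2]real_normK ?num_real// -exprD add2n.
apply: ler_wpM2l; first by rewrite mulr_ge0// exprn_ge0.
rewrite lef_pV2 ?posrE ?ltr0n ?fact_gt0//.
by rewrite ler_nat leq_fact// -addn2 leq_addr.
Qed.

(** The value at [s = 0] is the limit, which is also the sum of the series there. *)
Definition fejer T s : R := if s == 0 then T ^+ 2 / 2 else (1 - cos (T * s)) / s ^+ 2.

Lemma fejer_ge0 T s : 0 <= fejer T s.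
Proof.
rewrite /fejer; case: ifP => _; first by rewrite divr_ge0// sqr_ge0.
by rewrite divr_ge0 ?sqr_ge0// subr_ge0 cos_le1.
Qed.

Lemma cvg_fejer T s : \sum_(k < N) fejer_coeff T s k @[N --> \oo] --> fejer T s.
Proof.
rewrite /fejer; have [->|s0] := eqVneq s 0.
  apply: cvg_near_cst; exists 1%N => // -[//|N] _.
  rewrite big_ord_recl big1 ?addr0 => [|k _].
    by rewrite /fejer_coeff !expr0 mul1r mulr1.
  by rewrite /fejer_coeff lift0 doubleS expr0n/= mulr0 mul0r.
have s20 : s ^+ 2 != 0 by rewrite expf_neq0.
have h : (1 - series (cos_coeff' (T * s)) N.+1) / s ^+ 2 @[N --> \oo]
    --> (1 - cos (T * s)) / s ^+ 2.
  apply: cvgMl; apply: cvgB; first exact: cvg_cst.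
  by rewrite cvg_shiftS; exact: cvg_cos_coeff'.
apply: cvg_trans h; apply: near_eq_cvg; apply: nearW => N.
by rewrite -sum_fejer_coeff mulrC mulrA mulVf// mul1r.
Qed.

(** Instead of a binomial expansion, one factor [x - x0] at a time is moved into [w], whose moments
    remain zero. *)
Lemma shifted_moments w x0 : (forall k, itg (fun x => x ^+ k * w x)) ->
  (forall k, \int[mu]_x (x ^+ k * w x) = 0) ->
  forall n, itg (fun x => (x - x0) ^+ n * w x) /\ \int[mu]_x ((x - x0) ^+ n * w x) = 0.
Proof.
move=> iw mw n; elim: n w iw mw => [|n IH] w iw mw.
  by split; [exact: (iw 0%N)|exact: (mw 0%N)].
have i2 k : itg (fun x => x0 * (x ^+ k * w x)).
  by have := integrableZl measurableT x0 (iw k).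
have e : (fun x => (x - x0) ^+ n.+1 * w x) = fun x => (x - x0) ^+ n * ((x - x0) * w x).
  by apply/funext => x; rewrite exprSr mulrA.
have ek k : (fun x => x ^+ k * ((x - x0) * w x)) = fun x => x ^+ k.+1 * w x - x0 * (x ^+ k * w x).
  by apply/funext => x; rewrite exprSr; ring.
rewrite e; apply: IH => k.
  by rewrite ek; have := integrableB measurableT (iw k.+1) (i2 k).
by rewrite ek RintegralB// RintegralZl// !mw mulr0 subr0.
Qed.

Section fejer_moments.
Variable u : R -> R.
Hypothesis mfu : measurable_fun setT u.
Hypothesis u_decay : forall N : R, exists2 C, 0 <= C & forall x, `|u x| <= C * expR (- (N * `|x|)).

Lemma integrable_moments k : itg (fun x => x ^+ k * u x).
Proof.
have [C C0 hC] := u_decay 2.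
apply: (@integrable_expR_bound _ (k`!%:R * C)).
  by apply: measurable_funM => //; exact: exprn_measurable.
move=> x; rewrite normrM normrX.
have h : `|x| ^+ k <= k`!%:R * expR `|x|.
  case: k => [|k]; last exact: expr_le_expR.
  by rewrite expr0 mul1r -expR0 ler_expR.
apply: le_trans (ler_pM _ _ h (hC x)) _; rewrite ?exprn_ge0//.
rewrite mulrACA -expRD ler_wpM2l ?mulr_ge0// ler_expR; lra.
Qed.

Hypothesis u_moments : forall k, \int[mu]_x (x ^+ k * u x) = 0.

Lemma Rintegral_fejer T x0 :
  itg (fun x => u x * fejer T (x - x0)) /\ \int[mu]_x (u x * fejer T (x - x0)) = 0.
Proof.
have S N : itg (fun x => u x * \sum_(k < N) fejer_coeff T (x - x0) k) /\
    \int[mu]_x (u x * \sum_(k < N) fejer_coeff T (x - x0) k) = 0.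
  elim: N => [|N [i0 e0]].
    rewrite (_ : (fun x => _) = cst 0).
      by split; [exact: integrable0|rewrite Rintegral_cst// mul0r].
    by apply/funext => x; rewrite big_ord0 mulr0.
  pose a := (-1) ^+ N * T ^+ N.*2.+2 / N.*2.+2`!%:R.
  have [iN eN] := shifted_moments x0 integrable_moments u_moments N.*2.
  have ia : itg (fun x => a * ((x - x0) ^+ N.*2 * u x)).
    by have := integrableZl measurableT a iN.
  have -> : (fun x => u x * \sum_(k < N.+1) fejer_coeff T (x - x0) k) =
      fun x => u x * \sum_(k < N) fejer_coeff T (x - x0) k + a * ((x - x0) ^+ N.*2 * u x).
    by apply/funext => x; rewrite big_ord_recr/= mulrDr; congr (_ + _); rewrite /fejer_coeff /a; ring.
  split; first by have := integrableD measurableT i0 ia.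
  by rewrite RintegralD// e0 RintegralZl// eN mulr0 addr0.
(* The rate [|T| + 1] beats the growth [e^(|T| |x - x0|)] of the partial sums and leaves [e^(-|x|)]
   for integrability. *)
have [C C0 hC] := u_decay (`|T| + 1).
pose D := C * T ^+ 2 * expR (`|T| * `|x0|).
have [|||||i e] := @Rdominated_convergence R
    (fun N x => u x * \sum_(k < N) fejer_coeff T (x - x0) k)
    (fun x => u x * fejer T (x - x0)) (fun x => D * expR (- `|x|)).
- by move=> N; apply: integrable_measurable; have [] := S N.
- apply: (@measurable_fun_cvg _ _ _ _ (fun N x => u x * \sum_(k < N) fejer_coeff T (x - x0) k)) => [N|x _].
    by apply: integrable_measurable; have [] := S N.
  by apply: cvgMr; exact: cvg_fejer.
- apply: (@integrable_expR_bound _ D).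
    apply: measurable_funM => //; apply: measurableT_comp => //.
    exact: measurable_funN.
  have D0 : 0 <= D by rewrite /D mulr_ge0 ?expR_ge0// mulr_ge0// sqr_ge0.
  by move=> x; rewrite ger0_norm// mulr_ge0// expR_ge0.
- move=> N x; rewrite normrM.
  apply: le_trans (ler_pM _ _ (hC x) (sum_fejer_coeff_bound _ _ _)) _ => //.
  rewrite mulrACA /D -[leRHS]mulrA; apply: ler_wpM2l; first by rewrite mulr_ge0// sqr_ge0.
  rewrite -!expRD ler_expR.
  have := ler_wpM2l (normr_ge0 T) (ler_normB x x0); lra.
- by move=> x; apply: cvgMr; exact: cvg_fejer.
split => //; have e' : (fun N => \int[mu]_x (u x * \sum_(k < N) fejer_coeff T (x - x0) k)) = cst 0.
  by apply/funext => N; have [] := S N.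
by apply: (cvg_unique (@Rhausdorff R) e); rewrite e'; exact: cvg_cst.
Qed.

End fejer_moments.

(** On this range the cosine is nonpositive, so the numerator is at least [1], and [s <= pi / T]. *)
Lemma fejer_ge_indicator T s : 0 < T -> pi / 2 <= T * s <= pi -> T ^+ 2 / pi ^+ 2 <= fejer T s.
Proof.
move=> T0 /andP[h1 h2]; have p0 := @pi_gt0 R.
have s0 : 0 < s by rewrite -(pmulr_rgt0 _ T0) (lt_le_trans _ h1)// divr_gt0.
rewrite /fejer gt_eqF//; apply: (le_trans (y := 1 / s ^+ 2)).
  rewrite ler_pdivrMr ?exprn_gt0// mulrAC ler_pdivlMr ?exprn_gt0// mul1r -exprMn.
  by rewrite lerXn2r// nnegrE ltW// mulr_gt0.
rewrite ler_pM2r ?invr_gt0 ?exprn_gt0// lerDl oppr_ge0.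
rewrite -[T * s](subrK (pi / 2)) cosDpihalf oppr_le0 sin_ge0_pi//.
by apply/andP; split; lra.
Qed.

Lemma fejer_le T s (d : R) : 0 < d -> d <= `|s| -> fejer T s <= 2 / d ^+ 2.
Proof.
move=> d0 ds; have s0 : s != 0 by rewrite -normr_gt0 (lt_le_trans d0).
rewrite /fejer (negPf s0); apply: ler_pM.
- by rewrite subr_ge0 cos_le1.
- by rewrite invr_ge0 sqr_ge0.
- by have := cos_geN1 (T * s); lra.
- have s20 : 0 < s ^+ 2 by rewrite exprn_even_gt0.
  rewrite lef_pV2 ?posrE ?s20 ?exprn_gt0//.
  by rewrite -[s ^+ 2]real_normK ?num_real// lerXn2r// nnegrE// ltW.
Qed.

(* If [u x0 > 0], the contribution of [pi / (2 T) <= x - x0 <= pi / T] to the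
   integral of [u] against the kernel grows linearly in [T], while the negative
   contribution stays bounded. *)
Lemma moments_le0 u : continuous u ->
  (forall N : R, exists2 C, 0 <= C & forall x, `|u x| <= C * expR (- (N * `|x|))) ->
  (forall k, \int[mu]_x (x ^+ k * u x) = 0) ->
  forall x0, u x0 <= 0.
Proof.
move=> cu du umom x0; have mfu := continuous_measurable_fun cu.
rewrite leNgt; apply/negP => ux0; pose eta := u x0 / 2.
have eta0 : 0 < eta by rewrite divr_gt0.
have [d d0 hd] : exists2 d : R, 0 < d & forall x, `|x - x0| < d -> eta <= u x.
  have /cvgrPdist_lt/(_ eta eta0) := cu x0.
  move=> /nbhs_ballP[d d0 h]; exists d => // x xd.
  have := h x; rewrite /ball/= distrC => /(_ xd); rewrite ltr_norml => /andP[_].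
  rewrite /eta; lra.
have iu : itg (fun x => `|u x|).
  have := integrable_moments mfu du 0%N.
  rewrite (_ : (fun x => _) = u); last by apply/funext => x; rewrite expr0 mul1r.
  by move/integrable_norm.
pose A := \int[mu]_x `|u x|.
have p0 := @pi_gt0 R.
(* The interval [J] has length [pi / (2 T)] and carries a kernel of size at least [T^2 / pi^2] with
   [u >= eta], which gives the left side. Elsewhere within [d] of [x0] the integrand is nonnegative,
   and beyond [d] the kernel is at most [2 / d^2]. *)
have key T : pi / T < d -> 0 < T -> eta * T / (2 * pi) <= 2 / d ^+ 2 * A.
  move=> Td T0; have [ik ek] := Rintegral_fejer mfu du umom T x0.
  pose J := `[x0 + pi / T / 2, x0 + pi / T]%classic : set R.
  have iJ : itg (fun x => eta * (T ^+ 2 / pi ^+ 2) * \1_J x).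
    by have := integrableZl measurableT (eta * (T ^+ 2 / pi ^+ 2)) (integrable_indic_itv (x0 + pi / T / 2) (x0 + pi / T) true false).
  have iA : itg (fun x => 2 / d ^+ 2 * `|u x|).
    by have := integrableZl measurableT (2 / d ^+ 2) iu.
  have iS : itg (fun x => u x * fejer T (x - x0) + 2 / d ^+ 2 * `|u x|).
    by have := integrableD measurableT ik iA.
  have pT : 0 < pi / T by rewrite divr_gt0.
  have : \int[mu]_x (eta * (T ^+ 2 / pi ^+ 2) * \1_J x) <=
      \int[mu]_x (u x * fejer T (x - x0) + 2 / d ^+ 2 * `|u x|).
    apply: le_Rintegral => // x _; have k0 := fejer_ge0 T (x - x0).
    have D0 : 0 <= 2 / d ^+ 2 * `|u x| by rewrite mulr_ge0// divr_ge0// sqr_ge0.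
    rewrite indicE; case: (boolP (x \in J)) => [|_]; rewrite ?mulr1 ?mulr0.
      rewrite inE /J/= in_itv/= => /andP[h1 h2].
      have xd : `|x - x0| < d by rewrite ger0_norm; lra.
      have := hd x xd => ue; rewrite ler_wpDr//.
      apply: ler_pM => //; [exact: ltW|by rewrite divr_ge0// sqr_ge0|].
      apply: fejer_ge_indicator => //.
      apply/andP; split; last by rewrite [T * _]mulrC -ler_pdivlMr//; lra.
      by rewrite [T * _]mulrC -ler_pdivrMr// mulrAC; lra.
    have [xd|xd] := ltP `|x - x0| d.
      by rewrite addr_ge0// mulr_ge0// (le_trans _ (hd x xd))// ltW.
    have h := fejer_le T d0 xd.
    have : - (`|u x| * (2 / d ^+ 2)) <= u x * fejer T (x - x0).
      rewrite lerNl -mulNr; apply: (le_trans (y := `|u x| * fejer T (x - x0))).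
        by rewrite ler_wpM2r// -normrN ler_norm.
      by rewrite ler_wpM2l.
    lra.
  rewrite RintegralD// ek add0r RintegralZl//; last exact: integrable_indic_itv.
  rewrite RintegralZl//.
  rewrite -/A; apply: le_trans.
  have -> : \int[mu]_x \1_J x = pi / T / 2.
    transitivity (fine (mu J)).
      rewrite /Rintegral integral_indic ?setIT//; exact: measurable_itv.
    rewrite lebesgue_measure_itv/= lte_fin ltrD2l.
    rewrite ifT; last lra.
    by rewrite -EFinB/=; lra.
  rewrite le_eqVlt; apply/orP; left; apply/eqP.
  have T1 : T != 0 by rewrite gt_eqF.
  have p1 : (pi : R) != 0 by rewrite gt_eqF.
  by move: (pi : R) p1 => P P0; field; rewrite T1.
have A0 : 0 <= 2 / d ^+ 2 * A.
  by rewrite mulr_ge0 ?divr_ge0 ?sqr_ge0// Rintegral_ge0.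
(* The first summand ensures [pi / T < d], the second reaches the threshold of [key], and the [1]
   exceeds it. *)
pose T := pi / d + 2 * pi * (2 / d ^+ 2 * A) / eta + 1.
have q1 : 0 < pi / d by rewrite divr_gt0.
have q2 : 0 <= 2 * pi * (2 / d ^+ 2 * A) / eta.
  by rewrite divr_ge0 ?(ltW eta0)// mulr_ge0// mulr_ge0// ltW.
have T0 : 0 < T by rewrite /T; lra.
have := key T; rewrite ltr_pdivrMr// mulrC -ltr_pdivrMr// => /(_ _ T0) h.
have {h} : eta * T / (2 * pi) <= 2 / d ^+ 2 * A by apply: h; rewrite /T; lra.
rewrite ler_pdivrMr ?mulr_gt0// mulrC -ler_pdivlMr//.
rewrite [_ * (2 * pi)]mulrC /T; lra.
Qed.

Lemma moments_eq0 u : continuous u ->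
  (forall N : R, exists2 C, 0 <= C & forall x, `|u x| <= C * expR (- (N * `|x|))) ->
  (forall k, \int[mu]_x (x ^+ k * u x) = 0) ->
  forall x, u x = 0.
Proof.
move=> cu du umom x; apply/eqP; rewrite eq_le; apply/andP; split.
  exact: moments_le0 du umom x.
rewrite -oppr_le0; apply: (@moments_le0 (fun x => - u x)) => [y|N|k].
- by apply: cvgN; exact: cu.
- by have [C C0 hC] := du N; exists C => // y; rewrite normrN.
- under eq_Rintegral do rewrite mulrN -mulN1r.
  rewrite RintegralZl// ?umom ?mulr0//.
  exact: integrable_moments (continuous_measurable_fun cu) du k.
Qed.

End moment_uniqueness.

(** * Conclusion *)

Section uniqueness.
Local Open Scope complex_scope.
Context {R : realType}.

Lemma expr_1D_norm_le (x : R) n : (1 + `|x|) ^+ n <= 2 ^+ n * (1 + `|x| ^+ n).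
Proof.
have x0 := normr_ge0 x; have xn : 0 <= `|x| ^+ n by rewrite exprn_ge0.
have t0 : 0 <= 2 ^+ n :> R by rewrite exprn_ge0.
have [x1|x1] := leP `|x| 1.
  apply: (le_trans (y := 2 ^+ n)); first by rewrite lerXn2r ?nnegrE//; lra.
  by rewrite ler_peMr// lerDl.
apply: (le_trans (y := (2 * `|x|) ^+ n)); first by rewrite lerXn2r ?nnegrE//; lra.
by rewrite exprMn ler_wpM2l// lerDr.
Qed.

Lemma real_hilbert_uniqueness (alpha c : R) (Lambda M : set R) (u : R -> R) :
  0 < alpha < 1 -> 0 < c ->
  (0%:E < lower_density (Phi1 c) Lambda)%E ->
  (0%:E < lower_density (Galpha alpha) M)%E ->
  (forall n x, derivable (derive1n n u) x 1) ->
  (forall m n, exists C, forall x, `|x| ^+ m * `|derive1n n u x| <= C) ->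
  (forall x, Lambda x -> u x = 0) -> (forall x, M x -> real_hilbert u x = 0) ->
  forall x, u x = 0.
Proof.
move=> ha c0 hL hM du bu uL uM.
have bnd n m : exists C, forall x, `|derive1n n u x| * (1 + `|x|) ^+ m <= C.
  have [C1 h1] := bu m n; have [C2 h2] := bu 0%N n.
  exists (2 ^+ m * (C2 + C1)) => x.
  apply: le_trans (ler_wpM2l (normr_ge0 _) (expr_1D_norm_le x m)) _.
  rewrite mulrCA ler_wpM2l ?exprn_ge0// mulrDr mulr1.
  by have := h1 x; have := h2 x; rewrite expr0 mul1r mulrC; lra.
have dd := is_derive_derive1n du.
apply: moments_eq0.
- by apply: is_derive_continuous; exact: (dd 0%N).
- apply: (superexponential_decay c0 hL du) => // n.
  by have [C hC] := bu 0%N n; exists C => x; have := hC x; rewrite expr0 mul1r.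
- apply: (hilbert_zeros_moments _ (Galpha_hits_unbounded ha hM) uM).
  exists (derive1n 1 u); split; first exact: (dd 0%N).
  move=> m; have [C1 h1] := bnd 0%N m; have [C2 h2] := bnd 1%N m.
  exists (Num.max C1 C2) => x; rewrite !le_max.
  by split; [rewrite (h1 x)|rewrite (h2 x) orbT].
Qed.

End uniqueness.

Theorem corollary1p5 (R : realType) (alpha p q : R)
    (halpha : 0 < alpha < 1) (hp : 0 < p < 1) (hq : 0 < q < 1)
    (Lambda M : set R)
    (hLambda : discrete_set Lambda) (hM : discrete_set M) :
  ((exists c : R, [/\ 0 < c,
      (0%:E < lower_density (Phi1 c) Lambda)%E &
      (0%:E < lower_density (Galpha alpha) M)%E]) ->
    uniqueness_pair (@hilbert R) [set f | schwartz f] Lambda M)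
  /\
  ((upper_density (Galpha alpha) Lambda < +oo)%E ->
   (upper_density (Galpha alpha) M < +oo)%E ->
    non_uniqueness_pair (@hilbert R)
      ([set f | schwartz_hilbert p q f] `&` [set f | real_analytic f])
      Lambda M).
Proof.
split; last exact: finite_density_non_uniqueness.
move=> [c [c0 hL hM']] f [sf bf] fL fM x.
(* The transform acts on real and imaginary parts separately, so the real-valued statement applies
   to each. *)
apply: eq_ReIm.
- apply: (@real_hilbert_uniqueness R alpha c Lambda M (Re_fun f)) => //.
  + by move=> n y; have [] := sf n y.
  + move=> m n; have [C hC] := bf m n; exists C => y.
    apply: le_trans (hC y); rewrite ler_wpM2l ?exprn_ge0//.
    exact: (Re_le_normc (cderiven n f y)).
  + by move=> y Ly; rewrite /Re_fun fL.
  + by move=> y My; have := fM y My; rewrite /hilbert => /(congr1 (@complex.Re R)).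
- apply: (@real_hilbert_uniqueness R alpha c Lambda M (Im_fun f)) => //.
  + by move=> n y; have [] := sf n y.
  + move=> m n; have [C hC] := bf m n; exists C => y.
    apply: le_trans (hC y); rewrite ler_wpM2l ?exprn_ge0//.
    exact: (Im_le_normc (cderiven n f y)).
  + by move=> y Ly; rewrite /Im_fun fL.
  + by move=> y My; have := fM y My; rewrite /hilbert => /(congr1 (@complex.Im R)).
Qed.
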